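(* Let $\delta>0$. The set $\mathcal{IC}^e_1(C^\omega_\delta(S))$ of functions $f\in C^\omega_\delta(S)$ whose corresponding family $F_{r,a}:x\mapsto x+2\pi r+a f(x) \pmod{2\pi}$ has infinitesimal cyclicity essentially bounded by $1$ is Haar prevalent.
   Context: Let $S=\mathbb{R}/2\pi\mathbb{Z}$ be the circle. $C^\omega_\delta(S)$ denotes the space of real analytic $2\pi$-periodic functions which can be analytically continued to the strip $\mathbb{R}\times(-\delta i,\delta i)\subset\mathbb{C}$, with norm $\|f\|_{C^\omega_\delta(S)}=\sup_{|\mathrm{Im}\, z|<\delta}|f(z)|$. Let $X$ be a complete separable normed linear space. A Borel subset $E$ of $X$ is called a Haar null set if there is a Borel probability measure $\mu$ such that $\mu(x+E)=0$ for all $x\in X$. The complement of a Haar null set is called Haar prevalent. For a $2\pi$-periodic function $f$, the corresponding family is the family of circle diffeomorphisms $F_{r,a}: x\mapsto x+2\pi r+a f(x) \pmod{2\pi}$, where $r\in\mathbb{R}$ and $a\in[-a_0,a_0]$. For a circle diffeomorphism $g$, $N(g)$ is the number of attracting periodic trajectories of $g$ and $\rho(g)$ is the rotation number of $g$ (the rotation $x\mapsto x+2\pi r$ has rotation number $r$). Define $$B(F,\rho_0)=\limsup_{a_1\to 0+}\ \sup_{\rho(F_{r,a})=\rho_0,\ |a|<a_1} N(F_{r,a}).$$ The infinitesimal cyclicity of the family $F_{r,a}$ is essentially bounded by $N$ if there exists $Q\in\mathbb{N}$ such that $B(F,\tfrac pq)\le N$ for all coprime $p,q\in\mathbb{N}$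 with $q\ge Q$ (in other words, if the period is large enough, at most $N$ periodic attractors of this period can appear from the rigid rotation). *)

(* Defs.v *)
From HB Require Import structures.
From mathcomp Require Import all_boot all_order all_algebra.
From mathcomp Require Import all_classical all_reals all_analysis.
From mathcomp Require Import complex.
From mathcomp Require Import ring lra.

Set Implicit Arguments.
Unset Strict Implicit.
Unset Printing Implicit Defensive.

Import Order.TTheory GRing.Theory Num.Theory.
Import numFieldNormedType.Exports.

Local Open Scope classical_set_scope.
Local Open Scope ring_scope.

Definition analytic_at (K : numFieldType) (g : K -> K) (z0 : K) :=
  exists c : nat -> K, \forall z \near z0,
    series (fun n => c n * (z - z0) ^+ n) @ \oo --> g z.

Lemma analytic_at0 (K : numFieldType) (z0 : K) : analytic_at (fun=> 0) z0.
Proof.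
exists (fun=> 0); near=> z.
rewrite (_ : series _ = cst 0); first exact: cvg_cst.
by apply/funext => n; rewrite /series /= big1// => i _; rewrite mul0r.
Unshelve. all: by end_near. Qed.

Lemma analytic_atD (K : numFieldType) (g h : K -> K) z0 :
  analytic_at g z0 -> analytic_at h z0 -> analytic_at (g \+ h) z0.
Proof.
move=> [c gc] [d hd]; exists (fun n => c n + d n).
near=> z.
have cg : series (fun n => c n * (z - z0) ^+ n) @ \oo --> g z by near: z.
have dh : series (fun n => d n * (z - z0) ^+ n) @ \oo --> h z by near: z.
suff -> : series (fun n => (c n + d n) * (z - z0) ^+ n) =
    series (fun n => c n * (z - z0) ^+ n) +
    series (fun n => d n * (z - z0) ^+ n) by exact: cvgD.
apply/funext => n; rewrite fctE /series /= -big_split /=.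
by apply: eq_bigr => i _; rewrite mulrDl.
Unshelve. all: by end_near. Qed.

Lemma analytic_atZ (K : numFieldType) (a : K) (g : K -> K) z0 :
  analytic_at g z0 -> analytic_at (fun z => a * g z) z0.
Proof.
move=> [c gc]; exists (fun n => a * c n).
apply: filterS gc => z gz.
suff -> : series (fun n => a * c n * (z - z0) ^+ n) =
    (fun n => a * series (fun n => c n * (z - z0) ^+ n) n) by exact: cvgMr.
apply/funext => n; rewrite /series /= mulr_sumr.
by apply: eq_bigr => i _; rewrite mulrA.
Qed.

Lemma geometric_half_le2 (K : numFieldType) n :
  \sum_(0 <= i < n) 2^-1 ^+ i <= 2 :> K.
Proof.
have : \sum_(0 <= i < n) 2^-1 ^+ i = 2 - 2 * 2^-1 ^+ n :> K.
  elim: n => [|n IH]; first by rewrite big_geq// expr0 mulr1 subrr.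
  by rewrite big_nat_recr//= IH exprS mulrA divff// mul1r; ring.
by move=> ->; rewrite gerBl mulr_ge0// exprn_ge0// invr_ge0.
Qed.

Lemma zeros_cluster_coef (K : numFieldType) (g : K -> K) (z0 : K)
    (c : nat -> K) :
  (\forall z \near z0, series (fun n => c n * (z - z0) ^+ n) @ \oo --> g z) ->
  (forall e : K, 0 < e -> exists z, [/\ z != z0, `|z - z0| < e & g z = 0]) ->
  forall n, c n = 0.
Proof.
move=> /nbhs_ballP[s0 /= s0_gt0 gs] acc n.
elim/ltn_ind: n => n IH; apply/eqP; apply: contraT => cn0.
have cn_gt0 : 0 < `|c n| by rewrite normr_gt0.
pose s := s0 / 2; have s_gt0 : 0 < s by rewrite divr_gt0.
have s_lt : s < s0 by rewrite ltr_pdivrMr// ltr_pMr// ltr1n.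
have [M M_gt0 cM] : exists2 M, 0 < M & forall k, `|c k| * s ^+ k <= M.
  have : ball z0 s0 (z0 + s).
    by rewrite -ball_normE /= opprD addrA subrr add0r normrN gtr0_norm.
  move=> /gs; rewrite addrAC subrr add0r => cs.
  have /cvgP/cvg_seq_bounded bs := cvg_series_cvg_0 (cvgP _ cs).
  have [M M_gt0 HM] := pinfty_ex_gt0 bs.
  exists M => // k; have := HM k Logic.I.
  by rewrite /= normrM normrX (gtr0_norm s_gt0).
pose e1 := s / 2; pose e2 := `|c n| * s ^+ n.+1 / (4 * M).
have e1_gt0 : 0 < e1 by rewrite divr_gt0.
have e2_gt0 : 0 < e2 by rewrite divr_gt0 ?mulr_gt0 ?exprn_gt0.
have e12 : e1 >=< e2 by rewrite real_comparable// gtr0_real.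
have [|z [zz0 ze gz0]] := acc (Num.min e1 e2).
  by rewrite comparable_lt_min// e1_gt0.
move: ze; rewrite comparable_lt_min// => /andP[ze1 ze2].
pose r := `|z - z0|; have r_gt0 : 0 < r by rewrite normr_gt0 subr_eq0.
pose t := r / s; have t_ge0 : 0 <= t by rewrite divr_ge0// ltW.
have t_le : t <= 2^-1 by rewrite ler_pdivrMr// mulrC ltW.
have /gs : ball z0 s0 z.
  rewrite -ball_normE /= distrC (lt_trans ze1)//.
  by rewrite ltr_pdivrMr// (lt_trans s_lt)// ltr_pMr// ltr1n.
rewrite gz0 => /cvgr_dist_lt /(_ (`|c n| * r ^+ n / 2)).
have /[swap]/[apply] : 0 < `|c n| * r ^+ n / 2.
  by rewrite divr_gt0// mulr_gt0// exprn_gt0.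
move=> [N _ /(_ (N + n.+1)%N (leq_addr _ _))].
rewrite /= sub0r normrN /series /=.
rewrite (big_cat_nat _ (n := n.+1))//= ?leq_addl//.
rewrite big_nat_recr//= big_nat_cond big1 ?add0r; last first.
  by move=> i; rewrite andbT => /IH ->; rewrite mul0r.
set rest := \sum_(n.+1 <= _ < _) _.
have rest_le : `|rest| <= `|c n| * r ^+ n / 2.
  apply: (@le_trans _ _ (2 * M * t ^+ n.+1)).
    rewrite /rest -{1}(add0n n.+1) big_addn addnK.
    apply: (le_trans (ler_norm_sum _ _ _)).
    apply: (@le_trans _ _ (\sum_(0 <= i < N) M * t ^+ n.+1 * 2^-1 ^+ i)).
      apply: ler_sum => i _; rewrite normrM normrX.
      apply: (@le_trans _ _ (M * t ^+ (i + n.+1))).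
        rewrite /t expr_div_n mulrA ler_pdivlMr ?exprn_gt0//.
        by rewrite mulrAC ler_wpM2r// exprn_ge0.
      rewrite exprD -mulrA ler_wpM2l ?(ltW M_gt0)// mulrC.
      by rewrite ler_wpM2l ?exprn_ge0// lerXn2r ?nnegrE ?invr_ge0.
    rewrite -mulr_sumr -[leRHS]mulrA [leRHS]mulrC.
    by rewrite ler_wpM2l ?mulr_ge0 ?exprn_ge0 ?(ltW M_gt0)// geometric_half_le2.
  rewrite /t expr_div_n mulrA ler_pdivrMr ?exprn_gt0// exprS.
  move: ze2; rewrite /e2 ltr_pdivlMr ?mulr_gt0// => /ltW.
  have rn2 : 0 <= r ^+ n / 2 by rewrite divr_ge0// exprn_ge0// ltW.
  move=> /(ler_wpM2r rn2); rewrite -/r exprS.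
  have -> : r * (4 * M) * (r ^+ n / 2) = 2 * M * (r * r ^+ n) by field.
  by have -> : `|c n| * (s * s ^+ n) * (r ^+ n / 2) =
    `|c n| * r ^+ n / 2 * (s * s ^+ n) by field.
move=> lt1.
have : `|c n * (z - z0) ^+ n| < `|c n| * r ^+ n.
  rewrite -[ltLHS](congr1 Num.norm (addrK rest _)).
  rewrite (le_lt_trans (ler_normB _ _))//.
  rewrite [ltRHS](_ : _ = `|c n| * r ^+ n / 2 + `|c n| * r ^+ n / 2).
    by rewrite ltr_leD.
  by rewrite -splitr.
by rewrite normrM normrX ltxx.
Qed.

Lemma zeros_cluster_near (K : numFieldType) (g : K -> K) (z0 : K) :
  analytic_at g z0 ->
  (forall e : K, 0 < e -> exists z, [/\ z != z0, `|z - z0| < e & g z = 0]) ->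
  \forall z \near z0, g z = 0.
Proof.
move=> [c gc] acc; have c0 := zeros_cluster_coef gc acc.
apply: filterS gc => z gz; apply/esym.
have s0 : series (fun n => c n * (z - z0) ^+ n) = cst 0.
  by apply/funext => n; rewrite /series /= big1// => i _; rewrite c0 mul0r.
move: gz; rewrite s0 => gz.
exact: (@cvg_unique K _ _ _ _ _ (@cvg_cst K _ _ _ _) gz).
Qed.

Section AnalyticStrip.
Variable R : realType.
Local Notation C := (R[i]).
Implicit Types (delta : R) (f : R -> R) (g : C -> C).

Definition strip delta : set C := [set z | `|complex.Im z| < delta].

Definition is_continuation delta f g :=
  (forall z, strip delta z -> analytic_at (g : (C : numFieldType) -> _) z) /\
  (forall x : R, g (x%:C)%C = (f x)%:C%C).

Definition bounded_on_strip delta g :=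
  exists M : R, forall z, strip delta z -> Normc.normc (g z) <= M.

Definition Comega_pred delta : {pred R -> R} := fun f =>
  `[< (forall x, f (x + 2 * pi) = f x) /\
      exists2 g, is_continuation delta f g & bounded_on_strip delta g >].

Let pt (x y s : R) : C := Complex x (s * y).

Lemma normc_normE (z : C) : `|z| = (Normc.normc z)%:C%C.
Proof. by case: z => a b; rewrite normc_def. Qed.

Lemma normc_ge0 (z : C) : 0 <= Normc.normc z.
Proof. by case: z => a b; exact: sqrtr_ge0. Qed.

Lemma gtc0E (e : C) : 0 < e -> exists2 r : R, 0 < r & e = r%:C%C.
Proof.
case: e => a b; rewrite ltcE/= => /andP[/eqP -> a0].
by exists a.
Qed.

Let norm_ptB x y s t : `|pt x y s - pt x y t| = (`|s - t| * `|y|)%:C%C.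
Proof.
rewrite normc_def /= subrr expr0n add0r -mulrBl.
by rewrite sqrtr_sqr normrM.
Qed.

Let pt_near x y t (P : set C) :
  (\forall z \near (pt x y t : (C : numFieldType)), P z) ->
  exists2 e : R, 0 < e & forall s, `|s - t| < e -> P (pt x y s).
Proof.
move=> /nbhs_ballP[_ /= /gtc0E[e e0 ->] eP].
have y1 : 0 < 1 + `|y| by rewrite ltr_pwDl.
exists (e / (1 + `|y|)) => [|s st]; first by rewrite divr_gt0.
apply: eP; rewrite -ball_normE /= distrC norm_ptB ltcR.
rewrite (@le_lt_trans _ _ (`|s - t| * (1 + `|y|)))//.
  by rewrite ler_wpM2l// lerDr.
by rewrite -ltr_pdivlMr.
Qed.

Lemma strip_identity delta g :
  (forall z, strip delta z -> analytic_at (g : (C : numFieldType) -> _) z) ->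
  (forall x : R, g (x%:C)%C = 0) -> forall z, strip delta z -> g z = 0.
Proof.
move=> ga g0 [x y] /= zd.
have [->|y0] := eqVneq y 0; first exact: g0.
pose S := [set t : R | 0 <= t <= 1 /\
  forall s, 0 <= s <= t -> g (pt x y s) = 0].
have S0 : S 0.
  split; first by rewrite lexx ler01.
  by move=> s s0; rewrite (_ : s = 0) ?/pt ?mul0r; [exact: g0|apply: le_anti; rewrite andbC].
have ubS : ubound S 1 by move=> t [/andP[]].
have hS : has_sup S by split; [exists 0|exists 1].
pose T := sup S.
have T0 : 0 <= T by apply: ub_le_sup => //; exists 1.
have T1 : T <= 1 by apply: ge_sup => //; exists 0.
have below s : 0 <= s -> s < T -> g (pt x y s) = 0.
  move=> s0 sT; have [|u [_ Su]] := sup_gt _ sT; first by exists 0.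
  by move=> su; apply: Su; rewrite s0 ltW.
have /ga gaT : strip delta (pt x y T).
  rewrite /strip /= normrM (ger0_norm T0); apply: le_lt_trans zd.
  by rewrite ler_piMl.
have /pt_near[e e0 eT] : \forall z \near (pt x y T : (C : numFieldType)), g z = 0.
  apply: zeros_cluster_near => // _ /gtc0E[e e0 ->].
  have [T00|Tn0] := eqVneq T 0.
    exists ((x + e / 2)%:C)%C; split => //; rewrite /pt T00 mul0r.
      rewrite eq_complex /= eqxx andbT -subr_eq0 addrAC subrr add0r.
      by rewrite gt_eqF// divr_gt0.
    rewrite normc_def /= subrr expr0n addr0 addrAC subrr add0r sqrtr_sqr ltcR.
    by rewrite gtr0_norm ?divr_gt0// ltr_pdivrMr// ltr_pMr// ltr1n.
  have Tgt0 : 0 < T by rewrite lt_neqAle eq_sym Tn0.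
  have y1 : 0 < 1 + `|y| by rewrite ltr_pwDl.
  pose d := Num.min (T / 2) (e / (1 + `|y|)).
  have d0 : 0 < d by rewrite lt_min !divr_gt0.
  have dT : d < T.
    by rewrite gt_min ltr_pdivrMr// ltr_pMr// ltr1n.
  exists (pt x y (T - d)); split.
  - rewrite eq_complex /= eqxx /= -subr_eq0 -mulrBl mulf_neq0//.
    by rewrite addrAC subrr add0r oppr_eq0 gt_eqF.
  - rewrite norm_ptB ltcR addrAC subrr add0r normrN gtr0_norm//.
    rewrite (@lt_le_trans _ _ (d * (1 + `|y|)))//.
      by rewrite ltr_pM2l// ltrDr.
    by rewrite -ler_pdivlMr// /d ge_min lexx orbT.
  - by apply: below; rewrite ?subr_ge0 ?(ltW dT)// gtrBl.
suff T1E : T = 1.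
  have := eT 1; rewrite T1E subrr normr0 => /(_ e0).
  by rewrite /pt mul1r.
apply/eqP; rewrite eq_le T1 /= leNgt; apply/negP => Tlt1.
pose u := Num.min 1 (T + e / 2).
have Tu : T < u by rewrite lt_min Tlt1 ltrDl divr_gt0.
suff : S u by move=> /(ub_le_sup (ex_intro _ 1 ubS)); rewrite leNgt Tu.
split; first by rewrite ge_min lexx (le_trans T0 (ltW Tu)).
move=> s /andP[s0 su]; have [/(below _ s0)//|Ts] := ltP s T.
apply: eT; rewrite ger0_norm ?subr_ge0// ltrBlDl (le_lt_trans su)//.
rewrite gt_min; apply/orP; right; rewrite ltrD2l.
by rewrite ltr_pdivrMr// ltr_pMr// ltr1n.
Qed.

Lemma is_continuationD delta f1 f2 g1 g2 :
  is_continuation delta f1 g1 -> is_continuation delta f2 g2 ->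
  is_continuation delta (f1 + f2) (g1 \+ g2).
Proof.
move=> [a1 e1] [a2 e2]; split => [z zd|x].
  by apply: analytic_atD; [exact: a1|exact: a2].
by rewrite /= e1 e2 -rmorphD.
Qed.

Lemma is_continuationZ delta f g (a : R) :
  is_continuation delta f g ->
  is_continuation delta (a *: f) (fun z => a%:C%C * g z).
Proof.
move=> [ag eg]; split => [z zd|x]; first by apply: analytic_atZ; exact: ag.
by rewrite /= eg -rmorphM.
Qed.

Lemma is_continuation_unique delta f g1 g2 :
  is_continuation delta f g1 -> is_continuation delta f g2 ->
  forall z, strip delta z -> g1 z = g2 z.
Proof.
move=> [a1 e1] [a2 e2] z zd.
pose h := g1 \+ (fun z => -1 * g2 z).
suff : h z = 0 by rewrite /h /= mulN1r => /eqP; rewrite subr_eq0 => /eqP.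
apply: (@strip_identity delta) zd => [w wd|x].
  by apply: analytic_atD; [exact: a1|apply: analytic_atZ; exact: a2].
by rewrite /h /= e1 e2 mulN1r subrr.
Qed.

(* Only the values on the strip are meaningful; there they do not depend on the
   choice, by is_continuation_unique. *)
Definition continuation delta f : C -> C :=
  xget (fun=> 0) [set g | is_continuation delta f g].

Lemma continuationE delta f g : is_continuation delta f g ->
  forall z, strip delta z -> continuation delta f z = g z.
Proof.
move=> fg; apply: (is_continuation_unique _ fg).
exact: (xgetPex _ (ex_intro _ g fg)).
Qed.

Lemma Comega_submod_closed delta : submod_closed (Comega_pred delta).
Proof.
split.
  apply/asboolP; split => //; exists (fun=> 0); last first.
    by exists 0 => z _; rewrite Normc.normc0.
  by split => // z _; exact: analytic_at0.
move=> a f1 f2 /asboolP[p1 [g1 c1 [M1 b1]]] /asboolP[p2 [g2 c2 [M2 b2]]].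
apply/asboolP; split; first by move=> x; rewrite !fctE p1 p2.
exists ((fun z => a%:C%C * g1 z) \+ g2).
  exact: is_continuationD (is_continuationZ _ c1) c2.
exists (`|a| * M1 + M2) => z zd; apply: le_trans (le_normcD _ _) _.
rewrite lerD ?b2// Normc.normcM ler_pM ?b1//.
- by rewrite normc_ge0.
- by rewrite normc_ge0.
- by rewrite /= expr0n addr0 sqrtr_sqr lexx.
Qed.

HB.instance Definition _ delta :=
  GRing.isSubmodClosed.Build R (R -> R) (Comega_pred delta)
    (Comega_submod_closed delta).

End AnalyticStrip.

Record Comega (R : realType) (delta : {posnum R}) := MkComega {
  Comega_fun :> R -> R;
  _ : Comega_fun \in Comega_pred delta%:num }.

Section ComegaNormed.
Variables (R : realType) (delta : {posnum R}).

HB.instance Definition _ := [isSub for @Comega_fun R delta].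
HB.instance Definition _ := [Choice of Comega delta by <:].
HB.instance Definition _ := [SubChoice_isSubLmodule of Comega delta by <:].

Implicit Types f g : Comega delta.

Definition Comega_norm f : R :=
  sup [set Normc.normc (continuation delta%:num f z) | z in strip delta%:num].

Let Comega_continuation f :
  exists2 g, is_continuation delta%:num f g & bounded_on_strip delta%:num g.
Proof. by case: f => f /= /asboolP[]. Qed.

Let strip0 (x : R) : strip delta%:num x%:C%C.
Proof. by rewrite /strip /= normr0. Qed.

Let continuation_spec f :
  is_continuation delta%:num f (continuation delta%:num f).
Proof.
have [g fg _] := Comega_continuation f.
exact: (xgetPex _ (ex_intro _ g fg)).
Qed.

Let norm_ub f z : strip delta%:num z ->
  Normc.normc (continuation delta%:num f z) <= Comega_norm f.
Proof.
move=> zd; have [g fg [M gM]] := Comega_continuation f.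
apply: ub_le_sup; last by exists z.
by exists M => _ [w wd <-]; rewrite (continuationE fg)// gM.
Qed.

Let norm_le f (M : R) :
  (forall z, strip delta%:num z ->
    Normc.normc (continuation delta%:num f z) <= M) -> Comega_norm f <= M.
Proof.
move=> fM; apply: ge_sup; last by move=> _ [z zd <-]; exact: fM.
by exists (Normc.normc (continuation delta%:num f 0%:C%C)), 0%:C%C.
Qed.

Let norm_ge0 f : 0 <= Comega_norm f.
Proof. exact: le_trans (normc_ge0 _) (norm_ub f (strip0 0)). Qed.

Let norm_triangle f g :
  Comega_norm (f + g) <= Comega_norm f + Comega_norm g.
Proof.
apply: norm_le => z zd.
rewrite (continuationE
  (is_continuationD (continuation_spec f) (continuation_spec g)))//.
by apply: le_trans (le_normcD _ _) _; rewrite lerD// norm_ub.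
Qed.

Let norm_scale_le (a : R) f : Comega_norm (a *: f) <= `|a| * Comega_norm f.
Proof.
apply: norm_le => z zd.
rewrite (continuationE (is_continuationZ a (continuation_spec f)))//.
by rewrite Normc.normcM /= expr0n addr0 sqrtr_sqr ler_wpM2l// norm_ub.
Qed.

Let norm_scale (a : R) f : Comega_norm (a *: f) = `|a| * Comega_norm f.
Proof.
apply/eqP; rewrite eq_le norm_scale_le /=.
have [->|a0] := eqVneq a 0; first by rewrite normr0 mul0r norm_ge0.
rewrite -ler_pdivlMl ?normr_gt0// -normfV.
apply: le_trans (norm_scale_le _ _).
by rewrite scalerA mulVf// scale1r.
Qed.

Let norm_eq0 f : Comega_norm f = 0 -> f = 0.
Proof.
move=> f0; apply/val_inj/funext => x.
have := norm_ub f (strip0 x); rewrite f0 (continuation_spec f).2 /=.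
by rewrite expr0n addr0 sqrtr_sqr normr_le0 => /eqP.
Qed.

HB.instance Definition _ := Lmodule_isNormed.Build R (Comega delta)
  norm_triangle norm_scale norm_eq0.

End ComegaNormed.

Section HaarNull.
Variables (R : realType) (X : normedModType R).

(* The definition makes sense in every normed space, so completeness and
   separability of X are not required; Comega delta is not separable. *)
Definition borel_set (E : set X) := <<s @open X >> E.

Definition haar_null (E : set X) :=
  borel_set E /\
  exists mu : probability (g_sigma_algebraType (@open X)) R,
    forall x : X, mu [set x + y | y in E] = 0%E.

Definition haar_prevalent (E : set X) := haar_null (~` E).

End HaarNull.

Section CircleDynamics.
Variable R : realType.

(* A map of the circle R/2piZ is given by a lift G : R -> R, and a subset of the
   circle by its 2pi-periodic preimage in R. *)
Implicit Types (G : R -> R) (O : set R).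

Definition circle_diffeo G :=
  [/\ forall x, G (x + 2 * pi) = G x + 2 * pi,
      forall x, derivable G x 1,
      continuous (derive1 G) &
      forall x, 0 < derive1 G x].

Definition circle_eq (x y : R) := exists k : int, x = y + k%:~R * (2 * pi).

(* rho0 is taken modulo 1. *)
Definition has_rotation_number G (rho0 : R) :=
  exists k : int, forall x,
    (fun n => (iter n G x - x) / (n%:R * (2 * pi))) @ \oo --> rho0 + k%:~R.

Definition circle_periodic G x := exists2 n, (0 < n)%N & circle_eq (iter n G x) x.

Definition trajectory G x : set R :=
  [set y | exists n, circle_eq y (iter n G x)].

Definition thickening O (e : R) : set R := [set y | exists2 z, O z & `|y - z| < e].

(* Asymptotic stability. The stability clause excludes a semistable trajectory
   whose points return to it after going around the circle. *)
Definition attracting G O :=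
  (forall e, 0 < e -> exists2 d, 0 < d &
     forall y, thickening O d y -> forall n, thickening O e (iter n G y)) /\
  (exists2 d, 0 < d & forall y, thickening O d y -> forall e, 0 < e ->
     \forall n \near \oo, thickening O e (iter n G y)).

Definition num_attracting G : \bar R :=
  counting [set O | exists x,
    [/\ circle_periodic G x, O = trajectory G x & attracting G O]].

(* F r a is the (lift of the) diffeomorphism with parameters r in R and a in
   [-a0, a0]. *)
Implicit Types F : R -> R -> R -> R.

Definition infinitesimal_cyclicity (a0 : R) F (rho0 : R) : \bar R :=
  limf_esup (fun a1 : R => ereal_sup [set num_attracting (F p.1 p.2) | p in
    [set p : R * R | [/\ `|p.2| <= a0, `|p.2| < a1 &
                         has_rotation_number (F p.1 p.2) rho0]]])
    0^'+.

Definition essentially_bounded (a0 : R) F (N : nat) :=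
  exists Q : nat, forall p q : nat, coprime p q -> (0 < q)%N -> (Q <= q)%N ->
    (infinitesimal_cyclicity a0 F (p%:R / q%:R) <= N%:R%:E)%E.

Definition family (f : R -> R) (r a x : R) : R := x + 2 * pi * r + a * f x.

(* Only small values of a matter in infinitesimal_cyclicity, so any a0 for which
   all the maps are diffeomorphisms gives the same condition. *)
Definition ICe (N : nat) (delta : {posnum R}) : set (Comega delta) :=
  [set f | exists a0 : R,
    [/\ 0 < a0,
        forall r a, `|a| <= a0 -> circle_diffeo (family f r a) &
        essentially_bounded a0 (family f) N]].

End CircleDynamics.

(* Main.v *)
Require Import Defs.
From HB Require Import structures.
From mathcomp Require Import all_boot all_order all_algebra.
From mathcomp Require Import all_classical all_reals all_analysis.
From mathcomp Require Import complex finmap measurable_realfun.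
From mathcomp Require Import zify ring lra.

Set Implicit Arguments.
Unset Strict Implicit.
Unset Printing Implicit Defensive.

Import Order.TTheory GRing.Theory Num.Theory.
Import numFieldNormedType.Exports.

Local Open Scope classical_set_scope.
Local Open Scope ring_scope.

(* Near the rotation by 2 pi p / q, the displacement of the q-th iterate of F_{r,a} is
   a constant plus a times the average of f over the orbits of that rotation, up to
   O(a^2) in C^2.  The average only involves the Fourier modes of f of frequencies
   q, 2q, 3q, ...  If the mode of frequency q dominates, the displacement oscillates
   essentially like a single harmonic, so between two neighbouring points of a
   periodic trajectory there is no room for a second attracting trajectory.

   All f in C^omega_delta have Fourier coefficients O(exp(-eta n)) for each
   eta < delta.  Let h be the Poisson kernel with coefficients 2 rho^n,
   rho = exp(-7 delta / 6).  For a fixed g, the parameters w in [0, 1] such that the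
   q-th mode of g + w h fails to dominate lie in an interval of length O(tau^q),
   tau < 1.  By Borel-Cantelli almost every w is good for all large q, so the image of
   the uniform measure under w |-> w h is a witness of Haar nullity. *)

(** * Germs of analytic functions *)

(** Cyclicity is a limsup as [a] tends to 0 for fixed [p] and [q], so the perturbation estimates
    need no uniformity in [q]. Only the dominance of the frequency [q] must hold for all large [q],
    and this is the only place where the random parameter [w] enters. The frequency [q] competes
    only with its multiples from [2q] on, which are O(exp(-2 eta q)). This leaves room for a probe
    whose coefficients decay a little faster than exp(-delta n), so that it is bounded on the strip,
    yet slower than exp(-2 eta n). One probe serves every [g]: changing [g] moves the exceptional
    intervals and changes their lengths only by a constant factor. A Haar null set must also be
    Borel. For this, attraction is replaced by signs of the displacement, and the way back from
    signs to attraction uses that zeros of analytic functions are isolated unless the function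
    vanishes nearby. Analyticity is given by local power series. Contour integrals are replaced by
    an invariant mean and a quantitative form of the Cauchy-Riemann equations, and the higher
    derivatives on the real line come from the Fourier series. *)

Section ComplexNorm.
Variable R : realType.
Local Notation C := (R[i]).
Local Notation N := (@Normc.normc R).
Implicit Types z w : C.

Lemma normc_real (x : R) : N (x%:C)%C = `|x|.
Proof. by rewrite /= expr0n addr0 sqrtr_sqr. Qed.

Lemma normcN z : N (- z) = N z.
Proof. by case: z => a b /=; rewrite !sqrrN. Qed.

Lemma normcX z n : N (z ^+ n) = N z ^+ n.
Proof.
elim: n => [|n IH]; first by rewrite !expr0 Normc.normc1.
by rewrite !exprS Normc.normcM IH.
Qed.

Lemma ler_normcB z w : N (z - w) <= N z + N w.
Proof. by rewrite -(normcN w) le_normcD. Qed.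

Lemma ler_normc_sum I (r : seq I) (P : pred I) (F : I -> C) :
  N (\sum_(i <- r | P i) F i) <= \sum_(i <- r | P i) N (F i).
Proof.
elim/big_rec2 : _ => [|i x y _ IH]; first by rewrite Normc.normc0.
by rewrite (le_trans (le_normcD _ _))// lerD2l.
Qed.

Lemma normRe_le z : `|complex.Re z| <= N z.
Proof.
case: z => a b /=; rewrite -sqrtr_sqr ler_wsqrtr//.
by rewrite lerDl sqr_ge0.
Qed.

Lemma normIm_le z : `|complex.Im z| <= N z.
Proof.
case: z => a b /=; rewrite -sqrtr_sqr ler_wsqrtr//.
by rewrite lerDr sqr_ge0.
Qed.

Lemma normc_le_ReIm z : N z <= `|complex.Re z| + `|complex.Im z|.
Proof.
case: z => a b /=; rewrite -[leRHS]ger0_norm ?addr_ge0// -sqrtr_sqr.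
rewrite ler_wsqrtr// sqrrD !real_normK ?num_real// -addrA lerD2l lerDr.
by rewrite mulrn_wge0// mulr_ge0.
Qed.

Lemma normc_lt (z : C) (e : R) : (`|z| < (e%:C)%C) = (N z < e).
Proof. by rewrite normc_normE ltcR. Qed.

Lemma nbhs_normcP (z0 : C) (P : set C) :
  (\forall z \near (z0 : (C : numFieldType)), P z) <->
  exists2 e : R, 0 < e & forall z, N (z - z0) < e -> P z.
Proof.
split=> [/nbhs_ballP[_ /= /gtc0E[e e0 ->] eP]|[e e0 eP]].
  by exists e => // z ze; apply: eP; rewrite -ball_normE /= distrC normc_lt.
apply/nbhs_ballP; exists (e%:C)%C; first by rewrite /= ltcR.
by move=> z; rewrite -ball_normE /= distrC normc_lt; exact: eP.
Qed.

End ComplexNorm.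

Arguments Normc.normc : simpl never.

Section Germs.
Variable R : realType.
Local Notation C := (R[i]).
Local Notation N := (@Normc.normc R).

(** The exponent [k.+1] lets the single number [M] control both the inverse radius and the overall
    size, the constant coefficient included. *)
Definition coef_bounded (M : R) (P : {poly C}) :=
  forall k, N P`_k <= M ^+ k.+1.

(* Analyticity without power series: g has, to every order n, a polynomial
   approximation at z0 whose coefficients obey the same geometric bound.  This is
   stable under products, composition and inversion by finite computations only. *)
Definition germ (M : R) (g : C -> C) (z0 : C) := forall n, exists2 P,
  coef_bounded M P &
  forall t, M * N t <= 2^-1 -> N (g (z0 + t) - P.[t]) <= M ^+ n.+1 * N t ^+ n.

Lemma geometric_sum_le2 n (x : R) : 0 <= x -> x <= 2^-1 ->
  \sum_(i < n) x ^+ i <= 2.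
Proof.
move=> x0 x2; rewrite -(big_mkord xpredT (fun i => x ^+ i)).
apply: le_trans (@geometric_half_le2 R n).
by apply: ler_sum => i _; rewrite lerXn2r// nnegrE invr_ge0.
Qed.

Lemma horner_bound M (P : {poly C}) t : 1 <= M -> coef_bounded M P ->
  M * N t <= 2^-1 -> N P.[t] <= 2 * M.
Proof.
move=> M1 bP Mt; have M0 : 0 <= M by lra.
rewrite horner_coef (le_trans (ler_normc_sum _ _ _))//.
apply: (@le_trans _ _ (\sum_(i < size P) M * (M * N t) ^+ i)).
  apply: ler_sum => i _; rewrite Normc.normcM normcX exprMn mulrA -exprS.
  by rewrite ler_wpM2r ?exprn_ge0 ?normc_ge0.
rewrite -mulr_sumr mulrC ler_wpM2r// geometric_sum_le2//.
by rewrite mulr_ge0 ?normc_ge0.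
Qed.

Lemma horner_bound0 M (P : {poly C}) t : 1 <= M -> coef_bounded M P ->
  M * N t <= 2^-1 -> N (P.[t] - P`_0) <= 2 * M ^+ 2 * N t.
Proof.
move=> M1 bP Mt; have M0 : 0 <= M by lra.
have t0 := normc_ge0 t.
rewrite horner_coef; case sP: (size P) => [|n].
  rewrite big_ord0 (nth_default 0 (eq_leq sP)) sub0r oppr0 Normc.normc0.
  by rewrite mulr_ge0// mulr_ge0// exprn_ge0.
rewrite big_ord_recl /= expr0 mulr1 addrAC subrr add0r.
rewrite (le_trans (ler_normc_sum _ _ _))//.
apply: (@le_trans _ _ (\sum_(i < n) M ^+ 2 * N t * (M * N t) ^+ i)).
  apply: ler_sum => i _; rewrite Normc.normcM normcX /bump /= add1n.
  have -> : M ^+ 2 * N t * (M * N t) ^+ i = M ^+ i.+2 * N t ^+ i.+1.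
    by rewrite exprMn !exprS; ring.
  by rewrite ler_wpM2r ?exprn_ge0.
rewrite -mulr_sumr mulrC -mulrA ler_wpM2r ?mulr_ge0 ?exprn_ge0//.
by rewrite geometric_sum_le2 ?mulr_ge0.
Qed.

Lemma germ_weaken M M' g z0 : 1 <= M -> M <= M' -> germ M g z0 -> germ M' g z0.
Proof.
move=> M1 MM' gM n; have [P bP gP] := gM n.
have MX k : M ^+ k <= M' ^+ k by rewrite lerXn2r// nnegrE; lra.
exists P => [k|t Mt]; first exact: le_trans (bP k) _.
have t0 := normc_ge0 t.
apply: (le_trans (gP _ _)); last by rewrite ler_wpM2r ?exprn_ge0.
by apply: le_trans Mt; rewrite ler_wpM2r.
Qed.

Lemma germ_cst c z0 : exists2 M, 1 <= M & germ M (fun=> c) z0.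
Proof.
have c0 := normc_ge0 c.
exists (1 + N c) => [|n]; first lra.
exists c%:P => [k|t Mt].
  rewrite coefC; case: eqP => [->|_]; first by rewrite expr1; lra.
  by rewrite Normc.normc0 exprn_ge0//; lra.
rewrite hornerC subrr Normc.normc0 mulr_ge0 ?exprn_ge0 ?normc_ge0//; lra.
Qed.

Lemma germ_id z0 : exists2 M, 1 <= M & germ M id z0.
Proof.
have c0 := normc_ge0 z0.
exists (1 + N z0) => [|n]; first lra.
exists (z0%:P + 'X) => [k|t Mt].
  rewrite coefD coefC coefX; case: k => [|[|k]] /=.
  - by rewrite addr0 expr1; lra.
  - by rewrite add0r Normc.normc1 exprn_ege1//; lra.
  - by rewrite addr0 Normc.normc0 exprn_ge0//; lra.
rewrite !hornerE subrr Normc.normc0 mulr_ge0 ?exprn_ge0 ?normc_ge0//; lra.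
Qed.

(** The untruncated product of the approximations serves. The constant is 5 = 1 + 2 + 2: the product
    of the two errors is at most [M * e], and each cross term at most [2 * M * e] by [horner_bound].
    The k + 1 summands of a coefficient are absorbed by 5^(k+1). *)
Lemma germM M g1 g2 z0 : 1 <= M ->
  germ M g1 z0 -> germ M g2 z0 -> germ (5 * M ^+ 2) (fun z => g1 z * g2 z) z0.
Proof.
move=> M1 h1 h2 n; have [P bP hP] := h1 n; have [Q bQ hQ] := h2 n.
have M0 : 0 <= M by lra.
have MM : M <= 5 * M ^+ 2 by rewrite expr2; nra.
exists (P * Q) => [k|t Mt].
  rewrite coefM (le_trans (ler_normc_sum _ _ _))//.
  apply: (@le_trans _ _ (\sum_(i < k.+1) M ^+ k.+2)).
    apply: ler_sum => i _; rewrite Normc.normcM.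
    rewrite (_ : k.+2 = i.+1 + (k - i).+1)%N; last first.
      by rewrite addSn addnS subnKC// -ltnS.
    by rewrite exprD ler_pM ?normc_ge0.
  rewrite sumr_const card_ord -[leLHS]mulr_natl.
  have k5 : k.+1%:R <= 5 ^+ k.+1 :> R.
    by rewrite -natrX ler_nat ltnW// ltn_expl.
  have MX : M ^+ k.+2 <= (M ^+ 2) ^+ k.+1.
    rewrite -exprM; by apply: ler_weXn2l; rewrite // mul2n -addnn addSn ltnS leq_addl.
  by rewrite [leRHS]exprMn ler_pM ?exprn_ge0 ?ler0n.
have t0 := normc_ge0 t.
have Mt' : M * N t <= 2^-1 by apply: le_trans Mt; rewrite ler_wpM2r.
have d1 := hP _ Mt'; have d2 := hQ _ Mt'.
have q1 := horner_bound M1 bP Mt'; have q2 := horner_bound M1 bQ Mt'.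
set e := M ^+ n.+1 * N t ^+ n in d1 d2 *.
have e0 : 0 <= e by rewrite mulr_ge0 ?exprn_ge0.
have eM : e <= M.
  rewrite /e exprS -mulrA -exprMn ler_piMr// exprn_ile1 ?mulr_ge0//.
  by apply: le_trans Mt' _; lra.
have ge : 5 * M * e <= (5 * M ^+ 2) ^+ n.+1 * N t ^+ n.
  rewrite /e mulrA ler_wpM2r ?exprn_ge0// exprMn -exprM.
  rewrite -mulrA -exprS ler_pM ?exprn_ge0//.
    by rewrite ler_eXnr//; lra.
  by apply: ler_weXn2l; rewrite // mul2n -addnn addSn ltnS leq_addl.
apply: le_trans ge; rewrite hornerM.
have -> : g1 (z0 + t) * g2 (z0 + t) - P.[t] * Q.[t] =
  (g1 (z0 + t) - P.[t]) * (g2 (z0 + t) - Q.[t]) +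
  (P.[t] * (g2 (z0 + t) - Q.[t]) + Q.[t] * (g1 (z0 + t) - P.[t])) by ring.
rewrite (le_trans (le_normcD _ _))//.
rewrite (le_trans (lerD (lexx _) (le_normcD _ _)))// !Normc.normcM.
have [[[n1 n2] n3] n4] := (normc_ge0 (g1 (z0 + t) - P.[t]),
  normc_ge0 (g2 (z0 + t) - Q.[t]), normc_ge0 P.[t], normc_ge0 Q.[t]).
have -> : 5 * M * e = M * e + (2 * M * e + 2 * M * e) by ring.
apply: lerD; last by apply: lerD; apply: ler_pM.
by apply: ler_pM => //; apply: le_trans d1 _.
Qed.

End Germs.

(** * Composition of germs *)

Section GermComp.
Variable R : realType.
Local Notation C := (R[i]).
Local Notation N := (@Normc.normc R).

Lemma hockey_stick k m : (\sum_(i < k) 'C(i, m) = 'C(k, m.+1))%N.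
Proof.
elim: k => [|k IH]; first by rewrite big_ord0 bin0n.
by rewrite big_ord_recr /= IH binS.
Qed.

(** As [P] has no constant term, the coefficient is a sum over the compositions of k into m positive
    parts, each contributing at most M^(m+k). Counting them by C(k, m), slightly too many, turns the
    induction on m into the hockey stick identity. *)
Lemma coef_exp_bounded M (P : {poly C}) m : 1 <= M -> coef_bounded M P ->
  P`_0 = 0 -> forall k, N (P ^+ m)`_k <= 'C(k, m)%:R * M ^+ (m + k).
Proof.
move=> M1 bP P0; have M0 : 0 <= M by lra.
elim: m => [|m IH] k.
  rewrite expr0 coef1 bin0 mul1r; case: eqP => _.
    by rewrite mulr1n Normc.normc1 exprn_ege1.
  by rewrite mulr0n Normc.normc0 exprn_ge0.
rewrite exprS coefM big_ord_recl P0 mul0r add0r.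
rewrite (le_trans (ler_normc_sum _ _ _))//.
rewrite -hockey_stick natr_sum mulr_suml (reindex_inj rev_ord_inj).
apply: ler_sum => i _; rewrite Normc.normcM.
have ik := ltn_ord i.
have -> : (lift ord0 (rev_ord i) = k - i :> nat)%N by rewrite /= /bump; lia.
have -> : (k - (k - i) = i)%N by rewrite subKn// ltnW.
have -> : (m.+1 + k = (k - i).+1 + (m + i))%N by lia.
by rewrite exprD mulrCA ler_pM ?normc_ge0.
Qed.

Lemma sum_bin_le (x : R) k n : 0 <= x ->
  \sum_(i < n) x ^+ i * 'C(k, i)%:R <= (x + 1) ^+ k.
Proof.
move=> x0; elim: k n => [|k IH] [|n].
- by rewrite big_ord0.
- by rewrite big_ord_recl big1 => [|i _]; rewrite /= ?mulr1 ?mulr0 ?addr0.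
- by rewrite big_ord0 exprn_ge0// addr_ge0.
rewrite big_ord_recl bin0 /=.
have -> : \sum_(i < n) x ^+ bump 0 i * 'C(k.+1, bump 0 i)%:R =
  \sum_(i < n) x ^+ bump 0 i * 'C(k, bump 0 i)%:R +
  x * \sum_(i < n) x ^+ i * 'C(k, i)%:R.
  rewrite mulr_sumr -big_split /=; apply: eq_bigr => i _.
  by rewrite /bump /= add1n binS natrD exprS; ring.
rewrite addrA; have := IH n.+1; rewrite big_ord_recl bin0 /= => h1.
by have h2 := ler_wpM2l x0 (IH n); rewrite exprS; lra.
Qed.

Lemma exp_sub_bound (L : R) (s u : C) i : 0 <= L -> L * N s <= 4^-1 ->
  L * N u <= 4^-1 ->
  L ^+ i * N (s ^+ i - u ^+ i) <= 4 * (L * N (s - u)) * 2^-1 ^+ i.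
Proof.
move=> L0 Ls Lu; have d0 : 0 <= L * N (s - u) by rewrite mulr_ge0 ?normc_ge0.
elim: i => [|i IH].
  by rewrite !expr0 subrr Normc.normc0 mulr0 mulr1 mulr_ge0.
have -> : s ^+ i.+1 - u ^+ i.+1 = s * (s ^+ i - u ^+ i) + (s - u) * u ^+ i.
  by rewrite !exprS; ring.
apply: (@le_trans _ _ ((L * N s) * (L ^+ i * N (s ^+ i - u ^+ i)) +
   (L * N (s - u)) * (L * N u) ^+ i)).
  rewrite [X in _ <= X](_ : _ = L ^+ i.+1 *
     (N s * N (s ^+ i - u ^+ i) + N (s - u) * N u ^+ i)); last first.
    by rewrite exprMn exprS; ring.
  by rewrite ler_wpM2l ?exprn_ge0// -normcX -!Normc.normcM le_normcD.
have a1 : (L * N s) * (L ^+ i * N (s ^+ i - u ^+ i)) <=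
    4^-1 * (4 * (L * N (s - u)) * 2^-1 ^+ i).
  by rewrite ler_pM ?mulr_ge0 ?exprn_ge0 ?normc_ge0.
have a2 : (L * N (s - u)) * (L * N u) ^+ i <= (L * N (s - u)) * 2^-1 ^+ i.
  rewrite ler_wpM2l// lerXn2r ?nnegrE ?mulr_ge0 ?normc_ge0 ?invr_ge0//; lra.
by rewrite exprS; lra.
Qed.

(** With [P'] the approximation of [F - F z0] and [Q] that of [f], the error of the composite splits
    into that of [Q] at [s] and the variation of [Q] between [s] and [u], where [Q] is Lipschitz
    with constant [8 * L ^+ 2]. The coefficients are bounded by the binomial sum L M^k (1 + L M)^k.
    The constant 12 = 4 * 3 puts [s] and [u], of size at most [3 * M ^+ 2 * N t], inside the disc
    where [L * N s] is at most 1/4. *)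
Lemma germ_comp M L (F f : C -> C) (z0 : C) : 1 <= M -> 1 <= L ->
  germ M F z0 -> germ L f (F z0) ->
  germ (12 * L ^+ 2 * M ^+ 2) (f \o F) z0.
Proof.
move=> M1 L1 gF gf.
have M0 : 0 <= M by lra. have L0 : 0 <= L by lra.
set M' := 12 * _ * _.
have M2 : M <= M ^+ 2 by rewrite expr2 ler_peMl.
have L2 : L <= L ^+ 2 by rewrite expr2 ler_peMl.
have M'1 : 12 <= M' by rewrite /M'; nra.
have M'0 : 0 <= M' by lra.
(* Only from order 1 on does an approximation take the exact value [F z0] at 0. Order 0 follows from
   order 1 because [M' * N t] is at most 1. *)
suff H n : exists2 P, coef_bounded M' P & forall t, M' * N t <= 2^-1 ->
    N ((f \o F) (z0 + t) - P.[t]) <= M' ^+ n.+2 * N t ^+ n.+1.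
  case=> [|n]; last exact: H.
  have [P bP hP] := H 0; exists P => // t Mt.
  apply: le_trans (hP _ Mt) _; rewrite expr0 mulr1 !expr1 expr2 -mulrA.
  by rewrite ler_piMr//; lra.
have [P bP hP] := gF n.+1; have [Q bQ hQ] := gf n.+1.
have P0 : P`_0 = F z0.
  have := hP 0; rewrite Normc.normc0 mulr0 expr0n mulr0 addr0 horner_coef0.
  rewrite invr_ge0 ler0n => /(_ isT) h.
  apply/esym/eqP; rewrite -subr_eq0; apply/eqP/Normc.eq0_normc/le_anti.
  by rewrite h normc_ge0.
pose P' := P - (F z0)%:P.
have P'0 : P'`_0 = 0 by rewrite coefB coefC P0 subrr.
have bP' : coef_bounded M P'.
  move=> k; case: k => [|k]; first by rewrite P'0 Normc.normc0 expr1.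
  by rewrite coefB coefC subr0.
exists (Q \Po P') => [k|t Mt].
  rewrite coef_comp_poly (le_trans (ler_normc_sum _ _ _))//.
  apply: (@le_trans _ _ (\sum_(i < size Q)
     L * M ^+ k * ((L * M) ^+ i * 'C(k, i)%:R))).
    apply: ler_sum => i _; rewrite Normc.normcM.
    have -> : L * M ^+ k * ((L * M) ^+ i * 'C(k, i)%:R) =
      L ^+ i.+1 * ('C(k, i)%:R * M ^+ (i + k)).
      by rewrite exprMn exprD exprS; ring.
    by rewrite ler_pM ?normc_ge0// coef_exp_bounded.
  rewrite -mulr_sumr.
  have LM0 : 0 <= L * M by rewrite mulr_ge0.
  apply: (@le_trans _ _ (L * M ^+ k * (L * M + 1) ^+ k)).
    by rewrite ler_wpM2l ?mulr_ge0 ?exprn_ge0// sum_bin_le.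
  rewrite -mulrA -exprMn exprS ler_pM ?exprn_ge0 ?mulr_ge0//.
  - by rewrite addr_ge0.
  - rewrite /M'; nra.
  - rewrite lerXn2r// ?nnegrE ?M'0 ?mulr_ge0 ?addr_ge0//.
    have MM0 : 0 <= M ^+ 2 by rewrite exprn_ge0.
    have := ler_wpM2r MM0 L2; have : M ^+ 2 <= L ^+ 2 * M ^+ 2.
      by rewrite ler_peMl// exprn_ege1.
    rewrite /M'; lra.
have t0 := normc_ge0 t.
have MM' : M <= M' by rewrite /M'; nra.
have Mt' : M * N t <= 2^-1 by apply: le_trans Mt; rewrite ler_wpM2r.
have d1 := hP _ Mt'.
set s := F (z0 + t) - F z0.
set u := P'.[t].
have su : N (s - u) <= M ^+ n.+2 * N t ^+ n.+1.
  by apply: le_trans d1; rewrite /s /u /P' hornerD hornerN hornerC opprB addrA subrK.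
have uB : N u <= 2 * M ^+ 2 * N t.
  by have := horner_bound0 M1 bP' Mt'; rewrite P'0 subr0.
have en : M ^+ n.+2 * N t ^+ n.+1 <= M ^+ 2 * N t.
  have -> : M ^+ n.+2 * N t ^+ n.+1 = M ^+ 2 * N t * ((M * N t) ^+ n).
    by rewrite exprMn !exprS; ring.
  rewrite ler_piMr ?mulr_ge0 ?exprn_ge0// exprn_ile1 ?mulr_ge0//; lra.
have sB : N s <= 3 * M ^+ 2 * N t.
  rewrite (_ : s = (s - u) + u); last by rewrite subrK.
  by rewrite (le_trans (le_normcD _ _))//; lra.
have LB : L * (3 * M ^+ 2 * N t) <= 4^-1.
  have : L * (3 * M ^+ 2 * N t) <= 4^-1 * (M' * N t).
    rewrite /M'; have : L * (M ^+ 2 * N t) <= L ^+ 2 * (M ^+ 2 * N t).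
      by rewrite ler_wpM2r// mulr_ge0// exprn_ge0.
    lra.
  lra.
have Ls : L * N s <= 4^-1 by apply: le_trans LB; rewrite ler_wpM2l.
have Lu : L * N u <= 4^-1.
  apply: le_trans LB; rewrite ler_wpM2l//; apply: le_trans uB _.
  by rewrite ler_wpM2r// ler_wpM2r ?exprn_ge0//; lra.
have e1 : N (f (F z0 + s) - Q.[s]) <= L ^+ n.+2 * (3 * M ^+ 2 * N t) ^+ n.+1.
  apply: le_trans (hQ _ _) _; first lra.
  by rewrite ler_wpM2l ?exprn_ge0// lerXn2r ?nnegrE ?mulr_ge0 ?exprn_ge0 ?normc_ge0.
have e2 : N (Q.[s] - Q.[u]) <= 8 * L ^+ 2 * N (s - u).
  rewrite !horner_coef -sumrB (le_trans (ler_normc_sum _ _ _))//.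
  apply: (@le_trans _ _ (\sum_(i < size Q) 4 * L ^+ 2 * N (s - u) * 2^-1 ^+ i)).
    apply: ler_sum => i _; rewrite -mulrBr Normc.normcM.
    apply: (@le_trans _ _ (L * (L ^+ i * N (s ^+ i - u ^+ i)))).
      by rewrite mulrA -exprS ler_wpM2r ?normc_ge0.
    have -> : 4 * L ^+ 2 * N (s - u) * 2^-1 ^+ i =
       L * (4 * (L * N (s - u)) * 2^-1 ^+ i) by rewrite expr2; ring.
    by rewrite ler_wpM2l// exp_sub_bound.
  rewrite -mulr_sumr.
  have h2 : 0 <= 2^-1 :> R by rewrite invr_ge0.
  have := @geometric_sum_le2 R (size Q) 2^-1 h2 (lexx _).
  have : 0 <= L ^+ 2 * N (s - u) by rewrite mulr_ge0 ?exprn_ge0 ?normc_ge0.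
  by move=> X0 X1; have := ler_wpM2l X0 X1; lra.
have -> : (f \o F) (z0 + t) - (Q \Po P').[t] =
    (f (F z0 + s) - Q.[s]) + (Q.[s] - Q.[u]).
  by rewrite addrA subrK horner_comp /= /s [F z0 + (_ - _)]addrC subrK.
rewrite (le_trans (le_normcD _ _))//.
set X := (L ^+ 2 * (12 * M ^+ 2) * N t) ^+ n.+1.
have tX : M' ^+ n.+2 * N t ^+ n.+1 = M' * X.
  by rewrite /X /M' exprS -mulrA -exprMn; congr (_ * (_ * _) ^+ _); ring.
have X0 : 0 <= X by rewrite exprn_ge0// mulr_ge0// mulr_ge0 ?exprn_ge0// mulr_ge0// exprn_ge0.
have b1 : L ^+ n.+2 * (3 * M ^+ 2 * N t) ^+ n.+1 <= L ^+ 2 * X.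
  rewrite exprS -mulrA -exprMn ler_pM ?exprn_ge0 ?mulr_ge0 ?exprn_ge0//.
  rewrite /X lerXn2r ?nnegrE ?mulr_ge0 ?exprn_ge0//.
  have MM0 : 0 <= M ^+ 2 * N t by rewrite mulr_ge0 ?exprn_ge0.
  have := ler_wpM2r MM0 L2; have : 0 <= L ^+ 2 * (M ^+ 2 * N t).
    by rewrite mulr_ge0 ?exprn_ge0.
  lra.
have b2 : N (s - u) <= M ^+ 2 * X.
  apply: le_trans su _; rewrite exprS -mulrA -exprMn ler_pM ?exprn_ge0 ?mulr_ge0//.
  rewrite /X lerXn2r ?nnegrE ?mulr_ge0 ?exprn_ge0//.
  have MM0 : 0 <= M ^+ 2 * N t by rewrite mulr_ge0 ?exprn_ge0.
  have : M * N t <= M ^+ 2 * N t by rewrite ler_wpM2r.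
  have : M ^+ 2 * N t <= L ^+ 2 * (M ^+ 2 * N t).
    by rewrite ler_peMl// exprn_ege1.
  lra.
have b3 : L ^+ 2 * N (s - u) <= L ^+ 2 * (M ^+ 2 * X).
  by rewrite ler_wpM2l ?exprn_ge0.
have b4 : L ^+ 2 * X <= L ^+ 2 * (M ^+ 2 * X).
  by rewrite ler_wpM2l ?exprn_ge0// ler_peMl// exprn_ege1.
have b5 : 0 <= L ^+ 2 * (M ^+ 2 * X).
  apply: mulr_ge0; [exact: exprn_ge0|apply: mulr_ge0 => //; exact: exprn_ge0].
rewrite tX /M'; have := lerD e1 e2; lra.
Qed.

End GermComp.

(** * Germs and convergent power series *)

Section GermAnalytic.
Variable R : realType.
Local Notation C := (R[i]).
Local Notation N := (@Normc.normc R).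
Implicit Types (z t : C) (g : C -> C).

Lemma near_geom_lt (B x e : R) : 0 <= x < 1 -> 0 < e ->
  \forall n \near \oo, B * x ^+ n < e.
Proof.
move=> /andP[x0 x1] e0.
have : (B * x ^+ n) @[n --> \oo] --> B * 0.
  by apply: cvgMr; apply: cvg_expr; rewrite ger0_norm.
by rewrite mulr0 => /cvgr_lt; apply.
Qed.

Lemma cvg_dist_ltP (K : numFieldType) (u : nat -> K) (l : K) :
  (u @ \oo --> l) <->
  (forall e : K, 0 < e -> \forall n \near \oo, `|l - u n| < e).
Proof. exact: cvgrPdist_lt. Qed.

Lemma cvg_normcP (u : nat -> C) (l : C) :
  (u @ \oo --> (l : (C : numFieldType))) <->
  (forall e : R, 0 < e -> \forall n \near \oo, N (l - u n) < e).
Proof.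
split=> [ul e e0|ul].
  have := (@cvg_dist_ltP (C : numFieldType) u l).1 ul (e%:C)%C.
  rewrite ltcR => /(_ e0).
  by apply: filterS => n; rewrite normc_lt.
apply/(@cvg_dist_ltP (C : numFieldType) u l) => _ /gtc0E[e e0 ->].
by apply: filterS (ul e e0) => n; rewrite normc_lt.
Qed.

Lemma normcV (z : C) : z != 0 -> N z^-1 = (N z)^-1.
Proof.
move=> z0; have : N z^-1 * N z = 1 by rewrite -Normc.normcM mulVf// Normc.normc1.
move=> zz; have Nz : N z != 0.
  by apply: contra_eq_neq zz => ->; rewrite mulr0 eq_sym oner_eq0.
by rewrite -[RHS]mul1r -zz mulfK.
Qed.

Lemma germ_inv z0 : z0 != 0 -> exists2 M, 1 <= M & germ M (fun z => z^-1) z0.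
Proof.
move=> z00; have N0 : 0 < N z0.
  rewrite lt_neqAle normc_ge0 andbT eq_sym; apply: contra_neq z00.
  exact: Normc.eq0_normc.
pose rho := (N z0)^-1; have rho0 : 0 < rho by rewrite invr_gt0.
have rhoE : rho * N z0 = 1 by rewrite mulVf// gt_eqF.
exists (1 + 2 * rho); [lra|move=> n].
have NV : N z0^-1 = rho by rewrite normcV.
exists (\poly_(k < n) (z0^-1 * (- z0^-1) ^+ k)) => [k|t Mt].
  rewrite coef_poly; case: ifP => _; last by rewrite Normc.normc0 exprn_ge0//; lra.
  rewrite Normc.normcM normcX normcN NV -exprS.
  by rewrite lerXn2r ?nnegrE//; lra.
have t0 := normc_ge0 t.
rewrite horner_poly; pose u := - (z0^-1 * t).
have zt : N z0 <= N (z0 + t) + N t.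
  by rewrite -{1}(addrK t z0) ler_normcB.
have zt2 : 1 <= 2 * rho * N (z0 + t).
  have : rho * N z0 <= rho * (N (z0 + t) + N t) by rewrite ler_wpM2l// ltW.
  rewrite rhoE; lra.
have zt0 : z0 + t != 0.
  by apply: contraTneq zt2 => ->; rewrite Normc.normc0 mulr0 -ltNge ltr01.
have -> : \sum_(i < n) z0^-1 * (- z0^-1) ^+ i * t ^+ i =
    z0^-1 * \sum_(i < n) u ^+ i.
  rewrite mulr_sumr; apply: eq_bigr => i _.
  by rewrite -mulrA -exprMn /u mulNr.
have uE : (1 - u) * \sum_(i < n) u ^+ i = 1 - u ^+ n.
  by rewrite -[1 - u]opprB mulNr -subrX1 opprB.
have -> : (z0 + t)^-1 - z0^-1 * \sum_(i < n) u ^+ i = u ^+ n * (z0 + t)^-1.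
  have -> : u ^+ n = 1 - (1 - u) * \sum_(i < n) u ^+ i by rewrite uE subKr.
  rewrite /u; set S := \sum_(i < n) _; field.
  by rewrite z00 zt0.
rewrite Normc.normcM normcX /u normcN Normc.normcM NV exprMn normcV//.
rewrite mulrAC ler_wpM2r ?exprn_ge0// exprS mulrC ler_pM ?exprn_ge0 ?(ltW rho0)//.
- by rewrite invr_ge0 normc_ge0.
- have Nzt : 0 < N (z0 + t) by have := normc_ge0 (z0 + t); nra.
  by rewrite -[leLHS]mul1r ler_pdivrMr//; nra.
- by rewrite lerXn2r ?nnegrE//; lra.
Qed.

(** Once the lower coefficients agree, the difference is X^k times a polynomial [E], whose constant
    term is O(t) as t tends to 0 and hence zero. Thus approximations of different orders share their
    low coefficients, which [germ_analytic_at] needs to form a single power series. *)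
Lemma coef_stable M (P Q : {poly C}) K n : 1 <= M -> 0 <= K ->
  coef_bounded M P -> coef_bounded M Q ->
  (forall t, M * N t <= 2^-1 -> N (P.[t] - Q.[t]) <= K * N t ^+ n) ->
  forall k, (k < n)%N -> P`_k = Q`_k.
Proof.
move=> M1 K0 bP bQ PQ k.
have M0 : 0 <= M by lra.
elim/ltn_ind: k => k IH kn.
apply/eqP; rewrite -subr_eq0 -coefB; set D := P - Q.
pose E := drop_poly k D.
have DE : D = E * 'X^k.
  rewrite -[LHS](poly_take_drop k) [take_poly _ _](_ : _ = 0) ?add0r//.
  apply/polyP => j; rewrite coef_take_poly coef0; case: ifP => // jk.
  by rewrite coefB IH ?subrr// (ltn_trans jk).
pose M' := (2 * M) ^+ k.+1.
have M'1 : 1 <= M' by rewrite exprn_ege1//; lra.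
have bE : coef_bounded M' E.
  move=> j; rewrite coef_drop_poly coefB (le_trans (ler_normcB _ _))//.
  apply: (@le_trans _ _ (2 * M ^+ (j + k).+1)).
    by rewrite mulr_natl mulr2n lerD.
  apply: (@le_trans _ _ ((2 * M) ^+ (j + k).+1)).
    by rewrite exprMn ler_wpM2r ?exprn_ge0// ler_eXnr// ler1n.
  rewrite /M' -exprM; apply: ler_weXn2l; first lra.
  by rewrite mulnS mulSn; lia.
have E0 : D`_k = E`_0 by rewrite coef_drop_poly add0n.
rewrite E0; apply/eqP/Normc.eq0_normc/le_anti; rewrite normc_ge0 andbT.
apply/ler_addgt0Pr => e e0; rewrite add0r.
have K1 : 0 < K + 2 * M' ^+ 2 by have : 1 <= M' ^+ 2 := exprn_ege1 _ M'1; lra.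
pose tau := Num.min (2 * M')^-1 (Num.min (2 * M)^-1 (e / (K + 2 * M' ^+ 2))).
have tau0 : 0 < tau by rewrite !lt_min !invr_gt0 divr_gt0// andbT; apply/andP; split; lra.
have tau1 : M' * tau <= 2^-1.
  rewrite -ler_pdivlMl; last lra.
  by rewrite -invfM mulrC /tau ge_min lexx.
have tau2 : M * tau <= 2^-1.
  rewrite -ler_pdivlMl; last lra.
  by rewrite -invfM mulrC /tau !ge_min lexx orbT.
have tau3 : (K + 2 * M' ^+ 2) * tau <= e.
  by rewrite mulrC -ler_pdivlMr// /tau !ge_min lexx !orbT.
have Nt : N (tau%:C)%C = tau by rewrite normc_real gtr0_norm.
have e1 := @horner_bound0 R M' E (tau%:C)%C M'1 bE.
rewrite Nt in e1; have {}e1 := e1 tau1.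
have e2 := PQ (tau%:C)%C; rewrite Nt in e2; have {}e2 := e2 tau2.
have e3 : N E.[(tau%:C)%C] <= K * tau.
  rewrite -hornerN -hornerD -/D DE hornerM hornerXn Normc.normcM normcX Nt in e2.
  rewrite -(ler_pM2r (exprn_gt0 k tau0)); apply: le_trans e2 _.
  rewrite -mulrA -exprS ler_wpM2l//.
  apply: ler_wiXn2l => //; first exact: ltW.
  have : M' * tau <= 1 by lra.
  by apply: le_trans; rewrite ler_peMl// ltW.
have -> : E`_0 = E.[(tau%:C)%C] - (E.[(tau%:C)%C] - E`_0) by rewrite subKr.
rewrite (le_trans (ler_normcB _ _))//; lra.
Qed.

Lemma analytic_at_germ g z0 :
  analytic_at (g : (C : numFieldType) -> C) z0 -> exists2 M, 1 <= M & germ M g z0.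
Proof.
move=> [c /nbhs_normcP[s0 s00 gs]].
pose s := s0 / 2; have s_gt0 : 0 < s by rewrite divr_gt0.
have [B B0 cB] : exists2 B, 0 <= B & forall k, N (c k) * s ^+ k <= B.
  have := gs (z0 + (s%:C)%C); rewrite addrAC subrr add0r normc_real gtr0_norm//.
  rewrite {1}/s ltr_pdivrMr// ltr_pMr// ltr1n => /(_ isT) cs.
  have /cvgP/cvg_seq_bounded bs := cvg_series_cvg_0 (cvgP _ cs).
  have [M /gtc0E[m m0 ->] HM] := pinfty_ex_gt0 bs.
  exists m => [|k]; first exact: ltW.
  have := HM k Logic.I; rewrite /= normc_normE lecR Normc.normcM normcX.
  by rewrite normc_real gtr0_norm.
(* [s^-1] is the growth rate of the coefficients, [B] their prefactor, and the factor 2 pays for the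
   geometric tail. *)
pose M := 1 + 2 * B + s^-1.
have sV0 : 0 < s^-1 by rewrite invr_gt0.
have M1 : 1 <= M by rewrite /M; lra.
have M0 : 0 <= M by lra.
exists M => // n.
have cM k : N (c k) <= B * s^-1 ^+ k.
  by rewrite exprVn ler_pdivlMr ?exprn_gt0.
have sM k : s^-1 ^+ k <= M ^+ k.
  by rewrite lerXn2r ?nnegrE ?(ltW sV0)//; rewrite /M; lra.
exists (\poly_(k < n) c k) => [k|t Mt].
  rewrite coef_poly; case: ifP => _; last by rewrite Normc.normc0 exprn_ge0.
  rewrite (le_trans (cM k))// exprS ler_pM ?exprn_ge0 ?(ltW sV0)//.
  by rewrite /M; lra.
have t0 := normc_ge0 t.
have ts : s^-1 * N t <= 2^-1.
  by apply: le_trans Mt; rewrite ler_wpM2r// /M; lra.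
have tss : N t <= s / 2 by rewrite -ler_pdivrMl.
have tlt : N (z0 + t - z0) < s0.
  rewrite addrAC subrr add0r; apply: le_lt_trans tss _.
  rewrite /s; lra.
have /cvg_normcP gt := gs _ tlt.
apply/ler_addgt0Pr => e e0.
have [m _ mP] := gt e e0.
have := mP (m + n)%N (leq_addr _ _).
rewrite addrAC subrr add0r /series /= big_mkord => ge.
rewrite horner_poly.
set S := \sum_(i < m + n) _ in ge.
rewrite (_ : _ - _ = (g (z0 + t) - S) + (S - \sum_(i < n) c i * t ^+ i)); last first.
  by rewrite addrA subrK.
rewrite (le_trans (le_normcD _ _))// addrC lerD//; last exact: ltW.
have -> : S - \sum_(i < n) c i * t ^+ i = \sum_(i < m) c (n + i)%N * t ^+ (n + i).
  rewrite /S addnC big_split_ord /= addrAC subrr add0r.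
  by apply: eq_bigr => i _.
rewrite (le_trans (ler_normc_sum _ _ _))//.
apply: (@le_trans _ _ (\sum_(i < m) B * (s^-1 * N t) ^+ n * (s^-1 * N t) ^+ i)).
  apply: ler_sum => i _; rewrite Normc.normcM normcX.
  rewrite -mulrA -exprD [(_ * N t) ^+ _]exprMn mulrA.
  by rewrite ler_wpM2r ?exprn_ge0.
rewrite -mulr_sumr.
have X0 : 0 <= s^-1 * N t by rewrite mulr_ge0 ?(ltW sV0).
have := @geometric_sum_le2 R m _ X0 ts.
have BX : 0 <= B * (s^-1 * N t) ^+ n by rewrite mulr_ge0 ?exprn_ge0.
move=> /(ler_wpM2l BX) /le_trans; apply.
rewrite exprMn.
have -> : B * (s^-1 ^+ n * N t ^+ n) * 2 = (2 * B * s^-1 ^+ n) * N t ^+ n by ring.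
rewrite ler_wpM2r ?exprn_ge0// exprS ler_pM ?exprn_ge0 ?mulr_ge0 ?(ltW sV0)//.
by rewrite /M; lra.
Qed.

(** The power series takes its k-th coefficient from the approximation of order k + 1, the first one
    in which [coef_stable] fixes it. *)
Lemma germ_analytic_at M g z0 : 1 <= M -> germ M g z0 ->
  analytic_at (g : (C : numFieldType) -> C) z0.
Proof.
move=> M1 gM; have M0 : 0 <= M by lra.
have /choice[P PP] : forall n, exists P, coef_bounded M P /\
    forall t, M * N t <= 2^-1 -> N (g (z0 + t) - P.[t]) <= M ^+ n.+1 * N t ^+ n.
  by move=> n; have [P bP hP] := gM n; exists P.
have PC k n : (k < n)%N -> (P n)`_k = (P k.+1)`_k.
  move=> kn.
  apply: (@coef_stable M _ _ (M ^+ n.+1 + M ^+ k.+2) k.+1) => //.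
  - by rewrite addr_ge0 ?exprn_ge0.
  - exact: (PP n).1.
  - exact: (PP k.+1).1.
  move=> t Mt; rewrite (_ : _ - _ = (g (z0 + t) - (P k.+1).[t]) -
    (g (z0 + t) - (P n).[t])); last first.
    by ring.
  rewrite (le_trans (ler_normcB _ _))// addrC mulrDl lerD//.
    apply: le_trans ((PP n).2 _ Mt) _; rewrite ler_wpM2l ?exprn_ge0//.
    apply: ler_wiXn2l => //; first exact: normc_ge0.
    have := normc_ge0 t; nra.
  exact: ((PP k.+1).2).
exists (fun k => (P k.+1)`_k).
apply/nbhs_normcP; exists (2 * M)^-1; first by rewrite invr_gt0; lra.
move=> z zt; set t := z - z0.
have Mt : M * N t <= 2^-1.
  rewrite -ler_pdivlMl; last lra.
  by rewrite -invfM mulrC ltW.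
have t0 := normc_ge0 t.
apply/cvg_normcP => e e0.
have := @near_geom_lt (3 * M) 2^-1 e; rewrite invr_ge0 ler0n invf_lt1// ltr1n.
move=> /(_ isT e0); apply: filterS => n; apply: le_lt_trans.
have zE : z = z0 + t by rewrite /t addrC subrK.
rewrite {1}zE (_ : _ - _ = (g (z0 + t) - (P n).[t]) +
  ((P n).[t] - series (fun k => (P k.+1)`_k * t ^+ k) n)); last first.
  by ring.
have b1 := (PP n).2 _ Mt.
have b1' : M ^+ n.+1 * N t ^+ n <= M * 2^-1 ^+ n.
  rewrite exprS -mulrA -exprMn ler_wpM2l// lerXn2r// nnegrE ?mulr_ge0// invr_ge0//.
have b2 : N ((P n).[t] - series (fun k => (P k.+1)`_k * t ^+ k) n) <=
    2 * M * 2^-1 ^+ n.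
  rewrite /series /= big_mkord.
  rewrite (@horner_coef_wide _ (n + size (P n))) ?leq_addl//.
  rewrite big_split_ord /=.
  under eq_bigr do rewrite PC//.
  rewrite addrAC subrr add0r (le_trans (ler_normc_sum _ _ _))//.
  apply: (@le_trans _ _ (\sum_(i < size (P n)) M * 2^-1 ^+ n * 2^-1 ^+ i)).
    apply: ler_sum => i _; rewrite Normc.normcM normcX.
    apply: (@le_trans _ _ (M * (M * N t) ^+ (n + i))).
      rewrite exprMn mulrA -exprS ler_wpM2r ?exprn_ge0//.
      exact: (PP n).1.
    rewrite -mulrA -exprD ler_wpM2l// lerXn2r// nnegrE ?mulr_ge0// invr_ge0//.
  rewrite -mulr_sumr.
  have h2 : 0 <= 2^-1 :> R by rewrite invr_ge0.
  have := @geometric_sum_le2 R (size (P n)) 2^-1 h2 (lexx _).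
  have X0 : 0 <= M * 2^-1 ^+ n by rewrite mulr_ge0 ?exprn_ge0.
  by move=> /(ler_wpM2l X0); lra.
rewrite (le_trans (le_normcD _ _))//; lra.
Qed.

(** The natural bound is k^2 r^(k-2) |u|^2; multiplying by r^2 avoids negative exponents for k <
    2. *)
Lemma exp_taylor2 (r : R) (s u : C) k : 0 <= r -> N s + N u <= r ->
  r ^+ 2 * N ((s + u) ^+ k - s ^+ k - k%:R * s ^+ k.-1 * u) <=
  (k ^ 2)%:R * r ^+ k * N u ^+ 2.
Proof.
move=> r0 sr; have [s0 u0] := (normc_ge0 s, normc_ge0 u).
elim: k => [|k IH].
  by rewrite !expr0 subrr mul0r mul0r subrr Normc.normc0 mulr0 !mul0r.
case: k IH => [|k] IH.
  have -> : (s + u) ^+ 1 - s ^+ 1 - 1 * s ^+ 1.-1 * u = 0.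
    by rewrite !expr1 expr0; ring.
  by rewrite Normc.normc0 mulr0 !mulr_ge0 ?exprn_ge0.
rewrite (_ : (s + u) ^+ k.+2 - s ^+ k.+2 - k.+2%:R * s ^+ k.+2.-1 * u =
  (s + u) * ((s + u) ^+ k.+1 - s ^+ k.+1 - k.+1%:R * s ^+ k.+1.-1 * u) +
  k.+1%:R * s ^+ k * u ^+ 2); last first.
  by rewrite /= -[k.+2%:R]natr1 !exprS; ring.
set d := _ - k.+1%:R * _ * u in IH *.
apply: (@le_trans _ _ (r * (r ^+ 2 * N d) + k.+1%:R * r ^+ k.+2 * N u ^+ 2)).
  apply: (@le_trans _ _ (r ^+ 2 * (r * N d + k.+1%:R * r ^+ k * N u ^+ 2))); last first.
    by rewrite !exprS; lra.
  rewrite ler_wpM2l ?exprn_ge0// (le_trans (le_normcD _ _))// !(normcX, Normc.normcM).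
  rewrite lerD//.
    by rewrite ler_wpM2r ?normc_ge0// (le_trans (le_normcD _ _)).
  rewrite ler_wpM2r ?exprn_ge0//.
  have -> : N k.+1%:R = k.+1%:R :> R.
    have -> : k.+1%:R = (k.+1%:R%:C)%C :> C by rewrite rmorph_nat.
    by rewrite normc_real ger0_norm.
  by rewrite ler_wpM2l// lerXn2r ?nnegrE//; lra.
apply: (@le_trans _ _ (((k.+1 ^ 2) + k.+1)%:R * r ^+ k.+2 * N u ^+ 2)).
  rewrite natrD !mulrDl lerD2r [X in _ <= X](_ : _ = r * ((k.+1 ^ 2)%:R * r ^+ k.+1 * N u ^+ 2)).
    by rewrite ler_wpM2l.
  by rewrite [r ^+ k.+2]exprS; ring.
rewrite ler_wpM2r ?exprn_ge0// ler_wpM2r ?exprn_ge0// ler_nat.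
by rewrite !expnS expn0; lia.
Qed.

Lemma sqr_le_exp2 k : (k ^ 2 <= 2 ^ k.+1)%N.
Proof.
case: k => [//|[//|[//|k]]].
elim: k => [//|k IH]; rewrite [leqRHS]expnS mul2n -addnn.
apply: leq_trans (leq_add IH IH); rewrite -!mulnn; lia.
Qed.

(* Both increments equal t g'(z) up to O(t^2), so this is a form of the
   Cauchy-Riemann equations that does not mention derivatives. *)
Lemma germ_cauchy_riemann M g z0 : 1 <= M -> germ M g z0 ->
  forall z (t : R), N (z - z0) <= (8 * M)^-1 -> `|t| <= (8 * M)^-1 ->
  N (g (z + 'i%C * (t%:C)%C) - g z - 'i%C * (g (z + (t%:C)%C) - g z)) <=
  128 * M ^+ 3 * t ^+ 2.
Proof.
move=> M1 gM z t zr tr; have M0 : 0 <= M by lra.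
set s := z - z0 in zr *; have zE : z = z0 + s by rewrite addrC subrK.
clearbody s.
have M8 : 0 < 8 * M by lra.
have Ni : N ('i%C) = 1 by rewrite /Normc.normc expr0n add0r expr1n sqrtr1.
have MV : M * (8 * M)^-1 = 8^-1 by field; lra.
have s0 := normc_ge0 s; have t0 := normr_ge0 t.
have Ms : M * N s <= 8^-1 by rewrite -MV ler_wpM2l.
have Mt : M * `|t| <= 8^-1 by rewrite -MV ler_wpM2l.
have NT : N (t%:C)%C = `|t| by rewrite normc_real.
have NiT : N ('i%C * (t%:C)%C) = `|t| by rewrite Normc.normcM Ni mul1r.
pose r := (4 * M)^-1.
have r0 : 0 < r by rewrite invr_gt0; lra.
have Mr : M * r = 4^-1 by rewrite /r; field; lra.
have rE : r = (8 * M)^-1 + (8 * M)^-1 by rewrite /r; field; lra.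
have sr w : N w = `|t| -> N s + N w <= r by move=> ->; rewrite rE lerD.
pose cr (h : C -> C) := h (s + 'i%C * (t%:C)%C) - h s - 'i%C * (h (s + (t%:C)%C) - h s).
have crP (P : {poly C}) : coef_bounded M P ->
    N (cr (horner P)) <= 128 * M ^+ 3 * t ^+ 2.
  move=> bP.
  pose D := \sum_(k < size P) P`_k * (k%:R * s ^+ k.-1).
  have X (w : C) : N w = `|t| ->
      N (P.[s + w] - P.[s] - D * w) <= 64 * M ^+ 3 * t ^+ 2.
    move=> wt.
    have r2 : 0 < r ^+ 2 by rewrite exprn_gt0.
    rewrite -(ler_pM2l r2).
    have -> : r ^+ 2 * (64 * M ^+ 3 * t ^+ 2) = 4 * M * t ^+ 2.
      by rewrite /r; field; lra.
    rewrite !horner_coef mulr_suml -!sumrB.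
    apply: le_trans (ler_wpM2l (ltW r2) (ler_normc_sum _ _ _)) _.
    rewrite mulr_sumr.
    apply: (@le_trans _ _ (\sum_(k < size P) 2 * M * t ^+ 2 * 2^-1 ^+ k)).
      apply: ler_sum => k _.
      have -> : P`_k * (s + w) ^+ k - P`_k * s ^+ k -
          P`_k * (k%:R * s ^+ k.-1) * w =
          P`_k * ((s + w) ^+ k - s ^+ k - k%:R * s ^+ k.-1 * w) by ring.
      rewrite Normc.normcM mulrCA.
      apply: (@le_trans _ _ (M ^+ k.+1 * ((k ^ 2)%:R * r ^+ k * N w ^+ 2))).
        apply: ler_pM; rewrite ?normc_ge0//.
          by rewrite mulr_ge0 ?normc_ge0 ?exprn_ge0 ?(ltW r0).
        by apply: exp_taylor2; [exact: ltW|exact: sr].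
      rewrite wt real_normK ?num_real//.
      have -> : M ^+ k.+1 * ((k ^ 2)%:R * r ^+ k * t ^+ 2) =
         (M * t ^+ 2) * ((k ^ 2)%:R * (M * r) ^+ k) by rewrite exprMn exprS; ring.
      have -> : 2 * M * t ^+ 2 * 2^-1 ^+ k = (M * t ^+ 2) * (2 * 2^-1 ^+ k) by ring.
      rewrite Mr; apply: ler_wpM2l; first by apply: mulr_ge0 => //; exact: sqr_ge0.
      have -> : 2 * 2^-1 ^+ k = 2 ^+ k.+1 * 4^-1 ^+ k :> R.
        have -> : 4^-1 = 2^-1 * 2^-1 :> R by field.
        by rewrite exprMn exprS -mulrA [2 ^+ k * _]mulrA -exprMn mulfV ?expr1n ?mul1r// pnatr_eq0.
      rewrite ler_wpM2r ?exprn_ge0 ?invr_ge0//.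
      by rewrite -natrX ler_nat sqr_le_exp2.
    rewrite -mulr_sumr.
    have h2 : 0 <= 2^-1 :> R by rewrite invr_ge0.
    have := @geometric_sum_le2 R (size P) 2^-1 h2 (lexx _).
    have X0 : 0 <= 2 * M * t ^+ 2 by rewrite mulr_ge0 ?sqr_ge0 ?mulr_ge0.
    by move=> /(ler_wpM2l X0); lra.
  have -> : cr (horner P) = (P.[s + 'i%C * (t%:C)%C] - P.[s] - D * ('i%C * (t%:C)%C))
     - 'i%C * (P.[s + (t%:C)%C] - P.[s] - D * (t%:C)%C) by rewrite /cr; ring.
  rewrite (le_trans (ler_normcB _ _))// Normc.normcM Ni mul1r.
  by have := X _ NT; have := X _ NiT; lra.
(* The error of replacing [g] by a polynomial is not quadratic in [t], but it tends to 0 with the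
   order [n] while the bound for polynomials does not depend on [n]. So [n] is chosen after an
   arbitrary slack [e]. *)
apply/ler_addgt0Pr => e e0.
have := @near_geom_lt (4 * M) 4^-1 e; rewrite invr_ge0 ler0n invf_lt1// ltr1n.
move=> /(_ isT e0) [n _ nP]; have {nP} := nP n (leqnn n) => en.
have [P bP hP] := gM n.
have err w : M * N w <= 4^-1 -> N (g (z0 + w) - P.[w]) <= M * 4^-1 ^+ n.
  move=> Mw; apply: le_trans (hP _ _) _; first lra.
  rewrite exprS -mulrA -exprMn ler_wpM2l//.
  by rewrite lerXn2r ?nnegrE ?mulr_ge0 ?normc_ge0 ?invr_ge0.
have errw w : N w = `|t| -> N (g (z0 + (s + w)) - P.[s + w]) <= M * 4^-1 ^+ n.
  move=> wt; apply: err; apply: le_trans (ler_wpM2l M0 (le_normcD _ _)) _.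
  by rewrite wt mulrDr; lra.
have e1 : N (g (z0 + s) - P.[s]) <= M * 4^-1 ^+ n by apply: err; lra.
have e2 := errw _ NT; have e3 := errw _ NiT.
have -> : g (z + 'i%C * (t%:C)%C) - g z - 'i%C * (g (z + (t%:C)%C) - g z) =
  cr (horner P) + ((g (z0 + (s + 'i%C * (t%:C)%C)) - P.[s + 'i%C * (t%:C)%C]) -
   (g (z0 + s) - P.[s]) - 'i%C * ((g (z0 + (s + (t%:C)%C)) - P.[s + (t%:C)%C]) -
   (g (z0 + s) - P.[s]))).
  by rewrite /cr zE -[z0 + s + 'i%C * _]addrA -[z0 + s + (t%:C)%C]addrA; ring.
rewrite (le_trans (le_normcD _ _))// lerD ?crP//.
rewrite (le_trans (ler_normcB _ _))// Normc.normcM Ni mul1r.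
have f1 := ler_normcB (g (z0 + (s + 'i%C * (t%:C)%C)) - P.[s + 'i%C * (t%:C)%C]) (g (z0 + s) - P.[s]).
have f2 := ler_normcB (g (z0 + (s + (t%:C)%C)) - P.[s + (t%:C)%C]) (g (z0 + s) - P.[s]).
move: en; lra.
Qed.

End GermAnalytic.

Section AnalyticClosure.
Variable R : realType.
Local Notation C := (R[i]).
Local Notation N := (@Normc.normc R).
Local Notation analytic g z0 := (analytic_at (g : (C : numFieldType) -> C) z0).
Implicit Types (z w t : C) (f g : C -> C).

Lemma analytic_atP g z0 :
  analytic g z0 <-> exists2 M, 1 <= M & germ M g z0.
Proof. by split=> [/analytic_at_germ//|[M M1 gM]]; apply: germ_analytic_at gM. Qed.

Lemma analytic_at_cst c z0 : analytic (fun=> c) z0.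
Proof. exact/analytic_atP/germ_cst. Qed.

Lemma analytic_at_id z0 : analytic id z0.
Proof. exact/analytic_atP/germ_id. Qed.

Lemma analytic_atM f g z0 : analytic f z0 -> analytic g z0 ->
  analytic (fun z => f z * g z) z0.
Proof.
move=> /analytic_atP[M M1 fM] /analytic_atP[L L1 gL].
apply/analytic_atP; exists (5 * (M + L) ^+ 2).
  have : 1 <= (M + L) ^+ 2 by apply: exprn_ege1; lra.
  lra.
by apply: germM; [lra|apply: germ_weaken fM; lra|apply: germ_weaken gL; lra].
Qed.

Lemma analytic_at_inv z0 : z0 != 0 -> analytic (fun z => z^-1) z0.
Proof. by move=> z00; exact/analytic_atP/germ_inv. Qed.

Lemma analytic_at_comp f g z0 : analytic f z0 -> analytic g (f z0) ->
  analytic (fun z => g (f z)) z0.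
Proof.
move=> /analytic_atP[M M1 fM] /analytic_atP[L L1 gL].
apply/analytic_atP; exists (12 * L ^+ 2 * M ^+ 2); last exact: germ_comp.
have : 1 <= M ^+ 2 by apply: exprn_ege1.
have : 1 <= L ^+ 2 by apply: exprn_ege1.
nra.
Qed.

Lemma analytic_at_shift g z0 w : analytic g (z0 + w) ->
  analytic (fun z => g (z + w)) z0.
Proof.
move=> gw; apply: (@analytic_at_comp (fun z => z + w) g z0 _ gw).
exact: (analytic_atD (analytic_at_id z0) (analytic_at_cst w z0)).
Qed.

End AnalyticClosure.

Lemma is_derive_continuous (R : realType) (f : R -> R) (x df : R) :
  is_derive x 1 f df -> {for x, continuous f}.
Proof.
move=> fd; apply/differentiable_continuous/derivable1_diffP.
exact: (@ex_derive _ _ _ _ _ _ _ fd).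
Qed.

(** * The complex exponential *)

Section ComplexExp.
Variable R : realType.
Local Notation C := (R[i]).
Local Notation N := (@Normc.normc R).
Local Notation analytic g z0 := (analytic_at (g : (C : numFieldType) -> C) z0).
Implicit Types (z w t : C) (x y : R).

Definition cexp z : C :=
  Complex (expR (complex.Re z) * cos (complex.Im z))
          (expR (complex.Re z) * sin (complex.Im z)).

Lemma cexp0 : cexp 0 = 1.
Proof. by rewrite /cexp /= expR0 cos0 sin0 !mul1r. Qed.

Lemma cexpD z w : cexp (z + w) = cexp z * cexp w.
Proof.
case: z w => [a b] [c d]; rewrite /cexp /= expRD cosD sinD.
by apply/eqP; rewrite eq_complex /=; apply/andP; split; apply/eqP; ring.
Qed.

Lemma normc_cexp z : N (cexp z) = expR (complex.Re z).
Proof.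
rewrite /cexp /Normc.normc !exprMn -mulrDr cos2Dsin2 mulr1 sqrtr_sqr.
by rewrite ger0_norm// expR_ge0.
Qed.

Lemma cexp_imag x : cexp (Complex 0 x) = Complex (cos x) (sin x).
Proof. by rewrite /cexp /= expR0 !mul1r. Qed.

Lemma realM_complex (a : R) (b c : R) : (a%:C)%C * Complex b c = Complex (a * b) (a * c).
Proof.
by apply/eqP; rewrite eq_complex /=; apply/andP; split; apply/eqP; ring.
Qed.

Definition exp_poly n z : C := \sum_(k < n) z ^+ k / k`!%:R.

Section Component.
Variable L : C -> R.
Hypothesis LD : forall z w, L (z + w) = L z + L w.
Hypothesis LZ : forall a z, L ((a%:C)%C * z) = a * L z.
Hypothesis LN : forall z, `|L z| <= N z.
Hypothesis Lexp : forall w x, is_derive x 1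
  (fun s : R => L (cexp ((s%:C)%C * w))) (L (w * cexp ((x%:C)%C * w))).

Let L0 : L 0 = 0.
Proof. by have := LZ 0 0; rewrite mulr0 mul0r. Qed.

Let LB z w : L (z - w) = L z - L w.
Proof. by have := LD (z - w) w; rewrite subrK => ->; rewrite addrK. Qed.

Lemma is_derive_exp_poly n w x : is_derive x 1
  (fun s : R => L (exp_poly n.+1 ((s%:C)%C * w))) (L (w * exp_poly n ((x%:C)%C * w))).
Proof.
elim: n => [|n IH].
  rewrite /exp_poly big_ord0 mulr0 L0.
  rewrite (_ : (fun s => _) = cst (L 1)); first exact: is_derive_cst.
  by apply/funext => s; rewrite big_ord1 expr0 fact0 divr1.
pose W := w ^+ n.+1 / (n.+1)`!%:R.
have -> : (fun s : R => L (exp_poly n.+2 ((s%:C)%C * w))) =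
    (fun s : R => L (exp_poly n.+1 ((s%:C)%C * w))) + (L W) \*: ((@id R) ^+ n.+1).
  apply/funext => s; rewrite /exp_poly big_ord_recr LD fctE; congr (_ + _).
  rewrite /= exprMn -mulrA -/W -rmorphXn LZ /= mulrC.
  by rewrite exprfctE.
apply: is_derive_eq.
rewrite [in RHS]/exp_poly big_ord_recr /= mulrDr LD; congr (_ + _).
rewrite /= exprMn -rmorphXn.
rewrite (_ : w * _ = ((x ^+ n)%:C)%C * (w ^+ n.+1 / n`!%:R)); last first.
  by rewrite exprS; ring.
rewrite LZ.
have -> : w ^+ n.+1 / n`!%:R = ((n.+1%:R : R)%:C)%C * W.
  have f0 k : k`!%:R != 0 :> C by rewrite pnatr_eq0 -lt0n fact_gt0.
  rewrite /W factS natrM rmorph_nat; field.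
  by rewrite f0 /= addrC natr1 pnatr_eq0.
by rewrite LZ /GRing.scale /=; ring.
Qed.

(** Mean value theorem along the segment from 0 to [w], for [L] the real or the imaginary part: the
    derivative of the remainder of order n + 1 is [w] times the remainder of order n. *)
Lemma exp_poly_component n w B : (0 <= B) ->
  (forall s : R, 0 <= s <= 1 -> N (cexp ((s%:C)%C * w) - exp_poly n ((s%:C)%C * w)) <= B) ->
  `|L (cexp w - exp_poly n.+1 w)| <= N w * B.
Proof.
move=> B0 HB.
pose f (s : R) := L (cexp ((s%:C)%C * w)) - L (exp_poly n.+1 ((s%:C)%C * w)).
pose df (s : R) := L (w * (cexp ((s%:C)%C * w) - exp_poly n ((s%:C)%C * w))).
have fd (s : R) : is_derive s 1 f (df s).
  rewrite /df mulrBr LB.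
  have := is_derive_exp_poly n w s; have := Lexp w s.
  by move=> h1 h2; apply: is_deriveB.
have [|c c01] := @MVT R f df 0 1 ltr01 (fun s _ => fd s).
  apply: continuous_subspaceT => s.
  exact: is_derive_continuous (fd s).
rewrite subr0 mulr1 {1 2}/f rmorph1 mul1r rmorph0 mul0r cexp0.
rewrite (_ : exp_poly n.+1 0 = 1); last first.
  rewrite /exp_poly big_ord_recl expr0 fact0 divr1 big1 ?addr0// => i _.
  by rewrite expr0n mul0r.
rewrite subrr subr0 -LB => ->.
apply: le_trans (LN _) _; rewrite Normc.normcM ler_wpM2l ?normc_ge0//.
by apply: HB; move: c01; rewrite in_itv /= => /andP[/ltW -> /ltW ->].
Qed.

End Component.

Lemma is_derive_cexp_Re w x : is_derive x 1
  (fun s : R => complex.Re (cexp ((s%:C)%C * w)))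
  (complex.Re (w * cexp ((x%:C)%C * w))).
Proof.
case: w => a b.
have -> : (fun s : R => complex.Re (cexp ((s%:C)%C * Complex a b))) =
  (expR \o (fun s => s * a)) * (cos \o (fun s => s * b)).
  by apply/funext => s; rewrite realM_complex.
have da c : is_derive x 1 (fun s : R => s * c) c.
  have -> : (fun s : R => s * c) = c \*: (@id R).
    by apply/funext => s; rewrite mulrC.
  by apply: is_derive_eq; rewrite scaler1.
have := @is_derive1_comp R expR (fun s => s * a) x _ _ (is_derive_expR _) (da a).
have := @is_derive1_comp R cos (fun s => s * b) x _ _ (is_derive_cos _) (da b).
move=> h1 h2; apply: is_derive_eq.
by rewrite realM_complex /cexp /= /GRing.scale /=; ring.
Qed.

Lemma is_derive_cexp_Im w x : is_derive x 1
  (fun s : R => complex.Im (cexp ((s%:C)%C * w)))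
  (complex.Im (w * cexp ((x%:C)%C * w))).
Proof.
case: w => a b.
have -> : (fun s : R => complex.Im (cexp ((s%:C)%C * Complex a b))) =
  (expR \o (fun s => s * a)) * (sin \o (fun s => s * b)).
  by apply/funext => s; rewrite realM_complex.
have da c : is_derive x 1 (fun s : R => s * c) c.
  have -> : (fun s : R => s * c) = c \*: (@id R).
    by apply/funext => s; rewrite mulrC.
  by apply: is_derive_eq; rewrite scaler1.
have := @is_derive1_comp R expR (fun s => s * a) x _ _ (is_derive_expR _) (da a).
have := @is_derive1_comp R sin (fun s => s * b) x _ _ (is_derive_sin _) (da b).
move=> h1 h2; apply: is_derive_eq.
by rewrite realM_complex /cexp /= /GRing.scale /=; ring.
Qed.

(** Each induction step costs a factor 2, since the bounds for the real and the imaginary part are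
    added. The resulting rate is far from 1 / n!, but [germ] asks only for a geometric one. *)
Lemma exp_poly_error n w : N w <= 1 ->
  N (cexp w - exp_poly n w) <= expR 1 * (2 * N w) ^+ n.
Proof.
elim: n w => [|n IH] w w1.
  rewrite /exp_poly big_ord0 subr0 expr0 mulr1 normc_cexp ler_expR.
  by apply: le_trans w1; apply: le_trans (ler_norm _) (normRe_le _).
have w0 := normc_ge0 w.
have B0 : 0 <= expR 1 * (2 * N w) ^+ n.
  by rewrite mulr_ge0 ?expR_ge0// exprn_ge0// mulr_ge0.
have HB (s : R) : 0 <= s <= 1 ->
    N (cexp ((s%:C)%C * w) - exp_poly n ((s%:C)%C * w)) <= expR 1 * (2 * N w) ^+ n.
  move=> /andP[s0 s1].
  have sw : N ((s%:C)%C * w) <= N w.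
    by rewrite Normc.normcM normc_real ger0_norm// ler_piMl.
  apply: le_trans (IH _ (le_trans sw w1)) _.
  rewrite ler_wpM2l ?expR_ge0// lerXn2r ?nnegrE ?mulr_ge0 ?normc_ge0//.
  by rewrite ler_wpM2l.
apply: le_trans (normc_le_ReIm _) _.
have h1 : `|complex.Re (cexp w - exp_poly n.+1 w)| <= N w * (expR 1 * (2 * N w) ^+ n).
  apply: exp_poly_component => //.
  - by case=> [a b] [c d].
  - by move=> a [b c]; rewrite realM_complex.
  - exact: normRe_le.
  - exact: is_derive_cexp_Re.
have h2 : `|complex.Im (cexp w - exp_poly n.+1 w)| <= N w * (expR 1 * (2 * N w) ^+ n).
  apply: exp_poly_component => //.
  - by case=> [a b] [c d].
  - by move=> a [b c]; rewrite realM_complex.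
  - exact: normIm_le.
  - exact: is_derive_cexp_Im.
by rewrite exprS; lra.
Qed.

Lemma analytic_at_cexp z0 : analytic cexp z0.
Proof.
have e1 : 1 <= expR 1 :> R by rewrite -[leLHS]expR0 ler_expR.
have E0 : analytic cexp 0.
  apply/analytic_atP; exists (2 * expR 1) => [|n]; first lra.
  exists (\poly_(k < n) (k`!%:R)^-1) => [k|t Mt].
    rewrite coef_poly; case: ifP => _; last first.
      by rewrite Normc.normc0 exprn_ge0// mulr_ge0// expR_ge0.
    have k1 : (1 : R) <= k`!%:R by rewrite ler1n fact_gt0.
    have -> : (k`!%:R)^-1 = ((k`!%:R : R)^-1%:C)%C :> C.
      by rewrite fmorphV rmorph_nat.
    rewrite normc_real ger0_norm ?invr_ge0//.
    apply: (@le_trans _ _ 1); first by rewrite invf_le1//; lra.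
    by rewrite exprn_ege1//; lra.
  have t0 := normc_ge0 t.
  rewrite add0r horner_poly.
  have -> : \sum_(i < n) i`!%:R^-1 * t ^+ i = exp_poly n t.
    by apply: eq_bigr => i _; rewrite mulrC.
  have tn : N t <= 1 by nra.
  apply: le_trans (exp_poly_error _ tn) _.
  rewrite exprMn exprS.
  have X0 : 0 <= N t ^+ n by rewrite exprn_ge0.
  rewrite !mulrA ler_wpM2r//.
  have : 2 ^+ n <= (2 * expR 1) ^+ n :> R.
    by rewrite lerXn2r ?nnegrE//; lra.
  have : 0 <= 2 ^+ n :> R by rewrite exprn_ge0.
  nra.
have -> : cexp = (fun z => cexp z0 * cexp (z - z0)).
  by apply/funext => z; rewrite -cexpD addrC subrK.
apply: analytic_atM; first exact: analytic_at_cst.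
by apply: analytic_at_shift; rewrite subrr.
Qed.

End ComplexExp.

(** * Fourier series of analytic periodic functions *)

Section Periodic.
Variable R : realType.
Implicit Types (x y : R) (f : R -> R).

Lemma pi2_gt0 : 0 < 2 * pi :> R.
Proof. by rewrite mulr_gt0// pi_gt0. Qed.

Lemma periodic_int (T : Type) (f : R -> T) :
  (forall x, f (x + 2 * pi) = f x) ->
  forall (m : int) x, f (x + m%:~R * (2 * pi)) = f x.
Proof.
move=> fp; have fn (n : nat) x : f (x + n%:R * (2 * pi)) = f x.
  elim: n x => [|n IH] x; first by rewrite mul0r addr0.
  by rewrite -natr1 mulrDl mul1r addrA fp IH.
case=> n x; first exact: fn.
rewrite NegzE -[in RHS](subrK (n.+1%:R * (2 * pi)) x) fn.
by rewrite mulrNz mulNr.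
Qed.

Lemma mod_period (c x : R) : exists m : int, c <= x - m%:~R * (2 * pi) < c + 2 * pi.
Proof.
exists (Num.floor ((x - c) / (2 * pi))).
have := floor_itv ((x - c) / (2 * pi)); set k := Num.floor _.
rewrite ler_pdivlMr ?pi2_gt0// ltr_pdivrMr ?pi2_gt0// intrD mulr1z mulrDl mul1r.
move=> /andP[h1 h2]; apply/andP; split; lra.
Qed.

Lemma sum_shift_periodic (g : nat -> R) n : (forall k, g (k + n)%N = g k) ->
  forall l, \sum_(k < n) g (k + l)%N = \sum_(k < n) g k.
Proof.
case: n => [|n] gn l; first by rewrite !big_ord0.
elim: l => [|l <-]; first by under eq_bigr do rewrite addn0.
rewrite big_ord_recr [RHS]big_ord_recl /= addrC add0n.
congr (_ + _); first by rewrite addnS -addSn addnC gn.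
by apply: eq_bigr => i _; rewrite /bump /= add1n addnS.
Qed.

End Periodic.

(** * Invariant means on the circle *)

Section Mean.
Variable R : realType.
Implicit Types (x y : R) (f g : R -> R).

Definition bounded_by f (B : R) := forall x, `|f x| <= B.

(** This is all that is kept of the integral over a period. Invariance under translations by 2 pi /
    n already kills every nonconstant harmonic, by a translation of half a wavelength, and allows
    contours to be moved in small steps. *)
Record mean_spec (mu : (R -> R) -> R) : Prop := MeanSpec {
  meanD : forall f g A B, bounded_by f A -> bounded_by g B ->
    mu (fun x => f x + g x) = mu f + mu g;
  meanZ : forall c f A, bounded_by f A -> mu (fun x => c * f x) = c * mu f;
  mean_le : forall f A, bounded_by f A -> `|mu f| <= A;
  mean1 : mu (fun=> 1) = 1;
  mean_shift : forall f A n, bounded_by f A -> (0 < n)%N ->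
    (forall x, f (x + 2 * pi) = f x) ->
    mu (fun x => f (x + 2 * pi / n%:R)) = mu f }.

Definition grid_avg m f := (m`!)%:R^-1 * \sum_(k < m`!) f (2 * pi * k%:R / m`!%:R).

Lemma grid_avg_le m f A : bounded_by f A -> `|grid_avg m f| <= A.
Proof.
move=> fA; have m0 : 0 < m`!%:R :> R by rewrite ltr0n fact_gt0.
rewrite /grid_avg normrM ger0_norm ?invr_ge0 ?(ltW m0)//.
rewrite ler_pdivrMl//; apply: le_trans (ler_norm_sum _ _ _) _.
apply: (@le_trans _ _ (\sum_(k < m`!) A)); first exact: ler_sum.
by rewrite sumr_const card_ord mulr_natl.
Qed.

Lemma grid_avg_shift m f n : (0 < n <= m)%N ->
  (forall x, f (x + 2 * pi) = f x) ->
  grid_avg m (fun x => f (x + 2 * pi / n%:R)) = grid_avg m f.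
Proof.
move=> nm fp; congr (_ * _).
have m0 : m`!%:R != 0 :> R by rewrite pnatr_eq0 -lt0n fact_gt0.
have /dvdnP[l lE] : (n %| m`!)%N by apply: dvdn_fact.
have n0 : n%:R != 0 :> R.
  by rewrite pnatr_eq0 -lt0n; case/andP: nm.
have l0 : l%:R != 0 :> R.
  by apply: contra_neq m0; rewrite lE natrM => ->; rewrite mul0r.
pose g k := f (2 * pi * k%:R / m`!%:R).
rewrite -[RHS](@sum_shift_periodic R g _ _ l); last first.
  move=> k; rewrite /g natrD mulrDr mulrDl mulfK// fp//.
apply: eq_bigr => k _; rewrite /g natrD; congr (f _).
have -> : m`!%:R = l%:R * n%:R :> R by rewrite lE natrM.
by field; rewrite n0 l0.
Qed.

(* The mean over a circle, obtained as an ultralimit of averages over the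
   (m!)-th roots of unity: for 2pi/n rotations invariance is then exact. *)
Lemma mean_exists : exists mu, mean_spec mu.
Proof.
have [U [UU NU]] := @ultraFilterLemma nat (nbhs \oo) _.
have UP : ProperFilter U by case: UU.
have cv f (A : R) : bounded_by f A -> cvg (grid_avg ^~ f @ U).
  move=> fA.
  have [|p [_ pc]] := @segment_compact R (- A) A (grid_avg ^~ f @ U) _.
    change (U ((grid_avg ^~ f) @^-1` `[- A, A])); apply: filterE => m.
    have := grid_avg_le m fA.
    by rewrite ler_norml /= in_itv.
  apply/cvg_ex; exists p => B pB.
  have [//|nB] := in_ultra_setVsetC ((grid_avg ^~ f) @^-1` B) UU.
  have [x []] := pc (~` B) B nB pB; by [].
exists (fun f => lim (grid_avg ^~ f @ U)); split.
- move=> f g A B fA gB; apply/cvg_lim => //.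
  rewrite (_ : grid_avg ^~ _ = (grid_avg ^~ f) \+ (grid_avg ^~ g)).
    by apply: cvgD; [exact: cv fA|exact: cv gB].
  by apply/funext => m; rewrite /grid_avg /= big_split mulrDr.
- move=> c f A fA; apply/cvg_lim => //.
  rewrite (_ : grid_avg ^~ _ = (fun m => c * grid_avg m f)).
    by apply: cvgMr; exact: cv fA.
  by apply/funext => m; rewrite /grid_avg /= -mulr_sumr mulrCA.
- move=> f A fA; rewrite -[leRHS](@ger0_norm _ A); last first.
    exact: le_trans (normr_ge0 _) (fA 0).
  rewrite ger0_norm; last exact: le_trans (normr_ge0 _) (fA 0).
  rewrite ler_norml; apply/andP; split.
    apply: limr_ge; first exact: cv fA.
    apply: filterE => m; have := grid_avg_le m fA.
    by rewrite ler_norml => /andP[].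
  apply: limr_le; first exact: cv fA.
  apply: filterE => m; have := grid_avg_le m fA.
  by rewrite ler_norml => /andP[].
- apply/cvg_lim => //; rewrite (_ : grid_avg ^~ _ = cst 1); first exact: cvg_cst.
  by apply/funext => m; rewrite /grid_avg sumr_const card_ord /= mulVf.
- move=> f A n fA n0 fp; apply/cvg_lim => //.
  apply: cvg_trans (cv f A fA); apply: near_eq_cvg.
  apply: NU; exists n => // m nm.
  by rewrite grid_avg_shift// n0.
Qed.

End Mean.

(** * Shifting horizontal contours *)

Section Contour.
Variable R : realType.
Local Notation C := (R[i]).
Local Notation N := (@Normc.normc R).
Local Notation analytic g z0 := (analytic_at (g : (C : numFieldType) -> C) z0).
Variable mu : (R -> R) -> R.
Hypothesis muP : mean_spec mu.

Definition cr_defect (G : C -> C) (x y t : R) : C :=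
  G (Complex x (y + t)) - G (Complex x y) -
  'i%C * (G (Complex (x + t) y) - G (Complex x y)).

(** [germ_cauchy_riemann] has a constant and a radius that depend on the centre; compactness of a
    period rectangle makes both uniform. Here [K] plays the two roles, bounding the defect and,
    through [K^-1], the step. *)
Lemma cr_defect_uniform (G : C -> C) (Y : R) : 0 <= Y ->
  (forall x y, 0 <= y <= Y -> analytic G (Complex x y)) ->
  exists2 K, 0 < K & forall x y t, 0 <= x <= 2 * pi -> 0 <= y <= Y ->
    `|t| <= K^-1 -> N (cr_defect G x y t) <= K * t ^+ 2.
Proof.
move=> Y0 aG.
have cpt : compact (`[0 : R, 2 * pi] `*` `[0 : R, Y]).
  by apply: compact_setX; exact: segment_compact.
have /compact_near_coveringP cov := cpt.
have := cov R (pinfty_nbhs R) (fun K p => forall t : R, `|t| <= K^-1 ->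
  N (cr_defect G p.1 p.2 t) <= K * t ^+ 2) _.
case.
  move=> [x y] [/= xI yI].
  have /analytic_at_germ[M M1 gM] : analytic G (Complex x y).
    by apply: aG; move: yI; rewrite /= in_itv.
  have r0 : 0 < (8 * M)^-1 / 2 by rewrite divr_gt0// invr_gt0; lra.
  near=> p K => t /= tK.
  have K8 : 8 * M <= K by near: K; apply: nbhs_pinfty_ge; rewrite num_real.
  have K128 : 128 * M ^+ 3 <= K by near: K; apply: nbhs_pinfty_ge; rewrite num_real.
  have px : `|x - p.1| < (8 * M)^-1 / 2.
    by near: p; exists (ball x ((8 * M)^-1 / 2), setT) => /=;
      [split; [exact: nbhsx_ballx|exact: filterT]|move=> q [/= ]].
  have py : `|y - p.2| < (8 * M)^-1 / 2.
    by near: p; exists (setT, ball y ((8 * M)^-1 / 2)) => /=;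
      [split; [exact: filterT|exact: nbhsx_ballx]|move=> q [/= ]].
  have tr : `|t| <= (8 * M)^-1.
    by apply: le_trans tK _; rewrite lef_pV2 ?posrE//; lra.
  have pz : N (Complex p.1 p.2 - Complex x y) <= (8 * M)^-1.
    apply: le_trans (normc_le_ReIm _) _ => /=.
    by rewrite distrC [ `|p.2 - y|]distrC; lra.
  have := germ_cauchy_riemann M1 gM pz tr.
  have -> : Complex p.1 p.2 + 'i%C * (t%:C)%C = Complex p.1 (p.2 + t).
    by apply/eqP; rewrite eq_complex /=; apply/andP; split; apply/eqP; ring.
  have -> : Complex p.1 p.2 + (t%:C)%C = Complex (p.1 + t) p.2.
    by apply/eqP; rewrite eq_complex /= addr0 !eqxx.
  by move=> /le_trans; apply; rewrite ler_wpM2r// sqr_ge0.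
move=> K0 [_ HK].
pose K := Num.max 1 (K0 + 1).
have K1 : 0 < K by rewrite lt_max ltr01.
exists K => // x y t xI yI tK.
have := HK K; rewrite lt_max [K0 < K0 + 1]ltrDl ltr01 orbT => /(_ isT (x, y)).
by apply; rewrite //=; split; rewrite /= in_itv.
Unshelve. all: by end_near. Qed.

Variables (G : C -> C) (Y B : R).
Hypothesis aG : forall x y, 0 <= y <= Y -> analytic G (Complex x y).
Hypothesis pG : forall x y, 0 <= y <= Y -> G (Complex (x + 2 * pi) y) = G (Complex x y).
Hypothesis bG : forall x y, 0 <= y <= Y -> N (G (Complex x y)) <= B.

(** By the Cauchy-Riemann equations, raising the line by t changes the real part by a horizontal
    increment of the imaginary part, up to K t^2, and vice versa. For t = 2 pi / m the mean of a
    horizontal increment vanishes. Hence Y / t steps change the mean by at most Y K t, which tends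
    to 0. The height is a rational multiple of 2 pi so that arbitrarily fine grids of this kind
    reach it exactly. *)
Lemma contour_shift (j n : nat) : (0 < n)%N -> Y = 2 * pi * j%:R / n%:R ->
  mu (fun x => complex.Re (G (Complex x Y))) =
    mu (fun x => complex.Re (G (Complex x 0))) /\
  mu (fun x => complex.Im (G (Complex x Y))) =
    mu (fun x => complex.Im (G (Complex x 0))).
Proof.
move=> n0 YE.
have nR : 0 < n%:R :> R by rewrite ltr0n.
have Y0 : 0 <= Y by rewrite YE divr_ge0 ?mulr_ge0 ?(ltW (pi_gt0 R)).
have [K K0 HK] := cr_defect_uniform Y0 aG.
have HK' x y t : 0 <= y <= Y -> 0 <= y + t <= Y -> `|t| <= K^-1 ->
    N (cr_defect G x y t) <= K * t ^+ 2.
  move=> yY ytY tK; have [m /andP[m1 m2]] := mod_period 0 x.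
  have H z s : 0 <= s <= Y -> G (Complex (z - m%:~R * (2 * pi)) s) = G (Complex z s).
    move=> sY; have := @periodic_int R C (fun x => G (Complex x s)) (fun x => pG x sY) (- m) z.
    by rewrite mulrNz mulNr.
  have -> : cr_defect G x y t = cr_defect G (x - m%:~R * (2 * pi)) y t.
    rewrite /cr_defect; have -> : x - m%:~R * (2 * pi) + t = (x + t) - m%:~R * (2 * pi).
      by rewrite addrAC.
    by rewrite !H.
  by apply: HK => //; rewrite m1 ltW//; lra.
pose u y x := complex.Re (G (Complex x y)).
pose v y x := complex.Im (G (Complex x y)).
have ub y : 0 <= y <= Y -> bounded_by (u y) B.
  by move=> yY x; apply: le_trans (normRe_le _) (bG _ yY).
have vb y : 0 <= y <= Y -> bounded_by (v y) B.
  by move=> yY x; apply: le_trans (normIm_le _) (bG _ yY).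
have [muD muZ mule mu_1 mush] := muP.
have shift_sub w y t m : 0 <= y <= Y -> bounded_by (w y) B ->
    (forall x, w y (x + 2 * pi) = w y x) -> (0 < m)%N -> t = 2 * pi / m%:R ->
    mu (fun x => w y (x + t) + (-1) * w y x) = 0.
  move=> yY wB wp m0 ->.
  have wB1 : bounded_by (fun x => w y (x + 2 * pi / m%:R)) B by move=> x; exact: wB.
  have wB2 : bounded_by (fun x => -1 * w y x) B.
    by move=> x; rewrite mulN1r normrN.
  by rewrite (muD _ _ _ _ wB1 wB2) (mush _ _ _ wB m0 wp) (muZ _ _ _ wB) mulN1r subrr.
have step y m : (0 < m)%N -> 0 <= y -> y + 2 * pi / m%:R <= Y -> 2 * pi / m%:R <= K^-1 ->
    `|mu (u (y + 2 * pi / m%:R)) - mu (u y)| <= K * (2 * pi / m%:R) ^+ 2 /\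
    `|mu (v (y + 2 * pi / m%:R)) - mu (v y)| <= K * (2 * pi / m%:R) ^+ 2.
  move=> m0 y0 ytY tK; set t := 2 * pi / m%:R in ytY tK *.
  have t0 : 0 < t by rewrite divr_gt0 ?pi2_gt0// ltr0n.
  have yY : 0 <= y <= Y by apply/andP; split; lra.
  have ytY' : 0 <= y + t <= Y by apply/andP; split; lra.
  have up x : u y (x + 2 * pi) = u y x by rewrite /u pG.
  have vp x : v y (x + 2 * pi) = v y x by rewrite /v pG.
  have crb x : N (cr_defect G x y t) <= K * t ^+ 2.
    by apply: HK' => //; rewrite ger0_norm// ltW.
  have c1 : bounded_by (fun x => complex.Re (cr_defect G x y t)) (K * t ^+ 2).
    by move=> x; apply: le_trans (normRe_le _) (crb x).
  have c2 : bounded_by (fun x => complex.Im (cr_defect G x y t)) (K * t ^+ 2).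
    by move=> x; apply: le_trans (normIm_le _) (crb x).
  have dB w : bounded_by (w y) B ->
      bounded_by (fun x => w y (x + t) + (-1) * w y x) (B + B).
    move=> wB x; apply: le_trans (ler_normD _ _) _.
    by rewrite lerD// mulN1r normrN.
  have addB f g b1 b2 : bounded_by f b1 -> bounded_by g b2 ->
      bounded_by (fun x : R => f x + g x) (b1 + b2).
    by move=> fb gb x; apply: le_trans (ler_normD _ _) _; rewrite lerD.
  have nB w : bounded_by (w y) B -> bounded_by (fun x => (-1) * (w y (x + t) + (-1) * w y x)) (B + B).
    by move=> wB x; rewrite mulN1r normrN; exact: dB.
  split.
    have -> : u (y + t) = (fun x => complex.Re (cr_defect G x y t) +
        (u y x + (-1) * (v y (x + t) + (-1) * v y x))).
      apply/funext => x; rewrite /u /v /cr_defect.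
      case: (G _) => a b; case: (G _) => c d; case: (G _) => e f /=.
      ring.
    rewrite (muD _ _ _ _ c1 (addB _ _ _ _ (ub _ yY) (nB v (vb _ yY)))).
    rewrite (muD _ _ _ _ (ub _ yY) (nB v (vb _ yY))) (muZ _ _ _ (dB v (vb _ yY))).
    rewrite (shift_sub v y t m yY (vb _ yY) vp m0 erefl) mulr0 addr0 addrK.
    exact: mule c1.
  have -> : v (y + t) = (fun x => complex.Im (cr_defect G x y t) +
      (v y x + (u y (x + t) + (-1) * u y x))).
    apply/funext => x; rewrite /u /v /cr_defect.
    case: (G _) => a b; case: (G _) => c d; case: (G _) => e f /=.
    ring.
  rewrite (muD _ _ _ _ c2 (addB _ _ _ _ (vb _ yY) (dB u (ub _ yY)))).
  rewrite (muD _ _ _ _ (vb _ yY) (dB u (ub _ yY))).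
  rewrite (shift_sub u y t m yY (ub _ yY) up m0 erefl) addr0 addrK.
  exact: mule c2.
have steps k m : (0 < m)%N -> k%:R * (2 * pi / m%:R) <= Y -> 2 * pi / m%:R <= K^-1 ->
    `|mu (u (k%:R * (2 * pi / m%:R))) - mu (u 0)| <= k%:R * (K * (2 * pi / m%:R) ^+ 2) /\
    `|mu (v (k%:R * (2 * pi / m%:R))) - mu (v 0)| <= k%:R * (K * (2 * pi / m%:R) ^+ 2).
  move=> m0 kY tK; set t := 2 * pi / m%:R in kY tK *.
  have t0 : 0 < t by rewrite divr_gt0 ?pi2_gt0// ltr0n.
  elim: k kY => [|k IH] kY; first by rewrite !mul0r !subrr normr0.
  move: kY; rewrite -natr1 mulrDl mul1r => kY.
  have k0 : 0 <= k%:R * t by rewrite mulr_ge0// ltW.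
  have kY' : k%:R * t <= Y by lra.
  have [h1 h2] := IH kY'; have [h3 h4] := step _ _ m0 k0 kY tK.
  rewrite -/t in h3 h4; rewrite mulrDl mul1r.
  split; [apply: le_trans (ler_distD (mu (u (k%:R * t))) _ _) _|
          apply: le_trans (ler_distD (mu (v (k%:R * t))) _ _) _]; lra.
suff lim0 (d : R) : (forall l, (0 < l)%N -> 2 * pi / (n * l)%:R <= K^-1 ->
    `|d| <= Y * K * (2 * pi / (n * l)%:R)) -> d = 0.
  have key l : (0 < l)%N -> 2 * pi / (n * l)%:R <= K^-1 ->
      `|mu (u Y) - mu (u 0)| <= Y * K * (2 * pi / (n * l)%:R) /\
      `|mu (v Y) - mu (v 0)| <= Y * K * (2 * pi / (n * l)%:R).
    move=> l0 tK; have nl : (0 < n * l)%N by rewrite muln_gt0 n0.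
    have lR : l%:R != 0 :> R by rewrite pnatr_eq0 -lt0n.
    have E : (j * l)%:R * (2 * pi / (n * l)%:R) = Y :> R.
      by rewrite YE !natrM; field; rewrite lR gt_eqF.
    have := steps (j * l)%N _ nl; rewrite E => /(_ (lexx _) tK).
    set t := 2 * pi / (n * l)%:R in E *.
    by have -> : (j * l)%:R * (K * t ^+ 2) = (j * l)%:R * t * K * t; [ring|rewrite E].
  split; apply/eqP; rewrite -subr_eq0; apply/eqP/lim0 => l l0 tK.
    by have [] := key l l0 tK.
  by have [] := key l l0 tK.
move=> Hd; apply/eqP/negPn/negP => d0.
have nd0 : 0 < `|d| by rewrite normr_gt0.
pose l := (Num.bound (2 * pi * K / n%:R) + Num.bound (Y * K * (2 * pi) / n%:R / `|d|)).+1.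
have pi0 := pi2_gt0 R.
have l1 : 2 * pi * K / n%:R < l%:R.
  apply: lt_trans (archi_boundP _) _; first by apply: divr_ge0 => //; apply: mulr_ge0; exact: ltW.
  by rewrite ltr_nat /l ltnS leq_addr.
have l2 : Y * K * (2 * pi) / n%:R / `|d| < l%:R.
  apply: lt_trans (archi_boundP _) _.
    apply: divr_ge0 => //; apply: divr_ge0 => //.
    by apply: mulr_ge0; [apply: mulr_ge0 => //; exact: ltW|exact: ltW].
  by rewrite ltr_nat /l ltnS leq_addl.
have lR : 0 < l%:R :> R by rewrite ltr0n.
have := Hd l isT; rewrite natrM.
have -> : 2 * pi / (n%:R * l%:R) <= K^-1.
  rewrite ltr_pdivrMr// in l1.
  by rewrite ler_pdivrMr ?mulr_gt0// ler_pdivlMl//; lra.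
move=> /(_ isT); apply/negP; rewrite -ltNge.
rewrite ltr_pdivrMr// ltr_pdivrMr// in l2.
by rewrite mulrA ltr_pdivrMr ?mulr_gt0//; lra.
Qed.

End Contour.

Section DerivableQuadratic.
Variable R : realType.

Lemma is_derive_quadratic (f : R -> R) (x D K r : R) : 0 < r ->
  (forall h, `|h| <= r -> `|f (x + h) - f x - h * D| <= K * h ^+ 2) ->
  is_derive x 1 f D.
Proof.
move=> r0 fK.
have K0 : 0 <= K.
  have := fK r; rewrite ger0_norm ?(ltW r0)// lexx => /(_ isT).
  by move=> /(le_trans (normr_ge0 _)); rewrite pmulr_lge0// exprn_gt0.
have cf : h^-1 *: ((f \o shift x) (h *: (1 : R)) - f x) @[h --> 0^'] --> D.
  apply/cvgrPdist_lt => e e0; near=> h.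
  have h0 : h != 0 by near: h; exact: nbhs_dnbhs_neq.
  have hr : `|h| < r by near: h; exact: dnbhs0_lt.
  have he : `|h| < e / (K + 1) by near: h; apply: dnbhs0_lt; rewrite divr_gt0//; lra.
  have := fK h (ltW hr); rewrite /= /GRing.scale /= mulr1 [h + x]addrC => fh.
  have nh : 0 < `|h| by rewrite normr_gt0.
  rewrite -(ltr_pM2l nh) -normrM mulrBr mulrA mulfV// mul1r distrC.
  apply: le_lt_trans fh _; rewrite -[h ^+ 2]real_normK ?num_real// expr2.
  have : (K + 1) * `|h| < e by rewrite mulrC -ltr_pdivlMr//; lra.
  by rewrite mulrCA ltr_pM2l//; lra.
apply: DeriveDef; first by apply/cvg_ex; exists D.
exact: cvg_lim cf.
Unshelve. all: by end_near. Qed.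

Lemma analytic_derivable (f : R -> R) (g : R[i] -> R[i]) (x : R) :
  analytic_at (g : (R[i] : numFieldType) -> R[i]) (x%:C)%C ->
  (forall y : R, g (y%:C)%C = ((f y)%:C)%C) -> exists D, is_derive x 1 f D.
Proof.
move=> /analytic_at_germ[M M1 gM] gf; have M0 : 0 <= M by lra.
have [P bP hP] := gM 2%N.
exists (complex.Re P`_1).
have r0 : 0 < (2 * M)^-1 by rewrite invr_gt0; lra.
apply: (@is_derive_quadratic _ _ _ (4 * M ^+ 3) _ r0) => h hr.
have Mh : M * Normc.normc (h%:C)%C <= 2^-1.
  rewrite normc_real; have := ler_wpM2l M0 hr.
  by rewrite invfM mulrCA mulfV ?mulr1//; lra.
have Mh0 : M * Normc.normc (0%:C)%C <= 2^-1.
  by rewrite normc_real normr0 mulr0 invr_ge0.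
have e1 := hP _ Mh; have := hP _ Mh0.
rewrite normc_real normr0 expr0n mulr0 addr0 horner_coef0 gf => e0.
have {e0} P0 : P`_0 = ((f x)%:C)%C.
  apply/esym/eqP; rewrite -subr_eq0; apply/eqP/Normc.eq0_normc/le_anti.
  by rewrite e0 normc_ge0.
have tail : Normc.normc (P.[(h%:C)%C] - P`_0 - P`_1 * (h%:C)%C) <= 2 * M ^+ 3 * h ^+ 2.
  rewrite horner_coef.
  pose a k := P`_k * (h%:C)%C ^+ k.
  have -> : \sum_(i < size P) P`_i * (h%:C)%C ^+ i = \sum_(i < 2 + size P) a i.
    rewrite -[RHS](big_mkord xpredT a) (big_cat_nat _ (n := size P))//=; last exact: leq_addl.
    rewrite big_mkord [X in _ + X]big_nat_cond [X in _ + X]big1 ?addr0// => i.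
    by rewrite andbT => /andP[si _]; rewrite /a nth_default// mul0r.
  rewrite big_split_ord /= big_ord_recl big_ord1 /a /= expr0 mulr1 expr1.
  rewrite (_ : _ - _ - _ = \sum_(i < size P) a (2 + i)%N); last first.
    by rewrite /a; ring.
  rewrite (le_trans (ler_normc_sum _ _ _))//.
  apply: (@le_trans _ _ (\sum_(i < size P) M ^+ 3 * h ^+ 2 * 2^-1 ^+ i)).
    apply: ler_sum => i _; rewrite /a Normc.normcM normcX.
    apply: (@le_trans _ _ (M ^+ 3 * h ^+ 2 * (M * Normc.normc (h%:C)%C) ^+ i)).
      rewrite (_ : M ^+ 3 * _ * _ = M ^+ (2 + i).+1 * (h ^+ 2 * Normc.normc (h%:C)%C ^+ i)); last first.
        by rewrite exprMn addSn add1n !exprS; ring.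
      rewrite -[h ^+ 2]real_normK ?num_real// -normc_real -exprD.
      by rewrite ler_wpM2r ?exprn_ge0 ?normc_ge0.
    apply: ler_wpM2l; first by apply: mulr_ge0; [exact: exprn_ge0|exact: sqr_ge0].
    by rewrite lerXn2r ?nnegrE ?mulr_ge0 ?normc_ge0 ?invr_ge0.
  rewrite -mulr_sumr.
  have h2 : 0 <= 2^-1 :> R by rewrite invr_ge0.
  have := @geometric_sum_le2 R (size P) 2^-1 h2 (lexx _).
  have X0 : 0 <= M ^+ 3 * h ^+ 2 by rewrite mulr_ge0 ?sqr_ge0 ?exprn_ge0.
  by move=> /(ler_wpM2l X0); lra.
have -> : f (x + h) - f x - h * complex.Re P`_1 =
  complex.Re (((f (x + h))%:C)%C - ((f x)%:C)%C - P`_1 * (h%:C)%C).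
  by case: (P`_1) => a b /=; ring.
apply: le_trans (normRe_le _) _.
have -> : ((f (x + h))%:C)%C - ((f x)%:C)%C - P`_1 * (h%:C)%C =
  (g ((x%:C)%C + (h%:C)%C) - P.[(h%:C)%C]) + (P.[(h%:C)%C] - P`_0 - P`_1 * (h%:C)%C).
  by rewrite -rmorphD gf P0; ring.
apply: le_trans (le_normcD _ _) _.
rewrite normc_real real_normK ?num_real// in e1.
have : 0 <= M ^+ 3 * h ^+ 2 by rewrite mulr_ge0 ?sqr_ge0 ?exprn_ge0.
by lra.
Qed.

End DerivableQuadratic.

(** * Oscillating means of periodic functions *)

Section FourierInversion.
Variable R : realType.
Variable mu : (R -> R) -> R.
Hypothesis muP : mean_spec mu.
Implicit Types (x y : R) (phi f : R -> R).

Lemma bounded_byD f g A B : bounded_by f A -> bounded_by g B ->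
  bounded_by (fun x => f x + g x) (A + B).
Proof.
by move=> fA gB x; rewrite (le_trans (ler_normD _ _))// lerD.
Qed.

Lemma bounded_byM f g A B : bounded_by f A -> bounded_by g B ->
  bounded_by (fun x => f x * g x) (A * B).
Proof. by move=> fA gB x; rewrite normrM ler_pM. Qed.

Lemma bounded_by_cst (c : R) : bounded_by (fun=> c) `|c|.
Proof. by []. Qed.

Lemma bounded_by_sin a c : bounded_by (fun x => sin (a * (x - c))) 1.
Proof. by move=> x; rewrite ler_norml sin_geN1 sin_le1. Qed.

Lemma bounded_by_cos a c : bounded_by (fun x => cos (a * (x - c))) 1.
Proof. by move=> x; rewrite ler_norml cos_geN1 cos_le1. Qed.

Lemma periodic_cont_bounded phi : continuous phi ->
  (forall x, phi (x + 2 * pi) = phi x) -> exists B, bounded_by phi B.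
Proof.
move=> cphi pphi.
have cnorm : {within `[0, 2 * pi], continuous (fun x => `|phi x|)}.
  apply: continuous_subspaceT => x.
  by apply: (continuous_comp (cphi x)); exact: norm_continuous.
have [c _ cmax] := EVT_max (ltW (pi2_gt0 R)) cnorm.
exists `|phi c| => x; have [m /andP[m1 m2]] := mod_period 0 x.
have <- : phi (x - m%:~R * (2 * pi)) = phi x.
  by have := periodic_int pphi (- m) x; rewrite mulrNz mulNr.
by apply: cmax; rewrite in_itv /= m1 ltW//; lra.
Qed.

Lemma periodic_unif_cont phi e : continuous phi ->
  (forall x, phi (x + 2 * pi) = phi x) -> 0 < e ->
  \forall n \near \oo, forall x, `|phi (x + pi / n%:R) - phi x| <= e.
Proof.
move=> cphi pphi e0.
have /compact_near_coveringP cov : compact `[0 : R, 2 * pi] by exact: segment_compact.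
have := cov nat \oo (fun n x => `|phi (x + pi / n%:R) - phi x| <= e) _.
case.
  move=> x _.
  have e2 : 0 < e / 2 by rewrite divr_gt0.
  have /cvgrPdist_lt/(_ _ e2)/nbhs_ballP[r /= r0 rP] := cphi x.
  near=> y n => /=.
  have xy : `|x - y| < r / 2.
    by near: y; apply: (@nbhsx_ballx _ _ x (r / 2)); rewrite divr_gt0.
  have nr : pi / n%:R < r / 2.
    have pi0 := pi_gt0 R; have n0 : (0 < n)%N by near: n; exists 1%N.
    rewrite ltr_pdivrMr ?ltr0n//.
    have : pi / (r / 2) < n%:R.
      near: n; exists (Num.bound (pi / (r / 2))) => // k /= bk.
      apply: lt_le_trans (archi_boundP _) _; first by apply: divr_ge0; [exact: ltW (pi_gt0 R)|lra].
      by rewrite ler_nat.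
    by rewrite ltr_pdivrMr; [rewrite mulrC|lra].
  have pn : 0 <= pi / n%:R :> R by rewrite divr_ge0// ltW// pi_gt0.
  have b1 : ball x r y by rewrite /ball /=; lra.
  have b2 : ball x r (y + pi / n%:R).
    rewrite /ball /= opprD addrA; apply: le_lt_trans (ler_normB _ _) _.
    by rewrite (ger0_norm pn); lra.
  have := rP _ b1; have := rP _ b2 => /= h1 h2.
  rewrite distrC in h1.
  have := ler_distD (phi x) (phi (y + pi / n%:R)) (phi y); lra.
move=> n0 _ nP; exists n0 => // n nn x.
have [m /andP[m1 m2]] := mod_period 0 x.
have H y : phi (y - m%:~R * (2 * pi)) = phi y.
  by have := periodic_int pphi (- m) y; rewrite mulrNz mulNr.
rewrite -(H x) -(H (x + _)) addrAC; apply: nP => //=.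
by rewrite in_itv /= m1 ltW//; lra.
Unshelve. all: by end_near. Qed.

Lemma sin_int2pi (m : int) : sin (m%:~R * (2 * pi)) = 0 :> R.
Proof.
have h x : sin (x + 2 * pi) = sin x :> R.
  by rewrite sinD mulr_natl sin2pi cos2pi mulr0 addr0 mulr1.
by have := periodic_int h m 0; rewrite add0r sin0.
Qed.

Lemma sinD2pi_mul (n : nat) (x c : R) :
  sin (n%:R * (x + 2 * pi - c)) = sin (n%:R * (x - c)).
Proof.
have h y : sin (y + 2 * pi) = sin y :> R.
  by rewrite sinD mulr_natl sin2pi cos2pi mulr0 addr0 mulr1.
have := periodic_int h n (n%:R * (x - c)) => <-; congr sin.
by rewrite -pmulrn; ring.
Qed.

Lemma cosD2pi_mul (n : nat) (x c : R) :
  cos (n%:R * (x + 2 * pi - c)) = cos (n%:R * (x - c)).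
Proof.
have h y : cos (y + 2 * pi) = cos y :> R.
  by rewrite cosD mulr_natl sin2pi cos2pi mulr0 subr0 mulr1.
have := periodic_int h n (n%:R * (x - c)) => <-; congr cos.
by rewrite -pmulrn; ring.
Qed.

Lemma cosDpi' (x : R) : cos (x + pi) = - cos x.
Proof. by rewrite cosD cospi sinpi mulr0 subr0 mulrN1. Qed.

Lemma sinDpi' (x : R) : sin (x + pi) = - sin x.
Proof. by rewrite sinD cospi sinpi mulr0 addr0 mulrN1. Qed.

(* A translation by pi/n changes the sign of the oscillating factor, so that its
   mean against phi is half the mean against phi - phi(. + pi/n). *)
Lemma riemann_lebesgue phi (w : R -> R) (n : nat) (e : R) :
  continuous phi -> (forall x, phi (x + 2 * pi) = phi x) -> (0 < n)%N ->
  bounded_by w 1 -> (forall x, w (x + 2 * pi) = w x) ->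
  (forall x, w (x + pi / n%:R) = - w x) ->
  (forall x, `|phi (x + pi / n%:R) - phi x| <= e) ->
  `|mu (fun x => phi x * w x)| <= e.
Proof.
move=> cphi pphi n0 w1 pw aw pe.
have [B phiB] := periodic_cont_bounded cphi pphi.
have [muD muZ mule mu_1 mush] := muP.
have fB := bounded_byM phiB w1.
have n2 : (0 < 2 * n)%N by rewrite muln_gt0.
have nR : n%:R != 0 :> R by rewrite pnatr_eq0 -lt0n.
have pf x : phi (x + 2 * pi) * w (x + 2 * pi) = phi x * w x by rewrite pphi pw.
have := mush _ _ _ fB n2 pf; set I := mu (fun x => phi x * w x).
have -> : (fun x : R => phi (x + 2 * pi / (2 * n)%:R) * w (x + 2 * pi / (2 * n)%:R)) =
  (fun x => ((phi (x + pi / n%:R) - phi x) * (- w x)) + (-1) * (phi x * w x)).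
  apply/funext => x; have -> : 2 * pi / (2 * n)%:R = pi / n%:R :> R.
    by rewrite natrM; field.
  by rewrite aw; ring.
have g1 : bounded_by (fun x => (phi (x + pi / n%:R) - phi x) * (- w x)) (e * 1).
  by apply: bounded_byM => // x; rewrite normrN.
have g2 : bounded_by (fun x => (-1) * (phi x * w x)) (B * 1).
  by move=> x; rewrite mulN1r normrN.
rewrite (muD _ _ _ _ g1 g2) (muZ _ _ _ fB) -/I mulN1r => h.
have : `|mu (fun x => (phi (x + pi / n%:R) - phi x) * (- w x))| <= e.
  by rewrite -[leRHS]mulr1; exact: mule g1.
have -> : mu (fun x => (phi (x + pi / n%:R) - phi x) * (- w x)) = I + I by lra.
have := ler_norm I; have := ler_norm (- I); rewrite normrN.
by rewrite -mulr2n normrMn -mulr_natl; have := normr_ge0 I; lra.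
Qed.

End FourierInversion.

Section ComegaFacts.
Variables (R : realType) (delta : {posnum R}).
Local Notation C := (R[i]).
Local Notation N := (@Normc.normc R).
Implicit Types (f : Comega delta) (z : C).

Lemma Comega_periodic f x : f (x + 2 * pi) = f x.
Proof. by case: f => f /= /asboolP[]. Qed.

Lemma Comega_continuation f :
  is_continuation delta%:num f (continuation delta%:num f).
Proof.
case: f => f /= /asboolP[_ [g fg _]].
exact: (xgetPex _ (ex_intro _ g fg)).
Qed.

Lemma Comega_norm_ub f z : strip delta%:num z ->
  N (continuation delta%:num f z) <= `|f|.
Proof.
move=> zd; have [g fg [M gM]] : exists2 g, is_continuation delta%:num f g &
    bounded_on_strip delta%:num g by case: f => f /= /asboolP[].
apply: ub_le_sup; last by exists z.
by exists M => _ [w wd <-]; rewrite (continuationE fg)// gM.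
Qed.

Lemma Comega_le_norm f x : `|f x| <= `|f|.
Proof.
have := @Comega_norm_ub f (x%:C)%C.
rewrite (Comega_continuation f).2 normc_real; apply.
by rewrite /strip /= normr0.
Qed.

Lemma Comega_derivable f (x : R) : exists D, is_derive x 1 (f : R -> R) D.
Proof.
have [fa fe] := Comega_continuation f.
by apply: analytic_derivable (fa _ _) fe; rewrite /strip /= normr0.
Qed.

Lemma Comega_continuous f : continuous (f : R -> R).
Proof. by move=> x; have [D /is_derive_continuous] := Comega_derivable f x. Qed.

(** The translate of the continuation by 2 pi is another continuation of [f], so both agree on the
    strip. *)
Lemma continuation_periodic f z : strip delta%:num z ->
  continuation delta%:num f (z + ((2 * pi)%:C)%C) = continuation delta%:num f z.
Proof.
have [fa fe] := Comega_continuation f.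
apply: (@is_continuation_unique R delta%:num f
  (fun z => continuation delta%:num f (z + ((2 * pi)%:C)%C))); last by split.
split=> [w wd|x]; last by rewrite -rmorphD fe Comega_periodic.
by apply: analytic_at_shift; apply: fa; move: wd; rewrite /strip /= raddfD /= addr0.
Qed.

End ComegaFacts.

(** * The Dirichlet kernel and Fourier inversion *)

Section FourierSeries.
Variable R : realType.
Implicit Types (f al be : nat -> R) (x : R).

Definition trig_term al be x n : R :=
  al n * cos (n%:R * x) + be n * sin (n%:R * x).

Definition trig_series (g : R -> R) al be := forall x,
  series (trig_term al be x) @ \oo --> g x.

Lemma sin_half_eq0 (u : R) : sin (u / 2) = 0 ->
  exists m : int, u = m%:~R * (2 * pi).
Proof.
move=> su; have [m /andP[m1 m2]] := mod_period 0 u; exists m.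
have h x : sin ((x + 2 * pi) / 2) ^+ 2 = sin (x / 2) ^+ 2 :> R.
  have -> : (x + 2 * pi) / 2 = x / 2 + pi :> R by field.
  by rewrite sinDpi' sqrrN.
have := periodic_int h (- m) u; rewrite /= su expr0n mulrNz mulNr => /eqP.
rewrite sqrf_eq0 => /eqP s0; apply/eqP; rewrite -subr_eq0 eq_le m1 andbT.
rewrite leNgt; apply/negP => um.
have : 0 < (u - m%:~R * (2 * pi)) / 2 < pi by apply/andP; split; lra.
by move=> /sin_gt0_pi; rewrite s0 ltxx.
Qed.

Definition dirichlet (n : nat) (u : R) : R :=
  1 + \sum_(k < n) 2 * cos (k.+1%:R * u).

(** The right side is sin((n + 1/2) u), expanded so that the oscillating factors have the integer
    frequency n and are 2 pi-periodic. *)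
Lemma sin_dirichlet n (u : R) : sin (u / 2) * dirichlet n u =
  sin (n%:R * u) * cos (u / 2) + cos (n%:R * u) * sin (u / 2).
Proof.
elim: n => [|n IH].
  by rewrite /dirichlet big_ord0 mul0r sin0 cos0 mul0r add0r addr0 mulr1 mul1r.
have -> : dirichlet n.+1 u = dirichlet n u + 2 * cos (n.+1%:R * u).
  by rewrite /dirichlet big_ord_recr addrA.
rewrite mulrDr IH.
have -> : n.+1%:R * u = n%:R * u + (u / 2 + u / 2) by rewrite -natr1; field.
rewrite !(cosD, sinD).
have := cos2Dsin2 (u / 2); set c := cos (u / 2); set s := sin (u / 2) => cs.
set S := sin _; set T := cos _.
have cE : c * (c ^+ 2 + s ^+ 2) = c by rewrite cs mulr1.
have sE : s * (c ^+ 2 + s ^+ 2) = s by rewrite cs mulr1.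
have -> : S * c + T * s = S * (c * (c ^+ 2 + s ^+ 2)) + T * (s * (c ^+ 2 + s ^+ 2)).
  by rewrite cE sE.
ring.
Qed.

Variables (f : R -> R) (mu : (R -> R) -> R).
Hypothesis muP : mean_spec mu.
Hypothesis cf : continuous f.
Hypothesis pf : forall x, f (x + 2 * pi) = f x.

Definition fourier_cos (n : nat) : R :=
  (if n == 0%N then 1 else 2) * mu (fun x => f x * cos (n%:R * x)).
Definition fourier_sin (n : nat) : R :=
  2 * mu (fun x => f x * sin (n%:R * x)).

Let fB : exists B, bounded_by f B := periodic_cont_bounded cf pf.

Lemma fourier_partial_sum n x0 :
  series (trig_term fourier_cos fourier_sin x0) n.+1 =
  mu (fun t => f t * dirichlet n (t - x0)).
Proof.
have [muD muZ mule mu_1 mush] := muP.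
have [B bB] := fB.
have bc k : bounded_by (fun x => cos (k * x)) 1.
  by move=> x; rewrite ler_norml cos_geN1 cos_le1.
have bs k : bounded_by (fun x => sin (k * x)) 1.
  by move=> x; rewrite ler_norml sin_geN1 sin_le1.
have bD k : exists A, bounded_by (fun t => f t * dirichlet k (t - x0)) A.
  elim: k => [|k [A HA]].
    by exists B => t; rewrite /dirichlet big_ord0 addr0 mulr1.
  exists (A + B * (2 * 1)) => t.
  have -> : dirichlet k.+1 (t - x0) = dirichlet k (t - x0) + 2 * cos (k.+1%:R * (t - x0)).
    by rewrite /dirichlet big_ord_recr addrA.
  rewrite mulrDr (le_trans (ler_normD _ _))// lerD// normrM ler_pM//.
  by rewrite normrM ler_pM// ?bounded_by_cos// ger0_norm.
elim: n => [|n IH].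
  rewrite /series /= big_nat1 /trig_term /fourier_cos mul0r cos0 sin0 mulr0 addr0 mulr1 mul1r.
  congr mu; apply/funext => t; rewrite mul0r cos0 mulr1.
  by rewrite /dirichlet big_ord0 addr0 mulr1.
rewrite seriesSr IH.
have -> : (fun t => f t * dirichlet n.+1 (t - x0)) = (fun t =>
    f t * dirichlet n (t - x0) +
    ((2 * cos (n.+1%:R * x0)) * (f t * cos (n.+1%:R * t)) +
     (2 * sin (n.+1%:R * x0)) * (f t * sin (n.+1%:R * t)))).
  apply/funext => t.
  have -> : dirichlet n.+1 (t - x0) = dirichlet n (t - x0) + 2 * cos (n.+1%:R * (t - x0)).
    by rewrite /dirichlet big_ord_recr addrA.
  by rewrite mulrBr cosB; ring.
have [A HA] := bD n.
have b1 := bounded_byM bB (bc n.+1%:R).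
have b2 := bounded_byM bB (bs n.+1%:R).
have b3 := bounded_byM (bounded_by_cst (2 * cos (n.+1%:R * x0))) b1.
have b4 := bounded_byM (bounded_by_cst (2 * sin (n.+1%:R * x0))) b2.
rewrite (muD _ _ _ _ HA (bounded_byD b3 b4)) (muD _ _ _ _ b3 b4).
rewrite (muZ _ _ _ b1) (muZ _ _ _ b2) /trig_term /fourier_cos /fourier_sin /=.
by congr (_ + _); ring.
Qed.

Lemma mean_cos n x0 : (0 < n)%N -> mu (fun t => cos (n%:R * (t - x0))) = 0.
Proof.
move=> n0; have [muD muZ mule mu_1 mush] := muP.
have nR : n%:R != 0 :> R by rewrite pnatr_eq0 -lt0n.
have n2 : (0 < 2 * n)%N by rewrite muln_gt0.
have := mush _ _ _ (@bounded_by_cos R n%:R x0) n2 (fun x => cosD2pi_mul n x x0).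
have -> : (fun x => cos (n%:R * (x + 2 * pi / (2 * n)%:R - x0))) =
    (fun x => (-1) * cos (n%:R * (x - x0))).
  apply/funext => x; rewrite mulN1r -cosDpi'; congr cos.
  by rewrite natrM; field.
rewrite (muZ _ _ _ (@bounded_by_cos R n%:R x0)); lra.
Qed.

Lemma mean_dirichlet n x0 : mu (fun t => dirichlet n (t - x0)) = 1.
Proof.
have [muD muZ mule mu_1 mush] := muP.
have bD k : exists A, bounded_by (fun t => dirichlet k (t - x0)) A.
  exists (1 + \sum_(i < k) 2) => t; rewrite (le_trans (ler_normD _ _))//.
  rewrite normr1 lerD// (le_trans (ler_norm_sum _ _ _))//.
  apply: ler_sum => i _; rewrite normrM ger0_norm// ler_piMr//.
  exact: bounded_by_cos.
elim: n => [|n IH].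
  by rewrite -[RHS]mu_1; congr mu; apply/funext => t; rewrite /dirichlet big_ord0 addr0.
have -> : (fun t => dirichlet n.+1 (t - x0)) =
    (fun t => dirichlet n (t - x0) + 2 * cos (n.+1%:R * (t - x0))).
  by apply/funext => t; rewrite /dirichlet big_ord_recr addrA.
have [A HA] := bD n.
have b1 := bounded_byM (bounded_by_cst 2) (@bounded_by_cos R n.+1%:R x0).
rewrite (muD _ _ _ _ HA b1) (muZ _ _ _ (@bounded_by_cos R n.+1%:R x0)).
by rewrite mean_cos// mulr0 addr0.
Qed.

Section Quotient.
Variables (x0 D : R).

(* The factor of sin (n (t - x0)) in (f t - f x0) times the Dirichlet kernel; it is
   continuous, with value 2 f'(x0) at the removable singularities, so that the
   Riemann-Lebesgue lemma gives Fourier inversion at x0. *)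
Definition cot_quotient (t : R) : R :=
  if sin ((t - x0) / 2) == 0 then 2 * D
  else (f t - f x0) * cos ((t - x0) / 2) / sin ((t - x0) / 2).

Lemma cot_quotient_periodic t : cot_quotient (t + 2 * pi) = cot_quotient t.
Proof.
rewrite /cot_quotient pf.
have -> : (t + 2 * pi - x0) / 2 = (t - x0) / 2 + pi by field.
by rewrite sinDpi' cosDpi' oppr_eq0 invrN mulrN [_ * - cos _]mulrN mulNr opprK.
Qed.

Lemma cot_quotientE n t : (f t - f x0) * dirichlet n (t - x0) =
  cot_quotient t * sin (n%:R * (t - x0)) + (f t - f x0) * cos (n%:R * (t - x0)).
Proof.
rewrite /cot_quotient; case: eqP => [/sin_half_eq0[m tm]|/eqP s0].
  have -> : f t = f x0.
    by have := periodic_int pf m x0; rewrite -tm addrC subrK.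
  have -> : n%:R * (t - x0) = (n%:Z * m)%:~R * (2 * pi).
    by rewrite tm intrM -pmulrn mulrA.
  by rewrite subrr !mul0r sin_int2pi mulr0 addr0.
have := sin_dirichlet n (t - x0).
move=> /(congr1 (fun y => (f t - f x0) * (y / sin ((t - x0) / 2)))).
rewrite [_ * dirichlet _ _]mulrC mulfK// => ->.
by field.
Qed.

(** At [x0] it is the ratio of the difference quotients of [f] and of sin((t - x0) / 2), whose
    limits are [D] and 1/2. The other zeros of the sine are translates of [x0] by periods. *)
Lemma cot_quotient_continuous : is_derive x0 1 f D -> continuous cot_quotient.
Proof.
move=> fD.
have cs : continuous (fun t : R => sin ((t - x0) / 2)).
  move=> t; apply: (@continuous_comp _ _ _ (fun t => (t - x0) / 2) sin); last exact: continuous_sin.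
  apply: cvgMl; apply: cvgB; [exact: cvg_id|exact: cvg_cst].
have cc : continuous (fun t : R => cos ((t - x0) / 2)).
  move=> t; apply: (@continuous_comp _ _ _ (fun t => (t - x0) / 2) cos); last exact: continuous_cos.
  apply: cvgMl; apply: cvgB; [exact: cvg_id|exact: cvg_cst].
have at0 : {for x0, continuous cot_quotient}.
  have Q0 : cot_quotient x0 = 2 * D by rewrite /cot_quotient subrr mul0r sin0 eqxx.
  have sd : is_derive x0 1 (fun t : R => sin ((t - x0) / 2)) (1 / 2).
    have ld : is_derive x0 1 (fun t : R => (t - x0) / 2) (1 / 2).
      apply: (@is_derive_quadratic _ _ _ _ 0 1) => // h _.
      by rewrite (_ : _ - _ = 0) ?normr0 ?mul0r//; field.
    have := @is_derive1_comp R sin (fun t => (t - x0) / 2) x0 _ _ (is_derive_sin _) ld.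
    by rewrite subrr mul0r cos0 mul1r.
  have l1 : h^-1 *: ((f \o shift x0) (h *: (1 : R)) - f x0) @[h --> 0^'] --> D.
    by rewrite -(derive_val (is_derive := fD)); exact: (ex_derive (is_derive := fD)).
  have l2 : h^-1 *: (((fun t : R => sin ((t - x0) / 2)) \o shift x0) (h *: (1 : R)) - sin ((x0 - x0) / 2)) @[h --> 0^'] --> (1 / 2 : R).
    by rewrite -(derive_val (is_derive := sd)); exact: (ex_derive (is_derive := sd)).
  have nz : (1 / 2 : R) != 0 by rewrite gt_eqF//; lra.
  have l3 : cos ((h + x0 - x0) / 2) @[h --> (0 : R)^'] --> (1 : R).
    have := cc x0; rewrite /continuous_at subrr mul0r cos0 => cx.
    have cx' : cos ((h + x0 - x0) / 2) @[h --> (0 : R)] --> (1 : R).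
      apply: (cvg_comp (fun h : R => h + x0) (fun t => cos ((t - x0) / 2)) _ cx).
      by rewrite -{2}(add0r x0); apply: cvgD; [exact: cvg_id|exact: cvg_cst].
    by apply: cvg_trans cx'; apply: cvg_app; exact: nbhs_dnbhs.
  have := cvgM (cvgM l1 (cvgV nz l2)) l3.
  have -> : D * (1 / 2)^-1 * 1 = cot_quotient x0 by rewrite Q0; field.
  move=> lim; apply/cvgrPdist_lt => e e0.
  have nz2 := cvgr_neq0 _ l2 nz.
  have FF : Filter ((0 : R)^') by exact: dnbhs_filter.
  have lim2 := cvgr_dist_lt _ _ (lim FF FF FF) e e0.
  have [r /= r0 rP] := filterI (nz2 FF) (lim2 FF).
  apply/nbhs_ballP; exists r => // t xt.
  have [->|tx] := eqVneq t x0; first by rewrite subrr normr0.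
  have h0 : t - x0 != 0 by rewrite subr_eq0.
  have b0 : ball (0 : R) r (t - x0) by move: xt; rewrite /ball /= sub0r opprB.
  have [] := rP _ b0 h0.
  rewrite /= /GRing.scale /= !mulr1 !subrK subrr mul0r sin0 subr0 => n1.
  have ns : sin ((t - x0) / 2) != 0.
    by apply: contra_neq n1 => ->; rewrite mulr0.
  have -> : cot_quotient t = (t - x0)^-1 * (f t - f x0) /
     ((t - x0)^-1 * sin ((t - x0) / 2)) * cos ((t - x0) / 2).
    rewrite /cot_quotient (negbTE ns); field.
    by rewrite ns h0.
  by [].
move=> t; have [/eqP/sin_half_eq0[m tm]|s0] := boolP (sin ((t - x0) / 2) == 0).
  have -> : cot_quotient = cot_quotient \o (fun s => s - m%:~R * (2 * pi)).
    apply/funext => s /=; have := periodic_int cot_quotient_periodic (- m) s.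
    by rewrite mulrNz mulNr.
  apply: continuous_comp.
    by apply: cvgB; [exact: cvg_id|exact: cvg_cst].
  by rewrite -tm subKr.
pose F (s : R) := (f s - f x0) * cos ((s - x0) / 2) / sin ((s - x0) / 2).
rewrite /continuous_at (_ : cot_quotient t = F t); last first.
  by rewrite /cot_quotient (negbTE s0).
have FE : \forall s \near t, F s = cot_quotient s.
  have FF : Filter (nbhs t) by exact: nbhs_filter.
  have nn := cvgr_neq0 _ (cs t) s0; apply: filterS (nn FF) => s ns.
  by rewrite /cot_quotient (negbTE ns).
apply: cvg_trans (near_eq_cvg FE) _.
apply: cvgM; last exact: (cvgV s0 (cs t)).
apply: cvgM; last exact: cc.
by apply: cvgB; [exact: cf|exact: cvg_cst].
Qed.

End Quotient.

(** The Dirichlet kernel has mean 1, so the error at [x0] is the mean of (f t - f x0) times the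
    kernel. [cot_quotientE] splits it into a sine and a cosine part with continuous periodic
    amplitudes, and [riemann_lebesgue] makes each small. *)
Lemma fourier_inversion : (forall x, exists D, is_derive x 1 f D) ->
  trig_series f fourier_cos fourier_sin.
Proof.
move=> df x0; have [D fD] := df x0.
have [muD muZ mule mu_1 mush] := muP.
have [B bB] := fB.
apply/cvgrPdist_lt => e e0.
have e4 : 0 < e / 4 by lra.
have cQ := cot_quotient_continuous fD.
have pQ := @cot_quotient_periodic x0 D.
have c2 : continuous (fun t => f t - f x0).
  by move=> t; apply: cvgB; [exact: cf|exact: cvg_cst].
have p2 t : f (t + 2 * pi) - f x0 = f t - f x0 by rewrite pf.
have [n1 _ N1] := periodic_unif_cont cQ pQ e4.
have [n2 _ N2] := periodic_unif_cont c2 p2 e4.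
exists (maxn 1 (maxn n1 n2)).+1 => // -[//|n].
rewrite /= ltnS !geq_max => /and3P[n0 n1n n2n].
rewrite fourier_partial_sum.
have bc := @bounded_by_cos R n%:R x0; have bs := @bounded_by_sin R n%:R x0.
have [A bQ] := periodic_cont_bounded cQ pQ.
have [A2 bf2] := periodic_cont_bounded c2 p2.
have nR : n%:R != 0 :> R by rewrite pnatr_eq0 -lt0n.
have as_ x : sin (n%:R * (x + pi / n%:R - x0)) = - sin (n%:R * (x - x0)).
  by rewrite -sinDpi'; congr sin; field.
have ac x : cos (n%:R * (x + pi / n%:R - x0)) = - cos (n%:R * (x - x0)).
  by rewrite -cosDpi'; congr cos; field.
have h1 := riemann_lebesgue muP cQ pQ n0 bs (fun x => sinD2pi_mul n x x0) as_ (N1 n n1n).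
have h2 := riemann_lebesgue muP c2 p2 n0 bc (fun x => cosD2pi_mul n x x0) ac (N2 n n2n).
have b1 := bounded_byM bQ bs; have b2 := bounded_byM bf2 bc.
have [A3 bD] : exists A, bounded_by (fun t => dirichlet n (t - x0)) A.
  exists (1 + \sum_(i < n) 2) => t; rewrite (le_trans (ler_normD _ _))//.
  rewrite normr1 lerD// (le_trans (ler_norm_sum _ _ _))//.
  apply: ler_sum => i _; rewrite normrM ger0_norm// ler_piMr//.
  exact: bounded_by_cos.
have -> : (fun t => f t * dirichlet n (t - x0)) = (fun t =>
   (cot_quotient x0 D t * sin (n%:R * (t - x0)) + (f t - f x0) * cos (n%:R * (t - x0)))
   + f x0 * dirichlet n (t - x0)).
  by apply/funext => t; rewrite -cot_quotientE; ring.
have b3 := bounded_byM (bounded_by_cst (f x0)) bD.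
rewrite (muD _ _ _ _ (bounded_byD b1 b2) b3) (muD _ _ _ _ b1 b2) (muZ _ _ _ bD).
rewrite mean_dirichlet mulr1 distrC addrK.
by rewrite (le_lt_trans (ler_normD _ _))//; lra.
Qed.

End FourierSeries.

(** * Decay of Fourier coefficients *)

Section FourierDecay.
Variables (R : realType) (delta : {posnum R}).
Local Notation C := (R[i]).
Local Notation N := (@Normc.normc R).

Definition geom_bounded (al : nat -> R) (B rho : R) :=
  forall n, `|al n| <= B * rho ^+ n.

(** The function g(z) exp(i k z), with g the continuation of [f], has real and imaginary parts f
    cos(kx) and f sin(kx) on the real axis. Moving the line of averaging up to height [Y] does not
    change the means and brings in the factor exp(-kY). *)
Lemma fourier_decay (f : Comega delta) mu (Y : R) (j n : nat) (k : nat) :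
  mean_spec mu -> (0 < n)%N -> Y = 2 * pi * j%:R / n%:R -> Y < delta%:num ->
  `|mu (fun x => f x * cos (k%:R * x))| <= `|f| * expR (- Y) ^+ k /\
  `|mu (fun x => f x * sin (k%:R * x))| <= `|f| * expR (- Y) ^+ k.
Proof.
move=> muP n0 YE Yd.
have Y0 : 0 <= Y by rewrite YE divr_ge0// mulr_ge0// ltW// pi2_gt0.
pose g := continuation delta%:num f.
have [fa fe] := Comega_continuation f.
pose G (z : C) := g z * cexp (Complex 0 k%:R * z).
have in_strip x y : 0 <= y <= Y -> strip delta%:num (Complex x y).
  move=> /andP[y0 yY]; rewrite /strip /= ger0_norm//; exact: le_lt_trans yY Yd.
have aG x y : 0 <= y <= Y -> analytic_at (G : (C : numFieldType) -> C) (Complex x y).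
  move=> yY; apply: analytic_atM; first by apply: fa; exact: in_strip.
  apply: (@analytic_at_comp R (fun z => Complex 0 k%:R * z) (@cexp R)); last exact: analytic_at_cexp.
  exact: (analytic_atM (analytic_at_cst _ _) (analytic_at_id _)).
have kz x y : Complex 0 k%:R * Complex x y = Complex (- (k%:R * y)) (k%:R * x) :> C.
  by apply/eqP; rewrite eq_complex /=; apply/andP; split; apply/eqP; ring.
have eE (x y : R) : cexp (Complex 0 k%:R * Complex x y) =
   Complex (expR (- (k%:R * y)) * cos (k%:R * x)) (expR (- (k%:R * y)) * sin (k%:R * x)).
  by rewrite kz.
have pG x y : 0 <= y <= Y -> G (Complex (x + 2 * pi) y) = G (Complex x y).
  move=> yY; rewrite /G !eE; congr (_ * _).
    rewrite /g -(continuation_periodic f (in_strip x y yY)); congr (continuation _ _ _).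
    by apply/eqP; rewrite eq_complex /= addr0 !eqxx.
  have := cosD2pi_mul k x 0; have := sinD2pi_mul k x 0.
  by rewrite !subr0 => -> ->.
have bG x y : 0 <= y <= Y -> N (G (Complex x y)) <= `|f| * expR (- (k%:R * y)).
  move=> yY; rewrite /G Normc.normcM normc_cexp kz /=.
  by rewrite ler_wpM2r ?expR_ge0// Comega_norm_ub//; exact: in_strip.
have bG1 x y : 0 <= y <= Y -> N (G (Complex x y)) <= `|f|.
  move=> yY; apply: le_trans (bG _ _ yY) _.
  rewrite ler_piMr// -[leRHS]expR0 ler_expR oppr_le0 mulr_ge0//.
  by case/andP: yY.
have [h1 h2] := contour_shift muP aG pG bG1 n0 YE.
have gx x : g (Complex x 0) = ((f x)%:C)%C by rewrite -fe.
have G0 x : G (Complex x 0) = Complex (f x * cos (k%:R * x)) (f x * sin (k%:R * x)).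
  by rewrite /G eE gx mulr0 oppr0 expR0 !mul1r realM_complex.
have [muD muZ mule mu_1 mush] := muP.
have eY : expR (- Y) ^+ k = expR (- (k%:R * Y)) by rewrite -expRM_natl mulrN.
have YY : 0 <= Y <= Y by rewrite Y0 lexx.
rewrite eY; split.
  rewrite (_ : (fun x => f x * cos (k%:R * x)) = (fun x => complex.Re (G (Complex x 0)))).
    rewrite -h1; apply: mule => x; apply: le_trans (normRe_le _) (bG _ _ YY).
  by apply/funext => x; rewrite G0.
rewrite (_ : (fun x => f x * sin (k%:R * x)) = (fun x => complex.Im (G (Complex x 0)))).
  rewrite -h2; apply: mule => x; apply: le_trans (normIm_le _) (bG _ _ YY).
by apply/funext => x; rewrite G0.
Qed.

Lemma Comega_trig_series (f : Comega delta) (eta : R) :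
  0 < eta < delta%:num -> exists al be, exists2 B, 0 <= B &
  [/\ geom_bounded al B (expR (- eta)), geom_bounded be B (expR (- eta)) &
      trig_series f al be].
Proof.
move=> /andP[eta0 etad].
have [mu muP] := mean_exists R.
have cf := @Comega_continuous R delta f.
have pf := @Comega_periodic R delta f.
exists (fourier_cos f mu), (fourier_sin f mu), (2 * `|f|); first by rewrite mulr_ge0.
have pi0 := pi2_gt0 R.
(* [contour_shift] needs a height that is a rational multiple of 2 pi, hence the strict gap between
   [eta] and [delta]. *)
have [q] : exists q : rat, ratr q \in `](eta / (2 * pi)), (delta%:num / (2 * pi))[.
  by apply: rat_in_itvoo; rewrite ltr_pM2r// invr_gt0.
rewrite in_itv /= => /andP[q1 q2].
have q0 : 0 < q by rewrite -(ltr0q R); apply: lt_trans q1; rewrite divr_gt0.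
have [j [n n0 qE]] : exists j, exists2 n, (0 < n)%N & ratr q = j%:R / n%:R :> R.
  exists `|numq q|%N, `|denq q|%N; first by rewrite absz_gt0 denq_neq0.
  rewrite /ratr; congr (_ / _).
    by rewrite -[in LHS](@gez0_abs (numq q)) ?numq_ge0 ?ltW// pmulrn.
  by rewrite -[in LHS](@gez0_abs (denq q)) ?denq_ge0// pmulrn.
pose Y : R := 2 * pi * j%:R / n%:R.
have YE : Y = 2 * pi * ratr q by rewrite /Y qE mulrA.
have Yeta : eta <= Y by rewrite YE mulrC -ler_pdivrMr// ltW.
have Yd : Y < delta%:num by rewrite YE mulrC -ltr_pdivlMr.
have dec := fun k => @fourier_decay f mu Y j n k muP n0 erefl Yd.
have eY k : `|f| * expR (- Y) ^+ k <= `|f| * expR (- eta) ^+ k.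
  rewrite ler_wpM2l// lerXn2r ?nnegrE ?expR_ge0// ler_expR; lra.
split.
- move=> k; have [h _] := dec k; rewrite /fourier_cos normrM -mulrA.
  apply: ler_pM => //; last exact: le_trans h (eY k).
  by case: eqP => _; rewrite ger0_norm//; lra.
- move=> k; have [_ h] := dec k; rewrite /fourier_sin normrM -mulrA.
  by apply: ler_pM => //; [rewrite ger0_norm|exact: le_trans h (eY k)].
- by apply: (fourier_inversion muP cf pf) => x; exact: Comega_derivable.
Qed.

End FourierDecay.

(** * The Poisson kernel as a probe *)

Section PoissonKernel.
Variable R : realType.
Local Notation C := (R[i]).
Local Notation N := (@Normc.normc R).
Variable rho : R.
Hypothesis rho01 : 0 < rho < 1.

(** This is 2 Re 1 / (1 - rho exp(ix)), that is the classical Poisson kernel plus 1; the added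
    constant gives the coefficients 2 rho^n from n = 0 on. *)
Definition poisson (x : R) : R :=
  2 * (1 - rho * cos x) / (1 - 2 * rho * cos x + rho ^+ 2).

Let den_gt0 (x : R) : 0 < 1 - 2 * rho * cos x + rho ^+ 2.
Proof.
have := cos_le1 x; case/andP: rho01 => r0 r1 c1.
have : 0 < (1 - rho) ^+ 2 by rewrite exprn_gt0//; lra.
by have := ler_wpM2l (ltW r0) c1; rewrite sqrrB expr1n; lra.
Qed.

Lemma poisson_partial_sum n (x : R) :
  (1 - 2 * rho * cos x + rho ^+ 2) * \sum_(0 <= k < n.+1) rho ^+ k * cos (k%:R * x) =
  1 - rho * cos x - rho ^+ n.+1 * (cos (n.+1%:R * x) - rho * cos (n%:R * x)).
Proof.
elim: n => [|n IH].
  by rewrite big_nat1 !mul0r cos0 [1 * x]mul1r; ring.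
rewrite big_nat_recr//= mulrDr IH.
have -> : n.+2%:R * x = n.+1%:R * x + x by rewrite -[n.+2%:R]natr1 mulrDl mul1r.
have -> : n%:R * x = n.+1%:R * x - x by rewrite -natr1 mulrDl mul1r addrK.
rewrite [cos (_ * x + x)]cosD cosB !exprS; ring.
Qed.

Lemma poisson_trig_series :
  trig_series poisson (fun n => 2 * rho ^+ n) (fun=> 0).
Proof.
case/andP: rho01 => r0 r1 x; apply/cvgrPdist_lt => e e0.
have d0 := den_gt0 x; set d := 1 - _ + _ in d0.
have := @near_geom_lt R (4 / d) rho e; rewrite (ltW r0) r1 => /(_ isT e0).
case=> n0 _ n0P; exists n0.+1 => // -[//|n]; rewrite /= ltnS => nn.
have -> : series (trig_term (fun n => 2 * rho ^+ n) (fun=> 0) x) n.+1 =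
   2 * \sum_(0 <= k < n.+1) rho ^+ k * cos (k%:R * x).
  rewrite /series /= mulr_sumr; apply: eq_bigr => k _.
  by rewrite /trig_term mul0r addr0 mulrA.
have := poisson_partial_sum n x; rewrite -/d.
set S := \sum_(0 <= k < _) _ => SE.
have -> : poisson x - 2 * S = 2 * (rho ^+ n.+1 * (cos (n.+1%:R * x) - rho * cos (n%:R * x))) / d.
  rewrite /poisson -/d.
  have -> : S = (1 - rho * cos x - rho ^+ n.+1 * (cos (n.+1%:R * x) - rho * cos (n%:R * x))) / d.
    by rewrite -SE mulrC mulKf// gt_eqF.
  by field; rewrite gt_eqF.
apply: le_lt_trans (n0P n nn).
rewrite normrM [X in _ * X]ger0_norm ?invr_ge0 ?(ltW d0)// mulrAC ler_wpM2r ?invr_ge0 ?(ltW d0)//.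
have rn : 0 <= rho ^+ n by rewrite exprn_ge0// ltW.
rewrite !normrM ger0_norm// [ `|rho ^+ n.+1|]ger0_norm ?exprn_ge0 ?(ltW r0)//.
have c2 : `|cos (n.+1%:R * x) - rho * cos (n%:R * x)| <= 2.
  apply: le_trans (ler_normB _ _) _; rewrite normrM (ger0_norm (ltW r0)).
  have c m : `|cos m| <= 1 :> R by rewrite ler_norml cos_geN1 cos_le1.
  have := c (n.+1%:R * x); have := c (n%:R * x).
  have := normr_ge0 (cos (n%:R * x)); nra.
have rn1 : rho ^+ n.+1 <= rho ^+ n by rewrite exprS ler_piMl// ltW.
have := ler_pM (exprn_ge0 n.+1 (ltW r0)) (normr_ge0 _) rn1 c2; lra.
Qed.

(** On the real axis the second summand is the conjugate of the first; exp(-iz) in place of a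
    conjugation keeps it analytic. For [rho * expR delta%:num < 1] both denominators stay away from
    0 on the strip. *)
Definition poisson_ext (z : C) : C :=
  (1 - (rho%:C)%C * cexp ('i%C * z))^-1 + (1 - (rho%:C)%C * cexp (- 'i%C * z))^-1.

Lemma poisson_ext_real (x : R) : poisson_ext (x%:C)%C = ((poisson x)%:C)%C.
Proof.
case/andP: rho01 => r0 r1.
have e1 : cexp ('i%C * (x%:C)%C) = Complex (cos x) (sin x).
  rewrite -cexp_imag; congr cexp.
  by apply/eqP; rewrite eq_complex /=; apply/andP; split; apply/eqP; ring.
have e2 : cexp (- 'i%C * (x%:C)%C) = Complex (cos x) (- sin x).
  rewrite -[cos x]cosN -sinN -cexp_imag; congr cexp.
  by apply/eqP; rewrite eq_complex /=; apply/andP; split; apply/eqP; ring.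
rewrite /poisson_ext e1 e2 !realM_complex.
set A := 1 - _; set B := 1 - _.
have ABE : A * B = ((1 - 2 * rho * cos x + rho ^+ 2)%:C)%C.
  have := cos2Dsin2 x => cs.
  have -> : rho ^+ 2 = rho ^+ 2 * (cos x ^+ 2 + sin x ^+ 2) by rewrite cs mulr1.
  by apply/eqP; rewrite eq_complex /=; apply/andP; split; apply/eqP; ring.
have ADB : A + B = ((2 * (1 - rho * cos x))%:C)%C.
  by apply/eqP; rewrite eq_complex /=; apply/andP; split; apply/eqP; ring.
have AB0 : A * B != 0.
  rewrite ABE eq_complex /= eqxx andbT gt_eqF//; exact: den_gt0.
have : A != 0 /\ B != 0 by move: AB0; rewrite mulf_eq0 negb_or => /andP[].
case=> A0 B0.
have -> : A^-1 + B^-1 = (A + B) / (A * B) by field; rewrite A0 B0.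
by rewrite ABE ADB -fmorphV -rmorphM.
Qed.

Lemma poisson_in_Comega (delta : {posnum R}) : rho * expR delta%:num < 1 ->
  poisson \in Comega_pred delta%:num.
Proof.
case/andP: rho01 => r0 r1 rd; apply/asboolP; split.
  by move=> x; rewrite /poisson cosD [2 * pi]mulr_natl cos2pi sin2pi mulr0 subr0 mulr1.
have small (z : C) : strip delta%:num z ->
   N ((rho%:C)%C * cexp ('i%C * z)) <= rho * expR delta%:num /\
   N ((rho%:C)%C * cexp (- 'i%C * z)) <= rho * expR delta%:num.
  case: z => x y; rewrite /strip /= => yd.
  rewrite !Normc.normcM !normc_cexp normc_real (gtr0_norm r0) /=.
  by have := ltr_normlP _ _ yd => -[h1 h2]; split; rewrite ler_wpM2l ?(ltW r0)// ler_expR; lra.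
have far (w : C) : N w <= rho * expR delta%:num -> 1 - rho * expR delta%:num <= N (1 - w).
  move=> wr; have := ler_normcB (1 - w) (- w); rewrite opprK subrK Normc.normc1 normcN; lra.
have d0 : 0 < 1 - rho * expR delta%:num by lra.
have nz (w : C) : N w <= rho * expR delta%:num -> 1 - w != 0.
  by move=> /far h; apply: contraTneq h => ->; rewrite Normc.normc0 -ltNge.
exists poisson_ext; last first.
  exists ((1 - rho * expR delta%:num)^-1 + (1 - rho * expR delta%:num)^-1) => z /small[h1 h2].
  rewrite /poisson_ext (le_trans (le_normcD _ _))// !normcV ?nz//.
  by rewrite lerD// lef_pV2 ?posrE ?far//; apply: lt_le_trans d0 (far _ _).
split; last exact: poisson_ext_real.
move=> z /small[h1 h2].
have inner (c : C) : analytic_at ((fun z => 1 - (rho%:C)%C * cexp (c * z)) : (C : numFieldType) -> C) z.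
  have a1 : analytic_at ((fun z => c * z) : (C : numFieldType) -> C) z.
    exact: (analytic_atM (analytic_at_cst _ _) (analytic_at_id _)).
  have a2 := analytic_at_comp a1 (@analytic_at_cexp R (c * z)).
  have a3 := analytic_atM (analytic_at_cst (- (rho%:C)%C) z) a2.
  have a4 := analytic_atD (analytic_at_cst (1 : C) z) a3.
  rewrite (_ : (fun z => _) = ((fun=> 1) \+ (fun x : C => - (rho%:C)%C * cexp (c * x)))) //.
  by apply/funext => w /=; rewrite mulNr.
apply: analytic_atD.
  by apply: (analytic_at_comp (inner 'i%C)); apply: analytic_at_inv; exact: nz.
by apply: (analytic_at_comp (inner (- 'i%C))); apply: analytic_at_inv; exact: nz.
Qed.

End PoissonKernel.

(** * Series with geometrically bounded coefficients *)

Section GeometricCoefficients.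
Variable R : realType.
Implicit Types (al be : nat -> R) (B rho : R).

(** With d = (1 - rho) / 2, Bernoulli's inequality n d <= (1 + d)^n absorbs the factor n, and rho (1
    + d) is still below 1. *)
Lemma geom_bounded_natM al B rho : 0 <= rho < 1 -> geom_bounded al B rho ->
  exists2 B', 0 <= B' & exists2 rho', 0 <= rho' < 1 &
    geom_bounded (fun n => n%:R * al n) B' rho'.
Proof.
move=> /andP[r0 r1] aB; pose d := (1 - rho) / 2.
have d0 : 0 < d by rewrite /d; lra.
have B0 : 0 <= B by have := aB 0; rewrite expr0 mulr1; exact: le_trans (normr_ge0 _).
exists (B / d); first by rewrite divr_ge0// ltW.
exists (rho * (1 + d)); first by rewrite /d; apply/andP; split; nra.
move=> n; rewrite normrM ger0_norm//.
have nd : n%:R * d <= (1 + d) ^+ n.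
  elim: n => [|n IH]; first by rewrite mul0r expr0.
  have : 1 <= (1 + d) ^+ n by rewrite exprn_ege1//; lra.
  by rewrite -natr1 exprS; nra.
rewrite exprMn; have := aB n.
have rn : 0 <= rho ^+ n by rewrite exprn_ge0.
have -> : B / d * (rho ^+ n * (1 + d) ^+ n) = (1 + d) ^+ n / d * (B * rho ^+ n).
  by field; rewrite gt_eqF.
by move=> h; apply: ler_pM => //; rewrite ler_pdivlMr.
Qed.

Lemma geom_sum_le B rho n : 0 <= B -> 0 <= rho < 1 ->
  \sum_(0 <= k < n) B * rho ^+ k <= B / (1 - rho).
Proof.
move=> B0 /andP[r0 r1].
suff -> : \sum_(0 <= k < n) B * rho ^+ k = B / (1 - rho) * (1 - rho ^+ n).
  rewrite ler_piMr ?divr_ge0//; first lra.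
  by rewrite gerBl exprn_ge0.
elim: n => [|n IH]; first by rewrite big_geq// expr0 subrr mulr0.
by rewrite big_nat_recr//= IH exprS; field; lra.
Qed.

Lemma trig_term_le al be x n : `|trig_term al be x n| <= `|al n| + `|be n|.
Proof.
rewrite (le_trans (ler_normD _ _))// !normrM.
by rewrite lerD// ler_piMr// ler_norml ?cos_geN1 ?cos_le1 ?sin_geN1 ?sin_le1.
Qed.

Lemma geom_trig_cvg al be B rho x : 0 <= rho < 1 ->
  geom_bounded al B rho -> geom_bounded be B rho ->
  cvgn (series (trig_term al be x)).
Proof.
move=> /andP[r0 r1] aB bB.
apply: normed_cvg.
apply: (@series_le_cvg _ _ (geometric (B + B) rho)).
- by move=> n; exact: normr_ge0.
- move=> n; rewrite /geometric /= mulr_ge0 ?exprn_ge0// addr_ge0//;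
    by have := aB 0; rewrite expr0 mulr1; exact: le_trans (normr_ge0 _).
- move=> n; apply: le_trans (trig_term_le _ _ _ _) _.
  by rewrite /geometric /= mulrDl lerD.
- by apply: is_cvg_geometric_series; rewrite ger0_norm.
Qed.

Lemma trig_series_bounded (f : R -> R) al be B rho : 0 <= rho < 1 ->
  geom_bounded al B rho -> geom_bounded be B rho -> trig_series f al be ->
  exists2 A : R, 0 <= A & forall x, `|f x| <= A.
Proof.
move=> r01 aB bB fs; case/andP: (r01) => r0 r1.
have B0 : 0 <= B by have := aB 0; rewrite expr0 mulr1; exact: le_trans (normr_ge0 _).
exists ((B + B) / (1 - rho)); first by apply: divr_ge0; [exact: addr_ge0|lra].
move=> x; have /cvg_norm fx := fs x; apply: cvgr_to_le fx _.
apply: nearW => n; apply: le_trans (ler_norm_sum _ _ _) _.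
apply: le_trans (geom_sum_le n (addr_ge0 B0 B0) r01).
apply: ler_sum => k _; apply: le_trans (trig_term_le _ _ _ _) _.
by rewrite mulrDl lerD.
Qed.

End GeometricCoefficients.

Section MeanValue.
Variable R : realType.
Implicit Types (f g : R -> R).

Lemma mean_value f g : (forall x : R, is_derive x 1 f (g x)) ->
  forall x y : R, exists2 c, `|c - x| <= `|y - x| & f y - f x = g c * (y - x).
Proof.
move=> fg.
have cf : continuous f by move=> x; exact: is_derive_continuous (fg x).
have H x y : x < y -> exists2 c, x < c < y & f y - f x = g c * (y - x).
  move=> xy; have [|c] := @MVT R f g x y xy (fun c _ => fg c).
    exact: continuous_subspaceT.
  by rewrite in_itv /=; exists c.
move=> x y; have [xy|yx|->] := ltgtP x y.
- have [c /andP[xc cy] fc] := H _ _ xy; exists c => //.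
  by rewrite !ger0_norm; lra.
- have [c /andP[yc cx] fc] := H _ _ yx; exists c; last by lra.
  by rewrite !ler0_norm; lra.
- by exists y; rewrite ?subrr ?mulr0.
Qed.

Lemma derive_bounded_lipschitz f g L : (forall x : R, is_derive x 1 f (g x)) ->
  (forall x, `|g x| <= L) -> forall x y, `|f y - f x| <= L * `|y - x|.
Proof.
move=> fg gL x y; have [c _ ->] := mean_value fg x y.
by rewrite normrM ler_wpM2r.
Qed.

Lemma taylor2_le f g l L : (forall x : R, is_derive x 1 f (g x)) ->
  (forall x : R, is_derive x 1 g (l x)) -> (forall x, `|l x| <= L) ->
  forall x h, `|f (x + h) - f x - h * g x| <= L * h ^+ 2.
Proof.
move=> fg gl lL x h; have [c xc] := mean_value fg x (x + h).
have gL := derive_bounded_lipschitz gl lL.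
rewrite addrAC subrr add0r in xc * => ->.
have -> : g c * h - h * g x = (g c - g x) * h by ring.
have L0 : 0 <= L := le_trans (normr_ge0 _) (lL 0).
rewrite normrM -[h ^+ 2]real_normK ?num_real// expr2 mulrA ler_wpM2r//.
by apply: le_trans (gL x c) _; rewrite ler_wpM2l.
Qed.

End MeanValue.

(** * Differentiating and averaging trigonometric series *)

Section TrigDerivative.
Variable R : realType.
Implicit Types (al be : nat -> R) (f : R -> R).

Lemma is_derive_trig_term (a b : R) n (x : R) : is_derive x 1
  (fun x : R => a * cos (n%:R * x) + b * sin (n%:R * x))
  ((n%:R * b) * cos (n%:R * x) + (- (n%:R * a)) * sin (n%:R * x)).
Proof.
have da : is_derive x 1 (fun s : R => n%:R * s) n%:R.
  have -> : (fun s : R => n%:R * s) = n%:R \*: (@id R) by [].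
  by apply: is_derive_eq; rewrite scaler1.
have h1 := @is_derive1_comp R cos (fun s => n%:R * s) x _ _ (is_derive_cos _) da.
have h2 := @is_derive1_comp R sin (fun s => n%:R * s) x _ _ (is_derive_sin _) da.
have -> : (fun x => a * cos (n%:R * x) + b * sin (n%:R * x)) =
   a \*: (cos \o (fun s => n%:R * s)) + b \*: (sin \o (fun s => n%:R * s)) by [].
by apply: is_derive_eq; rewrite /GRing.scale /=; ring.
Qed.

(** The second derivatives of the terms have a summable bound, so the first-order Taylor remainders
    of the partial sums are at most K h^2 with one [K]. This bound passes to the limit, and a
    remainder of order h^2 gives the derivative. *)
Lemma trig_series_derivable f al be B rho : 0 <= rho < 1 ->
  geom_bounded al B rho -> geom_bounded be B rho -> trig_series f al be ->
  exists f1, trig_series f1 (fun n => n%:R * be n) (fun n => - (n%:R * al n)) /\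
    forall x : R, is_derive x 1 f (f1 x).
Proof.
move=> r01 aB bB fs.
have [A1 A10 [s1 s101 aA1]] := geom_bounded_natM r01 aB.
have [A2 A20 [s2 s201 bA2]] := geom_bounded_natM r01 bB.
have [A3 A30 [s3 s301 aA3]] := geom_bounded_natM s101 aA1.
have [A4 A40 [s4 s401 bA4]] := geom_bounded_natM s201 bA2.
have cv x : cvgn (series (trig_term (fun n => n%:R * be n) (fun n => - (n%:R * al n)) x)).
  case/andP: (s101) => s1_0 s1_1; case/andP: (s201) => s2_0 s2_1.
  pose s := Num.max s1 s2; have ss1 : s1 <= s by rewrite /s le_max lexx.
  have ss2 : s2 <= s by rewrite /s le_max lexx orbT.
  have s0 : 0 <= s := le_trans s1_0 ss1.
  have s01 : 0 <= s < 1 by rewrite s0 gt_max s1_1.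
  apply: (@geom_trig_cvg R _ _ (A1 + A2) s) => // n.
    apply: le_trans (bA2 n) _; rewrite ler_pM ?exprn_ge0 ?lerDr//.
    by rewrite lerXn2r ?nnegrE.
  rewrite normrN; apply: le_trans (aA1 n) _; rewrite ler_pM ?exprn_ge0 ?lerDl//.
  by rewrite lerXn2r ?nnegrE.
pose f1 x := limn (series (trig_term (fun n => n%:R * be n) (fun n => - (n%:R * al n)) x)).
exists f1; split=> [x|x]; first exact: cv.
pose K := A3 / (1 - s3) + A4 / (1 - s4).
apply: (@is_derive_quadratic _ _ _ _ K 1) => // h _.
have c1 := fs (x + h); have c2 := fs x; have c3 : series _ @ \oo --> f1 x := cv x.
have c4 : (fun N => h * series (trig_term (fun n => n%:R * be n)
    (fun n => - (n%:R * al n)) x) N) @ \oo --> h * f1 x by exact: cvgMr c3.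
apply: (cvgr_to_le (cvg_norm (cvgB (cvgB c1 c2) c4))); apply: nearW => N.
change (`|series (trig_term al be (x + h)) N - series (trig_term al be x) N -
  h * series (trig_term (fun n => n%:R * be n) (fun n => - (n%:R * al n)) x) N|
  <= K * h ^+ 2).
rewrite /series /= mulr_sumr -!sumrB.
apply: le_trans (ler_norm_sum _ _ _) _.
apply: (@le_trans _ _ (\sum_(0 <= n < N) (A3 * s3 ^+ n + A4 * s4 ^+ n) * h ^+ 2)).
  apply: ler_sum => n _.
  apply: (@taylor2_le R (fun x => trig_term al be x n)
    (fun x => trig_term (fun n => n%:R * be n) (fun n => - (n%:R * al n)) x n)
    (fun x => trig_term (fun n => n%:R * - (n%:R * al n)) (fun n => - (n%:R * (n%:R * be n))) x n)).
  - by move=> y; exact: is_derive_trig_term.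
  - by move=> y; exact: is_derive_trig_term.
  - move=> y; apply: le_trans (trig_term_le _ _ _ _) _.
    by rewrite mulrN !normrN lerD.
rewrite -mulr_suml big_split /= ler_wpM2r ?sqr_ge0//.
by rewrite lerD// geom_sum_le.
Qed.

Lemma cos_2pi_frac_neq1 n q : ~~ (q %| n)%N -> (0 < q)%N ->
  cos (2 * pi * n%:R / q%:R) != 1 :> R.
Proof.
move=> qn q0; have qR : 0 < q%:R :> R by rewrite ltr0n.
have pi0 := pi_gt0 R.
set r := (n %% q)%N; have r0 : (0 < r)%N by rewrite lt0n.
have rq : (r < q)%N by rewrite ltn_mod.
have h x : cos (x + 2 * pi) = cos x :> R.
  by rewrite cosD [2 * pi]mulr_natl sin2pi cos2pi mulr0 subr0 mulr1.
have -> : cos (2 * pi * n%:R / q%:R) = cos (2 * (pi * r%:R / q%:R)) :> R.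
  have := periodic_int h (n %/ q)%N (2 * (pi * r%:R / q%:R)) => <-.
  congr cos; rewrite -pmulrn {1}(divn_eq n q) -/r natrD natrM.
  by field; rewrite gt_eqF.
rewrite mulr_natl mulr2n cosD -!expr2.
have := cos2Dsin2 (pi * r%:R / q%:R : R).
have : 0 < sin (pi * r%:R / q%:R) :> R.
  apply: sin_gt0_pi; rewrite divr_gt0 ?mulr_gt0 ?ltr0n//=.
  by rewrite ltr_pdivrMr// ltr_pM2l// ltr_nat.
move=> s0 cs; apply/eqP => c1.
have : 0 < sin (pi * r%:R / q%:R) ^+ 2 :> R by rewrite exprn_gt0.
lra.
Qed.

(** A cyclic shift of the q points shows that the vector (C, S) of cosine and sine sums is fixed by
    the rotation of angle [th]. If q does not divide n, this rotation is not the identity, because p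
    is invertible modulo q, and its only fixed vector is 0. *)
Lemma sum_trig_frac (a b : R) n p q x : coprime p q -> (0 < q)%N ->
  \sum_(k < q) (a * cos (n%:R * (x + 2 * pi * (k * p)%:R / q%:R)) +
                b * sin (n%:R * (x + 2 * pi * (k * p)%:R / q%:R))) =
  if (q %| n)%N then q%:R * (a * cos (n%:R * x) + b * sin (n%:R * x)) else 0.
Proof.
move=> cpq q0; have qR : q%:R != 0 :> R by rewrite pnatr_eq0 -lt0n.
have hc x0 : cos (x0 + 2 * pi) = cos x0 :> R.
  by rewrite cosD [2 * pi]mulr_natl sin2pi cos2pi mulr0 subr0 mulr1.
have hs x0 : sin (x0 + 2 * pi) = sin x0 :> R.
  by rewrite sinD [2 * pi]mulr_natl sin2pi cos2pi mulr0 addr0 mulr1.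
case: ifP => qn.
  have /dvdnP[m nm] := qn.
  have E k : n%:R * (x + 2 * pi * (k * p)%:R / q%:R) = n%:R * x + (m * (k * p))%N%:~R * (2 * pi) :> R.
    by rewrite -pmulrn nm !natrM; field.
  under eq_bigr do rewrite E (periodic_int hc) (periodic_int hs).
  by rewrite sumr_const card_ord [RHS]mulr_natl.
pose th : R := 2 * pi * (n * p)%:R / q%:R.
have thn : cos th != 1.
  by apply: cos_2pi_frac_neq1 => //; rewrite Gauss_dvdl ?qn// coprime_sym.
pose C := \sum_(k < q) cos (n%:R * x + k%:R * th).
pose S := \sum_(k < q) sin (n%:R * x + k%:R * th).
have shiftE (F : R -> R) : (forall x0, F (x0 + 2 * pi) = F x0) ->
   \sum_(k < q) F (n%:R * x + k%:R * th) = \sum_(k < q) F (n%:R * x + k%:R * th + th).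
  move=> hF; pose g (k : nat) := F (n%:R * x + k%:R * th).
  rewrite -(@sum_shift_periodic R g q _ 1).
    apply: eq_bigr => k _; rewrite /g natrD; congr F; ring.
  move=> k; rewrite /g natrD mulrDl addrA.
  have -> : q%:R * th = (n * p)%N%:~R * (2 * pi) by rewrite /th -pmulrn; field.
  by rewrite (periodic_int hF).
have CE : C = C * cos th - S * sin th.
  rewrite {1}/C (shiftE cos hc) mulr_suml [S * _]mulr_suml -sumrB.
  by apply: eq_bigr => k _; rewrite cosD.
have SE : S = S * cos th + C * sin th.
  rewrite {1}/S (shiftE sin hs) mulr_suml [C * _]mulr_suml -big_split.
  by apply: eq_bigr => k _; rewrite sinD.
have d0 : 1 - cos th != 0 by rewrite subr_eq0 eq_sym.
have cs := cos2Dsin2 th.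
(* This is the determinant of the identity minus the rotation of angle [th]. *)
have D0 : 2 * (1 - cos th) != 0 by rewrite mulf_neq0.
have C0 : C = 0.
  apply: (mulfI D0); rewrite mulr0.
  have -> : 2 * (1 - cos th) * C = (1 - cos th) * (C * (1 - cos th)) + (C * sin th) * sin th.
    have -> : (1 - cos th) * (C * (1 - cos th)) + (C * sin th) * sin th = C * (1 - 2 * cos th + (cos th ^+ 2 + sin th ^+ 2)) by ring.
    by rewrite cs; ring.
  have -> : C * (1 - cos th) = - (S * sin th) by lra.
  have -> : C * sin th = S * (1 - cos th) by lra.
  by ring.
have S0 : S = 0.
  have := SE; rewrite C0 mul0r addr0 => /eqP; rewrite eq_sym -subr_eq0.
  by rewrite -[X in _ - X]mulr1 -mulrBr mulf_eq0 subr_eq0 (negbTE thn) orbF => /eqP.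
transitivity (a * C + b * S); last by rewrite C0 S0 !mulr0 addr0.
rewrite /C /S !mulr_sumr -big_split /=; apply: eq_bigr => k _.
have -> : n%:R * (x + 2 * pi * (k * p)%:R / q%:R) = n%:R * x + k%:R * th.
  by rewrite /th !natrM; field.
by [].
Qed.

Lemma cvg_sum_ord q (u : nat -> nat -> R) (l : nat -> R) :
  (forall k, u k @ \oo --> l k) ->
  (fun N => \sum_(k < q) u k N) @ \oo --> \sum_(k < q) l k.
Proof.
move=> ul; elim: q => [|q IH].
  rewrite big_ord0 (_ : (fun N => _) = cst 0); first exact: cvg_cst.
  by apply/funext => N; rewrite big_ord0.
rewrite big_ord_recr /= (_ : (fun N => _) =
    (fun N => \sum_(k < q) u k N) \+ u q); first by apply: cvgD.
by apply/funext => N; rewrite big_ord_recr.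
Qed.

Lemma trig_series_average f al be p q E x : coprime p q -> (0 < q)%N ->
  trig_series f al be ->
  (forall L, \sum_(2 <= m < L) (`|al (q * m)%N| + `|be (q * m)%N|) <= E) ->
  `|\sum_(k < q) f (x + 2 * pi * (k * p)%:R / q%:R) -
    q%:R * (al 0%N + (al q * cos (q%:R * x) + be q * sin (q%:R * x)))| <= q%:R * E.
Proof.
move=> cpq q0 fs EL.
pose xk (k : nat) := x + 2 * pi * (k * p)%:R / q%:R.
have cvgS : (fun N => \sum_(k < q) series (trig_term al be (xk k)) N) @ \oo -->
    \sum_(k < q) f (xk k).
  by apply: (@cvg_sum_ord q (fun k => series (trig_term al be (xk k))) (fun k => f (xk k))) => k; exact: fs.
set l := q%:R * _.
(* Partial sums are taken at the ends of blocks of q frequencies; in each block only its multiple of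
   q survives the average. *)
have part L : \sum_(k < q) series (trig_term al be (xk k)) (q * L)%N =
   \sum_(0 <= m < L) q%:R * trig_term al be x (q * m)%N.
  rewrite /series /=.
  rewrite exchange_big /=.
  under eq_bigr do rewrite [\sum_(k < q) _]sum_trig_frac//.
  elim: L => [|L IH]; first by rewrite muln0 !big_geq.
  rewrite mulnS addnC (big_cat_nat _ (n := (q * L)%N)) ?leq_addr//= IH.
  rewrite [RHS]big_nat_recr//=; congr (_ + _).
  rewrite -{1}[(q * L)%N]add0n big_addn addKn.
  case: q q0 {cpq EL xk cvgS l IH} => // q _.
  rewrite big_nat_recl//= add0n dvdn_mulr// big_nat_cond big1 ?addr0// => i.
  rewrite andbT => /andP[_ iq]; rewrite dvdn_addl ?dvdn_mulr//.
  by rewrite gtnNdvd.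
have {}fs : forall e, 0 < e -> `|\sum_(k < q) f (xk k) - l| <= q%:R * E + e.
  move=> e e0; have /cvgrPdist_lt/(_ e e0)[N _ NP] := cvgS.
  pose L := (N + 2)%N.
  have /NP : (N <= q * L)%N by rewrite /L; apply: leq_trans (leq_pmull _ q0); rewrite leq_addr.
  rewrite part => h.
  have -> : \sum_(k < q) f (xk k) - l =
     (\sum_(k < q) f (xk k) - \sum_(0 <= m < L) q%:R * trig_term al be x (q * m)%N) +
     (\sum_(0 <= m < L) q%:R * trig_term al be x (q * m)%N - l).
    by rewrite addrA subrK.
  rewrite (le_trans (ler_normD _ _))// addrC lerD//; last exact: ltW.
  rewrite (big_cat_nat _ (n := 2))//=; last by rewrite /L addnC.
  rewrite big_nat_recl// big_nat1 muln0 muln1 /l.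
  have -> : trig_term al be x 0 = al 0%N.
    by rewrite /trig_term mul0r cos0 sin0 mulr0 mulr1 addr0.
  rewrite -mulrDr -/(trig_term al be x q) addrAC subrr add0r.
  rewrite -mulr_sumr normrM ger0_norm// ler_wpM2l//.
  apply: le_trans (EL L); apply: le_trans (ler_norm_sum _ _ _) _.
  by apply: ler_sum => i _; exact: trig_term_le.
by apply/ler_addgt0Pr.
Qed.

End TrigDerivative.

(** * Fixed points of return maps *)

Section Lift.
Variables (R : realType) (F : R -> R) (Lam : R).
Hypothesis F2pi : forall x, F (x + 2 * pi) = F x + 2 * pi.
Hypothesis Finc : forall x y, x < y -> F x < F y.
Hypothesis Lam1 : 1 <= Lam.
Hypothesis Flip : forall x y, `|F x - F y| <= Lam * `|x - y|.
Implicit Types (x y z t e : R) (n m k : nat) (j : int).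

Lemma lift_int j x : F (x + j%:~R * (2 * pi)) = F x + j%:~R * (2 * pi).
Proof.
have h y : F (y + 2 * pi) - (y + 2 * pi) = F y - y by rewrite F2pi; ring.
have := periodic_int h j x; lra.
Qed.

Lemma iter_int n j x :
  iter n F (x + j%:~R * (2 * pi)) = iter n F x + j%:~R * (2 * pi).
Proof. by elim: n => //= n ->; rewrite lift_int. Qed.

Lemma iter_lt n x y : x < y -> iter n F x < iter n F y.
Proof. by move=> xy; elim: n => //= n; exact: Finc. Qed.

Lemma iter_le n x y : x <= y -> iter n F x <= iter n F y.
Proof. by rewrite le_eqVlt => /orP[/eqP->//|xy]; rewrite ltW// iter_lt. Qed.

Lemma iter_lip n x y : `|iter n F x - iter n F y| <= Lam ^+ n * `|x - y|.
Proof.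
elim: n => [|n IH] /=; first by rewrite expr0 mul1r.
have L1 := Lam1; apply: le_trans (Flip _ _) _.
by rewrite exprS -mulrA ler_wpM2l//; lra.
Qed.

Lemma iter_cont n : continuous (iter n F).
Proof.
move=> x; apply/cvgrPdist_lt => e e0.
have L1 := Lam1; have L0 : 0 < Lam ^+ n by rewrite exprn_gt0//; lra.
apply/nbhs_ballP; exists (e / Lam ^+ n) => /=; first by rewrite divr_gt0.
move=> y; rewrite /ball /= => xy; apply: le_lt_trans (iter_lip _ _ _) _.
by rewrite mulrC -ltr_pdivlMr.
Qed.

Variables (q : nat) (P : int).
Hypothesis q0 : (0 < q)%N.

(** Its fixed points are the lifts of the points of the circle that return after [q] steps and [P]
    full turns. *)
Definition return_map x := iter q F x - P%:~R * (2 * pi).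
Definition displacement x := return_map x - x.

Local Notation Phi := return_map.

Lemma return_mapE x : iter q F x = Phi x + P%:~R * (2 * pi).
Proof. by rewrite subrK. Qed.

Lemma iter_return n m x :
  iter (n + m * q) F x = iter n F (iter m Phi x) + (m%:Z * P)%:~R * (2 * pi).
Proof.
elim: m x => [|m IH] x; first by rewrite mul0n addn0 mul0r mul0r addr0.
rewrite mulSn addnCA addnC iterD return_mapE iter_int IH -iterSr.
rewrite -addrA -mulrDl -intrD; congr (_ + _%:~R * _).
by rewrite -[in RHS]addn1 PoszD mulrDl mul1r.
Qed.

Lemma return_lt x y : x < y -> Phi x < Phi y.
Proof. by move=> xy; rewrite ltrD2r iter_lt. Qed.

Lemma return_cont : continuous Phi.
Proof.
by move=> x; apply: cvgB; [exact: iter_cont|exact: cvg_cst].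
Qed.

Lemma return_int j x : Phi (x + j%:~R * (2 * pi)) = Phi x + j%:~R * (2 * pi).
Proof. by rewrite /return_map iter_int addrAC. Qed.

Lemma return_iter k x : Phi (iter k F x) = iter k F (Phi x).
Proof.
rewrite /return_map -iterD addnC iterD.
have -> : - (P%:~R * (2 * pi)) = (- P)%:~R * (2 * pi) :> R by rewrite mulrNz mulNr.
by rewrite iter_int.
Qed.

Lemma iter_fixed z : Phi z = z -> forall m, iter m Phi z = z.
Proof. by move=> zz; elim=> //= m ->. Qed.

Lemma iter_fixed_mod z n : Phi z = z ->
  iter n F z = iter (n %% q) F z + ((n %/ q)%:Z * P)%:~R * (2 * pi).
Proof.
move=> zz; rewrite {1}(divn_eq n q) addnC iter_return.
by rewrite iter_fixed.
Qed.

Lemma fixed_periodic z : Phi z = z -> circle_periodic F z.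
Proof.
by move=> zz; exists q => //; exists P; rewrite return_mapE zz.
Qed.

Lemma trajectory_fixedP z y : Phi z = z -> trajectory F z y ->
  exists2 k, (k < q)%N & exists j, y = iter k F z + j%:~R * (2 * pi).
Proof.
move=> zz [n [j yE]]; exists (n %% q)%N; first by rewrite ltn_mod.
exists ((n %/ q)%:Z * P + j); rewrite yE (iter_fixed_mod _ zz).
by rewrite -addrA -mulrDl -intrD.
Qed.

Lemma trajectory_int z k j : trajectory F z (iter k F z + j%:~R * (2 * pi)).
Proof. by exists k, j. Qed.

Lemma trajectory_self z : trajectory F z z.
Proof. by have := trajectory_int z 0 0; rewrite mul0r addr0. Qed.

Lemma lattice_isolated (c w : R) : exists2 g, 0 < g &
  forall j, `|c + j%:~R * (2 * pi) - w| < g -> c + j%:~R * (2 * pi) = w.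
Proof.
have pi0 := pi2_gt0 R.
have [[j [j1 j2]]|H] := pselect (exists j, 0 < `|c + j%:~R * (2 * pi) - w| /\
   `|c + j%:~R * (2 * pi) - w| < pi); last first.
  exists pi; first exact: pi_gt0.
  move=> j jp; apply/eqP; rewrite -subr_eq0; apply: contra_notT H => nz.
  by exists j; rewrite normr_gt0.
exists `|c + j%:~R * (2 * pi) - w| => // i ij.
have [e|/eqP ij0] := eqVneq i j; first by move: ij; rewrite e ltxx.
have : `|(i - j)%:~R| < (1 : R).
  have e : (i - j)%:~R * (2 * pi) = (c + i%:~R * (2 * pi) - w) - (c + j%:~R * (2 * pi) - w) :> R.
    by rewrite intrB; ring.
  have : `|(i - j)%:~R * (2 * pi)| < 2 * pi :> R.
    by rewrite e; apply: le_lt_trans (ler_normB _ _) _; lra.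
  by rewrite normrM (gtr0_norm pi0) -[ltRHS]mul1r ltr_pM2r.
by rewrite -intr_norm ltrz1; lia.
Qed.

Lemma trajectory_isolated z w : Phi z = z -> exists2 g, 0 < g &
  forall y, trajectory F z y -> `|y - w| < g -> y = w.
Proof.
move=> zz.
have [g g0 gP] : exists2 g, 0 < g & forall k, (k < q)%N -> forall j,
    `|iter k F z + j%:~R * (2 * pi) - w| < g -> iter k F z + j%:~R * (2 * pi) = w.
  elim: (q) => [|n [g g0 gP]]; first by exists 1.
  have [g' g'0 g'P] := lattice_isolated (iter n F z) w.
  exists (Num.min g g') => [|k]; first by rewrite lt_min g0.
  rewrite ltnS leq_eqVlt => /orP[/eqP->|kn] j; rewrite lt_min => /andP[h1 h2].
    exact: g'P.
  exact: gP.
exists g => // y /(trajectory_fixedP zz)[k kq [j ->]]; exact: gP.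
Qed.

Section SignChange.
Variables (z s : R).
Hypothesis zz : Phi z = z.
Hypothesis s1 : s = 1 \/ s = -1.

(* The return map read in the coordinate t = s (x - z), so that both sides of a
   fixed point are treated at once. *)
Definition side_map t := s * (Phi (z + s * t) - z).

Lemma ss : s * s = 1. Proof. by case: s1 => ->; ring. Qed.

Lemma iter_side m t : z + s * iter m side_map t = iter m Phi (z + s * t).
Proof.
elim: m => //= m <-; rewrite {1}/side_map mulrA ss mul1r.
by rewrite addrC subrK.
Qed.

Lemma side_lt t u : t < u -> side_map t < side_map u.
Proof.
move=> tu; rewrite /side_map; case: s1 => ->.
  by rewrite !mul1r ltrD2r return_lt// ltrD2l.
by rewrite !mulN1r ltrN2 ltrD2r return_lt// ltrD2l ltrN2.
Qed.

Lemma side0 : side_map 0 = 0.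
Proof. by rewrite /side_map mulr0 addr0 zz subrr mulr0. Qed.

Lemma side_gt0 t : 0 < t -> 0 < side_map t.
Proof. by move=> /side_lt; rewrite side0. Qed.

Lemma side_cont : continuous side_map.
Proof.
move=> t; apply: cvgMr; apply: cvgB; last exact: cvg_cst.
apply: (continuous_comp (f := fun t => z + s * t)); last exact: return_cont.
by apply: cvgD; [exact: cvg_cst|apply: cvgMr; exact: cvg_id].
Qed.

Lemma side_lip t : 0 <= t -> side_map t <= Lam ^+ q * t.
Proof.
move=> t0; have := iter_lip q (z + s * t) z.
have -> : iter q F (z + s * t) - iter q F z = Phi (z + s * t) - z.
  by rewrite !return_mapE zz; ring.
rewrite [z + s * t - z]addrAC subrr add0r normrM (_ : `|s| = 1) ?mul1r ?(ger0_norm t0).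
  apply: le_trans; apply: le_trans (ler_norm _) _; rewrite normrM.
  by rewrite (_ : `|s| = 1) ?mul1r//; case: s1 => ->; rewrite ?normrN normr1.
by case: s1 => ->; rewrite ?normrN normr1.
Qed.

(** Otherwise the return map does not move points towards [z] on this side. An orbit that starts at
    distance [t0] then never comes closer than [t0], although by stability it stays near [z] and by
    attraction it should come closer. *)
Lemma attracting_sign_change : attracting F (trajectory F z) ->
  forall e, 0 < e -> exists2 t, 0 < t < e & side_map t < t.
Proof.
move=> [stab [d2 d20 attr]] e e0.
have [//|H] := pselect (exists2 t, 0 < t < e & side_map t < t).
have {}H t : 0 < t < e -> t <= side_map t.
  by move=> te; rewrite leNgt; apply/negP => tt; apply: H; exists t.
have [g g0 gP] := trajectory_isolated z zz.
have L0 : 1 <= Lam ^+ q by rewrite exprn_ege1.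
(* One application of [side_map] takes a point below [e1] to one below g / 2. So closeness to the
   trajectory, which is what stability controls, means closeness to [z] itself and not to another of
   its points. *)
pose e1 := Num.min e g / (2 * Lam ^+ q).
have e1E : e1 * (2 * Lam ^+ q) = Num.min e g by rewrite divfK//; lra.
have e10 : 0 < e1 by rewrite divr_gt0 ?lt_min ?e0//; lra.
have me : Num.min e g <= e by rewrite ge_min lexx.
have mg : Num.min e g <= g by rewrite ge_min lexx orbT.
have e1L : Lam ^+ q * e1 <= g / 2 by lra.
have e1e : e1 < e by nra.
have e1g : e1 <= g / 2 by nra.
have [d d0 dP] := stab e1 e10.
pose t0 := Num.min (Num.min d d2) e1 / 2.
have t00 : 0 < t0 by rewrite divr_gt0 ?lt_min ?d0 ?d20.
have t0E : t0 * 2 = Num.min (Num.min d d2) e1 by rewrite divfK.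
have t0d : t0 < d.
  have h : Num.min (Num.min d d2) e1 <= d by rewrite !ge_min lexx.
  by lra.
have t0d2 : t0 < d2.
  have h : Num.min (Num.min d d2) e1 <= d2 by rewrite !ge_min lexx orbT.
  by lra.
have t0e : t0 < e1.
  have h : Num.min (Num.min d d2) e1 <= e1 by rewrite !ge_min lexx orbT.
  by lra.
have ns x : `|s * x| = `|x|.
  by rewrite normrM; case: s1 => ->; rewrite ?normrN normr1 mul1r.
have near_z d' : t0 < d' -> thickening (trajectory F z) d' (z + s * t0).
  move=> td; exists z; first exact: trajectory_self.
  by rewrite addrAC subrr add0r ns gtr0_norm.
have close n e' : e' <= g / 2 -> 0 <= iter n side_map t0 <= g / 2 ->
    thickening (trajectory F z) e' (iter (n * q) F (z + s * t0)) ->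
    iter n side_map t0 < e'.
  move=> eg /andP[i0 ig]; have -> : (n * q = 0 + n * q)%N by [].
  rewrite iter_return -iter_side /=; set c := _%:~R * _.
  move=> [y Oy yc].
  have Oy' : trajectory F z (y - c).
    case: Oy => k [j yE]; exists k, (j - n%:Z * P); rewrite yE /c intrB; ring.
  have yzc : `|(y - c) - (z + s * iter n side_map t0)| < e'.
    by rewrite distrC (_ : _ - _ = z + s * iter n side_map t0 + c - y)//; ring.
  have yz : y - c = z.
    apply: gP => //; rewrite -(subrK (z + s * iter n side_map t0) (y - c)) -addrA.
    apply: le_lt_trans (ler_normD _ _) _.
    by rewrite [z + _ - z]addrAC subrr add0r ns (ger0_norm i0); lra.
  move: yzc; rewrite yz opprD addrA subrr add0r normrN ns ger0_norm//.
have stay n : t0 <= iter n side_map t0 < e1.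
  elim: n => [|n /andP[h1 h2]]; first by rewrite /= lexx t0e.
  have i0 : 0 < iter n side_map t0 < e by apply/andP; split; lra.
  have up := H _ i0.
  have sl : side_map (iter n side_map t0) <= Lam ^+ q * iter n side_map t0.
    by apply: side_lip; lra.
  have sl2 : Lam ^+ q * iter n side_map t0 <= Lam ^+ q * e1 by rewrite ler_wpM2l//; lra.
  apply/andP; split=> /=; first lra.
  apply: (close n.+1) => //=; first by apply/andP; split; lra.
  exact: dP (near_z _ t0d) _.
have [N _ NP] := attr _ (near_z _ t0d2) _ t00.
have := NP (N * q)%N (leq_pmulr _ q0).
have /andP[h1 h2] := stay N.
move=> th; have : iter N side_map t0 < t0.
  by apply: close th; [lra|apply/andP; split; lra].
by rewrite ltNge h1.
Qed.

(** The iterates decrease, and their limit is a fixed point of [side_map] in [0, e[, which can only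
    be 0. *)
Lemma side_contracts e : 0 < e -> (forall t, 0 < t < e -> side_map t < t) ->
  forall t, 0 <= t < e -> (forall m, 0 <= iter m side_map t <= t) /\
    (iter m side_map t @[m --> \oo] --> 0).
Proof.
move=> e0 H t /andP[t0 te].
have st m : 0 <= iter m side_map t <= t /\ iter m.+1 side_map t <= iter m side_map t.
  elim: m => [|m [/andP[h1 h2] h3]] /=.
    rewrite lexx t0; split=> //; move: t0; rewrite le_eqVlt => /orP[/eqP<-|t0].
      by rewrite side0.
    by rewrite ltW// H// t0.
  have h0 : 0 <= side_map (iter m side_map t).
    move: h1; rewrite le_eqVlt => /orP[/eqP<-|h1]; first by rewrite side0.
    by rewrite ltW// side_gt0.
  split; first by rewrite h0 (le_trans h3).
  move: h0; rewrite le_eqVlt => /orP[/eqP<-|h0]; first by rewrite side0.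
  by apply/ltW/H; rewrite h0 (le_lt_trans _ te)// (le_trans h3).
split; first by move=> m; have [] := st m.
pose u m := iter m side_map t.
have cu : cvgn u.
  apply: nonincreasing_is_cvgn.
    by apply/nonincreasing_seqP => m; have [] := st m.
  by exists 0 => _ [m _ <-]; have [/andP[]] := st m.
pose l := limn u; have ul : u @ \oo --> l := cu.
have l0 : 0 <= l.
  by apply: (cvgr_to_ge ul); apply: nearW => m; have [/andP[]] := st m.
have lt_ : l <= t.
  by apply: (cvgr_to_le ul); apply: nearW => m; have [/andP[]] := st m.
have ll : side_map l = l.
  have c1 : (fun m => side_map (u m)) @ \oo --> side_map l.
    by apply: (cvg_comp u side_map ul); exact: side_cont.
  have c2 : (fun m => side_map (u m)) @ \oo --> l.
    have -> : (fun m => side_map (u m)) = (fun m => u (m + 1)%N).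
      by apply/funext => m; rewrite addn1.
    by rewrite cvg_shiftn.
  exact: (@cvg_unique R _ _ _ _ _ c1 c2).
suff <- : l = 0 by [].
apply/eqP; rewrite eq_le l0 andbT leNgt; apply/negP => lp.
by have := H l; rewrite ll ltxx lp (le_lt_trans lt_ te) => /(_ isT).
Qed.

End SignChange.
End Lift.

(** * Attraction and signs of the displacement *)

Section Orbits.
Variables (R : realType) (F : R -> R) (Lam : R).
Hypothesis F2pi : forall x, F (x + 2 * pi) = F x + 2 * pi.
Hypothesis Finc : forall x y, x < y -> F x < F y.
Hypothesis Lam1 : 1 <= Lam.
Hypothesis Flip : forall x y, `|F x - F y| <= Lam * `|x - y|.
Variables (q : nat) (P : int).
Hypothesis q0 : (0 < q)%N.
Implicit Types (x y z t e : R) (n m k : nat) (j : int).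

Local Notation Phi := (return_map F q P).
Local Notation H := (displacement F q P).

(** A point close to any point of the trajectory comes close to a translate of [z] after at most q
    steps ([enter]). From then on, full returns bring it ever closer, and fewer than q further steps
    remain ([follow]). Each of the two incomplete turns costs a factor at most [W]. *)
Lemma attracting_of_sign z e : Phi z = z -> 0 < e ->
  (forall t, 0 < t < e -> 0 < H (z - t)) ->
  (forall t, 0 < t < e -> H (z + t) < 0) ->
  attracting F (trajectory F z).
Proof.
move=> zz e0 Hl Hr.
have L1 := Lam1.
have contr u : `|u - z| < e -> (forall m, `|iter m Phi u - z| <= `|u - z|) /\
    (iter m Phi u @[m --> \oo] --> z).
  move=> ue.
  have Hs s : s = 1 \/ s = -1 -> forall t, 0 < t < e -> side_map F q P z s t < t.
    move=> [->|->] t te; rewrite /side_map.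
      by have := Hr t te; rewrite /displacement mul1r mul1r; lra.
    by have := Hl t te; rewrite /displacement !mulN1r; lra.
  have [s [s1 us]] : exists s, (s = 1 \/ s = -1) /\ u = z + s * `|u - z|.
    have [uz|uz] := leP z u.
      by exists 1; split; [left|rewrite mul1r ger0_norm ?subr_ge0// addrC subrK].
    exists (-1); split; [by right|rewrite mulN1r ltr0_norm ?subr_lt0//].
    by rewrite opprK addrC subrK.
  have [h1 h2] := side_contracts Finc Lam1 Flip zz s1 e0 (Hs s s1)
    (introT andP (conj (normr_ge0 (u - z)) ue)).
  have iE m : iter m Phi u = z + s * iter m (side_map F q P z s) `|u - z|.
    by rewrite (iter_side _ _ _ _ s1) -us.
  split=> [m|].
    rewrite iE addrAC subrr add0r normrM; have /andP[h3 h4] := h1 m.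
    rewrite (ger0_norm h3) (_ : `|s| = 1) ?mul1r//.
    by case: s1 => ->; rewrite ?normrN normr1.
  have -> : (fun m => iter m Phi u) = (fun m => z + s * iter m (side_map F q P z s) `|u - z|).
    by apply/funext.
  rewrite -[X in _ --> X]addr0 -(mulr0 s).
  by apply: cvgD; [exact: cvg_cst|exact: cvgMr].
pose W := Lam ^+ q; have W1 : 1 <= W by rewrite exprn_ege1.
have WP n x y : (n <= q)%N -> `|iter n F x - iter n F y| <= W * `|x - y|.
  move=> nq; apply: le_trans (iter_lip Lam1 Flip n x y) _.
  by rewrite ler_wpM2r// ler_weXn2l.
have enter d w y : trajectory F z w -> `|y - w| < d ->
    exists n0 u j, [/\ (n0 <= q)%N, `|u - z| < W * d & iter n0 F y = u + j%:~R * (2 * pi)].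
  move=> /(trajectory_fixedP F2pi q0 zz)[k kq [j wE]] yw.
  exists (q - k)%N, (iter (q - k) F y - (P + j)%:~R * (2 * pi)), (P + j).
  split; [exact: leq_subr| |by rewrite subrK].
  have wz : iter (q - k) F w = z + (P + j)%:~R * (2 * pi).
    have qz : iter q F z = z + P%:~R * (2 * pi) by rewrite (return_mapE _ _ P) zz.
    by rewrite wE (iter_int F2pi) -iterD subnK ?(ltnW kq)// qz intrD; ring.
  have := WP _ y w (leq_subr k q); rewrite wz opprD addrA.
  rewrite [iter _ F y - z - _]addrAC => /le_lt_trans; apply.
  by rewrite ltr_pM2l//; lra.
have follow n0 y u j : iter n0 F y = u + j%:~R * (2 * pi) -> forall n, (n0 <= n)%N ->
    exists2 w, trajectory F z w &
      `|iter n F y - w| <= W * `|iter ((n - n0) %/ q) Phi u - z|.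
  move=> yE n n0n; set m := ((n - n0) %/ q)%N; set i := ((n - n0) %% q)%N.
  have nE : n = ((i + m * q) + n0)%N by rewrite addnC addnC [(i + _)%N]addnC -divn_eq addnC subnKC// addnC.
  exists (iter i F z + (m%:Z * P + j)%:~R * (2 * pi)); first exact: trajectory_int.
  rewrite nE iterD yE (iter_int F2pi) (@iter_return R F F2pi q P).
  set v := iter m Phi u; set c1 := (_ * _)%:~R; set c2 := _%:~R.
  have -> : iter i F v + c1 * (2 * pi) + c2 * (2 * pi) -
      (iter i F z + (m%:Z * P + j)%:~R * (2 * pi)) = iter i F v - iter i F z.
    by rewrite intrD /c1 /c2; ring.
  by apply: WP; rewrite ltnW// ltn_mod.
split=> [eps eps0|].
  pose d1 := Num.min e (eps / W).
  have d10 : 0 < d1 by rewrite lt_min e0 divr_gt0//; lra.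
  have d1e : d1 <= e by rewrite ge_min lexx.
  have d1W : W * d1 <= eps by rewrite mulrC -ler_pdivlMr; [rewrite ge_min lexx orbT|lra].
  exists (d1 / W); first by rewrite divr_gt0//; lra.
  move=> y [w Ow yw] n.
  have [n0 [u [j [n0q ue yE]]]] := enter _ _ _ Ow yw.
  rewrite mulrC divfK in ue; last lra.
  have [nn|nn] := leqP n0 n.
    have [w' Ow' h] := follow _ _ _ _ yE n nn; exists w' => //.
    apply: le_lt_trans h _; apply: lt_le_trans d1W; rewrite ltr_pM2l; last lra.
      have ue' : `|u - z| < e by lra.
    exact: le_lt_trans ((contr u ue').1 _) ue.
  exists (iter n F w).
    by case: Ow => k [i ->]; rewrite (iter_int F2pi) -iterD; exact: trajectory_int.
  apply: le_lt_trans (WP _ _ _ (leq_trans (ltnW nn) n0q)) _.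
  apply: lt_le_trans d1W; rewrite ltr_pM2l; last lra.
  by apply: lt_le_trans yw _; rewrite ler_pdivrMr; [rewrite ler_peMr//; lra|lra].
exists (e / W); first by rewrite divr_gt0//; lra.
move=> y [w Ow yw] eps eps0.
have [n0 [u [j [n0q ue yE]]]] := enter _ _ _ Ow yw.
rewrite mulrC divfK in ue; last lra.
have [_ uz] := contr u ue.
have eW : 0 < eps / W by rewrite divr_gt0//; lra.
have /cvgrPdist_lt/(_ _ eW)[M _ MP] := uz.
exists (n0 + M * q)%N => // n /= nM.
have [w' Ow' h] := follow _ _ _ _ yE n (leq_trans (leq_addr _ _) nM).
exists w' => //; apply: le_lt_trans h _.
rewrite mulrC -ltr_pdivlMr; last lra.
rewrite distrC; apply: MP => /=.
by rewrite leq_divRL// leq_subRL// (leq_trans (leq_addr _ _) nM).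
Qed.

(** The orbit of [z] stays at bounded distance from the uniform motion of speed 2 pi P / q, and by
    monotonicity any other orbit stays between two translates of it. *)
Lemma rotation_of_fixed z : Phi z = z -> forall x,
  (fun n => (iter n F x - x) / (n%:R * (2 * pi))) @ \oo --> (P%:~R / q%:R : R).
Proof.
move=> zz x; have pi0 := pi2_gt0 R.
have qR : 0 < q%:R :> R by rewrite ltr0n.
pose rho : R := P%:~R / q%:R.
have bnd : exists A : R, forall k, (k < q)%N -> `|iter k F z - z - k%:R * (2 * pi) * rho| <= A.
  elim: (q) => [|n [A AP]]; first by exists 0.
  exists (Num.max A `|iter n F z - z - n%:R * (2 * pi) * rho|) => k.
  rewrite ltnS leq_eqVlt => /orP[/eqP->|/AP kA]; first by rewrite le_max lexx orbT.
  by rewrite le_max kA.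
have [A AP] := bnd.
have zb n : `|iter n F z - z - n%:R * (2 * pi) * rho| <= A.
  rewrite (iter_fixed_mod F2pi _ zz).
  have -> : iter (n %% q) F z + ((n %/ q)%:Z * P)%:~R * (2 * pi) - z - n%:R * (2 * pi) * rho
    = iter (n %% q) F z - z - (n %% q)%:R * (2 * pi) * rho.
    rewrite {3}(divn_eq n q) natrD natrM intrM -pmulrn /rho; field.
    by rewrite gt_eqF.
  by apply: AP; rewrite ltn_mod.
have [j /andP[j1 j2]] := mod_period z x.
have xb n : `|iter n F x - x - n%:R * (2 * pi) * rho| <= A + 2 * pi + 2 * pi.
  have h1 := iter_le Finc n j1; have h2 := ltW (iter_lt Finc n j2).
  have e1 : iter n F (x - j%:~R * (2 * pi)) = iter n F x - j%:~R * (2 * pi).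
    by have := iter_int F2pi n (- j) x; rewrite mulrNz mulNr.
  have e2 : iter n F (z + 2 * pi) = iter n F z + 2 * pi.
    by have := iter_int F2pi n 1 z; rewrite mul1r.
  rewrite e1 in h1 h2; rewrite e2 in h2.
  have := zb n; rewrite !ler_norml => /andP[h3 h4]; apply/andP; split; lra.
pose K := A + 2 * pi + 2 * pi.
have K0 : 0 <= K by apply: le_trans (xb 0%N); exact: normr_ge0.
apply/cvgrPdist_lt => e e0.
exists (Num.bound (K / (2 * pi) / e)).+1 => // n /= nb.
have n0 : (0 < n)%N by apply: leq_ltn_trans nb.
have nR : 0 < n%:R :> R by rewrite ltr0n.
have np : 0 < n%:R * (2 * pi) :> R by rewrite mulr_gt0.
have -> : P%:~R / q%:R - (iter n F x - x) / (n%:R * (2 * pi)) =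
   - (iter n F x - x - n%:R * (2 * pi) * rho) / (n%:R * (2 * pi)).
  rewrite -/rho; apply: (mulIf (lt0r_neq0 np)); rewrite mulrBl !divfK ?(lt0r_neq0 np)//.
  by ring.
rewrite normrM normrN normfV (gtr0_norm np) ltr_pdivrMr//.
apply: le_lt_trans (xb n) _; rewrite -/K.
have : K / (2 * pi) / e < n%:R.
  apply: lt_le_trans (archi_boundP _) _; last by rewrite ler_nat ltnW.
  by apply: divr_ge0; [apply: divr_ge0 => //; exact: ltW|exact: ltW].
by rewrite ltr_pdivrMr// ltr_pdivrMr//; lra.
Qed.

Lemma rotation_of_periodic (rho : R) n j x : (0 < n)%N ->
  (fun n => (iter n F x - x) / (n%:R * (2 * pi))) @ \oo --> rho ->
  iter n F x = x + j%:~R * (2 * pi) -> j%:~R / n%:R = rho.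
Proof.
move=> n0 Hx xj; have pi0 := pi2_gt0 R.
have nR : 0 < n%:R :> R by rewrite ltr0n.
have mE m : iter (m * n) F x = x + (m%:Z * j)%:~R * (2 * pi).
  elim: m => [|m IH]; first by rewrite mul0n mul0r mul0r addr0.
  rewrite mulSn iterD IH (iter_int F2pi) xj -addrA -mulrDl -intrD.
  by congr (_ + _%:~R * _); rewrite intS; ring.
have c : (fun m => (iter (m * n) F x - x) / ((m * n)%:R * (2 * pi))) @ \oo --> rho.
  apply: (cvg_comp (fun m => m * n)%N (fun n => (iter n F x - x) / (n%:R * (2 * pi))) _ Hx).
  by move=> B [N _ NB]; exists N => // m /= Nm; apply: NB; rewrite /= (leq_trans Nm)// leq_pmulr.
have c' : (fun m => (iter (m * n) F x - x) / ((m * n)%:R * (2 * pi))) @ \oo --> (j%:~R / n%:R : R).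
  have cc : (fun=> j%:~R / n%:R : R) @ \oo --> (j%:~R / n%:R : R) by exact: cvg_cst.
  apply: cvg_trans cc; apply: near_eq_cvg.
  exists 1%N => // m /= m0; rewrite mE addrAC subrr add0r intrM natrM -pmulrn.
  have mR : 0 < m%:R :> R by rewrite ltr0n.
  have c0 := lt0r_neq0 pi0; have m1 := lt0r_neq0 mR; have n1 := lt0r_neq0 nR.
  by move: (2 * pi) c0 m1 n1 => c0 *; field; do ?[apply/andP; split].
exact: (@cvg_unique R _ _ _ _ _ c' c).
Qed.

(** An increasing map keeps moving a point in the direction of its first step. *)
Lemma return_fixed_of_iter m z : iter m.+1 Phi z = z -> Phi z = z.
Proof.
move=> zz; have [h|h|//] := ltgtP (Phi z) z.
  have hm k : iter k.+1 Phi z < z.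
    elim: k => //= k IH; apply: lt_trans h; exact: (return_lt Finc).
  by have := hm m; rewrite zz ltxx.
have hm k : z < iter k.+1 Phi z.
  elim: k => //= k IH; apply: lt_trans h _; exact: (return_lt Finc).
by have := hm m; rewrite zz ltxx.
Qed.

Lemma trajectory_eq z w : Phi z = z -> trajectory F z w -> trajectory F w = trajectory F z.
Proof.
move=> zz /(trajectory_fixedP F2pi q0 zz)[k kq [j wE]].
apply/seteqP; split=> y [n [i ->]].
  by rewrite wE (iter_int F2pi) -iterD -addrA -mulrDl -intrD; exists (n + k)%N, (j + i).
exists (n + (q - k))%N, (i - (P + j)).
rewrite iterD wE [iter (q - k) F _](iter_int F2pi) -iterD subnK ?(ltnW kq)//.
rewrite !(iter_int F2pi) (return_mapE F q P z) zz !(iter_int F2pi) intrB intrD; ring.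
Qed.

(* The displacement changes sign from + to - on ]x1, y1[ and on ]x2, y2[, and by the
   last clause no image of ]x2, y2[ meets a translate of ]x1, y1[.  For the family
   this is equivalent to the existence of two attracting periodic trajectories, and
   it is visibly an open condition on F. *)
Definition two_sinks (x1 y1 x2 y2 : R) :=
  [/\ x1 < y1, x2 < y2, [/\ 0 < H x1, H y1 < 0, 0 < H x2 & H y2 < 0] &
   forall k, (k < q)%N -> exists j, y1 + j%:~R * (2 * pi) < iter k F x2 /\
                        iter k F y2 < x1 + (j + 1)%:~R * (2 * pi)].

Lemma displacement_cont : continuous H.
Proof. by move=> x; apply: cvgB; [exact: (return_cont Lam1 Flip)|exact: cvg_id]. Qed.

Lemma side_sign z (s : R) : s = 1 \/ s = -1 -> forall t,
  side_map F q P z s t < t -> 0 < - (s * H (z + s * t)).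
Proof. by rewrite /side_map /displacement => -[->|->] t; rewrite ?mulN1r ?mul1r; lra. Qed.

(** Let g be a lower bound for the distance from [z1] to the trajectory of [z2]. The interval around
    [z1] has half-widths below g / 2. The one around [z2] is smaller by the factor [W], so that its
    first q images stay within g / 2 of that trajectory. *)
Lemma two_sinks_of_attracting z1 z2 : Phi z1 = z1 -> Phi z2 = z2 ->
  attracting F (trajectory F z1) -> attracting F (trajectory F z2) ->
  trajectory F z1 <> trajectory F z2 ->
  exists x1 y1 x2 y2, two_sinks x1 y1 x2 y2.
Proof.
move=> zz1 zz2 A1 A2 O12.
have [g g0 gP] := trajectory_isolated F2pi Lam1 q0 z1 zz2.
have {}gP y : trajectory F z2 y -> g <= `|y - z1|.
  move=> Oy; rewrite leNgt; apply/negP => /(gP _ Oy) yE.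
  by apply: O12; apply: (trajectory_eq zz2); rewrite -yE.
have L1 := Lam1; pose W := Lam ^+ q; have W1 : 1 <= W by rewrite exprn_ege1.
have s1 : (1 : R) = 1 \/ (1 : R) = -1 by left.
have sN : (-1 : R) = 1 \/ (-1 : R) = -1 by right.
have g2 : 0 < g / 2 by rewrite divr_gt0.
have gW : 0 < g / 2 / W by rewrite divr_gt0//; lra.
have sc z : Phi z = z -> forall s : R, (s = 1 \/ s = -1) -> attracting F (trajectory F z) -> forall e, 0 < e ->
    exists2 t, 0 < t < e & 0 < - (s * H (z + s * t)).
  move=> zz s ss A e e0.
  have [t te ht] := attracting_sign_change F2pi Lam1 Flip q0 zz ss A e0.
  by exists t => //; exact: side_sign.
have [t1 /andP[a1 b1] H1] := sc _ zz1 _ sN A1 _ g2.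
have [t2 /andP[a2 b2] H2] := sc _ zz1 _ s1 A1 _ g2.
have [u1 /andP[c1 d1] G1] := sc _ zz2 _ sN A2 _ gW.
have [u2 /andP[c2 d2] G2] := sc _ zz2 _ s1 A2 _ gW.
rewrite !mulN1r opprK in H1 G1; rewrite !mul1r oppr_gt0 in H2 G2.
exists (z1 - t1), (z1 + t2), (z2 - u1), (z2 + u2); split; [lra|lra|by split; lra|].
move=> k kq; have [j /andP[j1 j2]] := mod_period z1 (iter k F z2).
have o1 : trajectory F z2 (iter k F z2 - j%:~R * (2 * pi)).
  by have := trajectory_int F z2 k (- j); rewrite mulrNz mulNr.
have o2 : trajectory F z2 (iter k F z2 - (j + 1)%:~R * (2 * pi)).
  by have := trajectory_int F z2 k (- (j + 1)); rewrite mulrNz mulNr.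
have := gP _ o1; rewrite ger0_norm; last lra.
have := gP _ o2; rewrite ltr0_norm; last by rewrite intrD; lra.
have B u : 0 < `|u - z2| < g / 2 / W -> `|iter k F u - iter k F z2| < g / 2.
  move=> /andP[_ h]; apply: le_lt_trans (iter_lip Lam1 Flip k _ _) _.
  apply: (@le_lt_trans _ _ (W * `|u - z2|)); first by rewrite ler_wpM2r// ler_weXn2l// ltnW.
  by rewrite mulrC -ltr_pdivlMr//; lra.
have := B (z2 - u1); rewrite [_ - u1 - _]addrAC subrr add0r normrN gtr0_norm// c1 d1 => /(_ isT).
have := B (z2 + u2); rewrite [_ + u2 - _]addrAC subrr add0r gtr0_norm// c2 d2 => /(_ isT).
rewrite !ltr_norml => /andP[_ h1] /andP[h2 _] h3 h4.
by exists j; rewrite intrD; split; rewrite intrD in h3; lra.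
Qed.

(** The dichotomy for zeros of an analytic function: as the displacement may vanish identically, an
    accumulation of zeros has to be allowed. *)
Hypothesis isolated_zeros : forall z,
  (forall e, 0 < e -> exists w, [/\ w != z, `|w - z| < e & H w = 0]) ->
  exists2 e, 0 < e & forall w, `|w - z| < e -> H w = 0.

(** An arbitrary zero given by the intermediate value theorem need not be a crossing. The infimum
    [z] of the points after [x] with negative displacement is one: there are no negative values
    before it, and negative values accumulate at it from the right. Hence [H] does not vanish near
    [z], its zero there is isolated, and both signs are strict. *)
Lemma attracting_between x y : x < y -> 0 < H x -> H y < 0 ->
  exists2 z, x < z < y & Phi z = z /\ attracting F (trajectory F z).
Proof.
move=> xy Hx Hy; have Hc := displacement_cont.
pose S := [set w | x <= w /\ H w < 0].
have S0 : S !=set0 by exists y; split=> //; exact: ltW.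
have Slb : lbound S x by move=> w [].
have hi : has_inf S by split=> //; exists x.
pose z := inf S.
have near0 w (d : R) : 0 < d -> exists2 e, 0 < e & forall v, `|v - w| < e -> `|H v - H w| < d.
  move=> d0; have /cvgrPdist_lt/(_ _ d0)/nbhs_ballP[e /= e0 eP] := Hc w.
  by exists e => // v vw; rewrite distrC; apply: eP; rewrite /ball /= distrC.
have zx : x <= z by apply: lb_le_inf.
have pos w : x <= w -> w < z -> 0 <= H w.
  move=> xw wz; rewrite leNgt; apply/negP => h.
  have : z <= w by apply: ge_inf; [exists x|split].
  by rewrite leNgt wz.
have close e : 0 < e -> exists2 w, z <= w < z + e & H w < 0.
  move=> e0; have [w [xw Hw] wz] := inf_adherent e0 hi.
  by exists w => //; rewrite wz andbT; apply: ge_inf => //; exists x.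
have zx' : x < z.
  rewrite lt_neqAle zx andbT; apply/eqP => xE.
  have [e e0 eP] := near0 x _ Hx.
  have [w /andP[w1 w2] Hw] := close e e0.
  have := eP w; rewrite {1}xE ger0_norm ?subr_ge0// => /(_ ltac:(lra)).
  by rewrite ltr_norml => /andP[]; lra.
have Hz : H z = 0.
  apply/eqP; rewrite eq_le; apply/andP; split; rewrite leNgt; apply/negP => h.
    have [e e0 eP] := near0 z _ h.
    have [w /andP[w1 w2] Hw] := close e e0.
    have := eP w; rewrite ger0_norm ?subr_ge0// => /(_ ltac:(lra)).
    by rewrite ltr_norml => /andP[]; lra.
  have h' : 0 < - H z by lra.
  have [e e0 eP] := near0 z _ h'.
  pose m := Num.min e (z - x) / 2.
  have m0 : 0 < Num.min e (z - x) by rewrite lt_min e0; lra.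
  have m1 : Num.min e (z - x) <= e by rewrite ge_min lexx.
  have m2 : Num.min e (z - x) <= z - x by rewrite ge_min lexx orbT.
  have := eP (z - m); rewrite [z - m - z]addrAC subrr add0r normrN gtr0_norm /m; last lra.
  move=> /(_ ltac:(lra)); have := pos (z - m) ltac:(rewrite /m; lra) ltac:(rewrite /m; lra).
  by rewrite /m ltr_norml => h1 /andP[]; lra.
have zy : z < y.
  rewrite lt_neqAle; apply/andP; split; last by apply: ge_inf; [exists x|split=> //; exact: ltW].
  by apply/eqP => zE; rewrite zE in Hz; rewrite Hz ltxx in Hy.
have [g g0 gP] : exists2 g, 0 < g & forall w, w != z -> `|w - z| < g -> H w != 0.
  have [//|nG] := pselect (exists2 g, 0 < g & forall w, w != z -> `|w - z| < g -> H w != 0).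
  have [e e0 eP] : exists2 e, 0 < e & forall w, `|w - z| < e -> H w = 0.
    apply: isolated_zeros => e e0.
    have [//|nw] := pselect (exists w, [/\ w != z, `|w - z| < e & H w = 0]).
    case: nG; exists e => // w wz we; apply/eqP => h; apply: nw; by exists w.
  have [w /andP[w1 w2] Hw] := close e e0.
  by move: Hw; rewrite eP ?ltxx// ger0_norm ?subr_ge0//; lra.
exists z; first by rewrite zx' zy.
have zz : Phi z = z by apply/eqP; rewrite -subr_eq0; apply/eqP.
split=> //; pose e := Num.min g (z - x).
have e0 : 0 < e by rewrite lt_min g0; lra.
have eg : e <= g by rewrite ge_min lexx.
have ex : e <= z - x by rewrite ge_min lexx orbT.
apply: (attracting_of_sign zz e0) => t /andP[t0 te].
  rewrite lt_neqAle; apply/andP; split; last by apply: pos; lra.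
  rewrite eq_sym; apply: gP; first by apply/eqP => h; lra.
  by rewrite [z - t - z]addrAC subrr add0r normrN gtr0_norm//; lra.
rewrite ltNge; apply/negP => Ht.
have [w /andP[w1 w2] Hw] := close t t0.
have wt : w <= z + t by lra.
have := @IVT R H w (z + t) 0 wt (continuous_subspaceT Hc).
rewrite ge_min le_max (ltW Hw) Ht orbT => /(_ isT)[v].
rewrite in_itv /= => /andP[v1 v2] Hv.
have vz : v != z.
  apply/eqP => vE; have wE : w = z by lra.
  by rewrite wE Hz ltxx in Hw.
by have := gP v vz; rewrite Hv eqxx ger0_norm; [move=> /(_ ltac:(lra))|lra].
Qed.

Lemma attracting_of_two_sinks x1 y1 x2 y2 : two_sinks x1 y1 x2 y2 ->
  exists z1 z2, [/\ Phi z1 = z1, Phi z2 = z2, attracting F (trajectory F z1),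
    attracting F (trajectory F z2) & trajectory F z1 <> trajectory F z2].
Proof.
move=> [xy1 xy2 [h1 h2 h3 h4] sep]; have pi0 := pi2_gt0 R.
have [z1 /andP[a1 b1] [zz1 A1]] := attracting_between xy1 h1 h2.
have [z2 /andP[a2 b2] [zz2 A2]] := attracting_between xy2 h3 h4.
exists z1, z2; split=> // O12.
have : trajectory F z2 z1 by rewrite -O12; exact: trajectory_self.
move=> /(trajectory_fixedP F2pi q0 zz2)[k kq [j zE]].
have [i [i1 i2]] := sep _ kq.
have k1 := iter_lt Finc k a2; have k2 := iter_lt Finc k b2.
(* If the trajectories coincided, [i + j] would be an integer strictly between -1 and 0. *)
have p1 : (i + j)%:~R * (2 * pi) < (0%:~R) * (2 * pi) :> R by rewrite intrD mul0r; lra.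
have p2 : (-1)%:~R * (2 * pi) < (i + j)%:~R * (2 * pi) :> R.
  by rewrite intrD in i2; rewrite intrD; lra.
rewrite ltr_pM2r// ltr_int in p1; rewrite ltr_pM2r// ltr_int in p2.
by move: p1 p2; clear; lia.
Qed.

End Orbits.

Lemma counting_le1P (T : choiceType) (R : realType) (X : set T) :
  ((counting X : \bar R) <= 1%:E)%E <-> forall a b, X a -> X b -> a = b.
Proof.
rewrite /counting; split.
  case: (pselect (finite_set X)) => fX; last by rewrite asboolF.
  rewrite asboolT// lee_fin (_ : 1 = 1%:R)// ler_nat => h a b Xa Xb.
  have ha : a \in fset_set X by rewrite in_fset_set//; exact: mem_set.
  have hb : b \in fset_set X by rewrite in_fset_set//; exact: mem_set.
  apply/eqP; apply: contraT => ab; move: h; rewrite leqNgt.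
  rewrite (leq_trans _ (fsubset_leq_card (_ : [fset a; b]%fset `<=` fset_set X)%fset))//.
    by rewrite cardfs2 ab.
  by apply/fsubsetP => c; rewrite !inE => /orP[] /eqP->.
move=> h; have fX : finite_set X.
  have [->|/set0P[a Xa]] := eqVneq X set0; first exact: finite_set0.
  apply: (@sub_finite_set _ _ [set a]); last exact: finite_set1.
  by move=> b Xb; apply: h.
rewrite asboolT// lee_fin (_ : 1 = 1%:R)// ler_nat.
have [->|/set0P[a Xa]] := eqVneq X set0; first by rewrite fset_set0 cardfs0.
have -> : X = [set a] by apply/seteqP; split=> [b Xb|b ->//]; exact: h.
by rewrite fset_set1 cardfs1.
Qed.

(** * The family near a rigid rotation *)

(** The constant is 81/100 - 1/100 = 4/5. *)
Lemma phase_product (R : realFieldType) (A u u' v v' : R) : 0 < A ->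
  `|v| <= A / 10 -> `|v'| <= A / 10 -> 9 * A / 10 <= u -> 9 * A / 10 <= u' ->
  - (u * u') + v * v' <= A ^+ 2 * - (4 / 5).
Proof.
move=> A0 vA vA' uA uA'.
have h1 : v * v' <= A / 10 * (A / 10).
  by apply: le_trans (ler_norm _) _; rewrite normrM ler_pM.
have h2 : 9 * A / 10 * (9 * A / 10) <= u * u' by apply: ler_pM; lra.
by rewrite expr2; lra.
Qed.

(** * Oscillation of a perturbed harmonic *)

Section Phase.
Variables (R : realType) (n A alpha beta : R).
Hypothesis n0 : 0 < n.
Hypothesis A0 : 0 < A.
Hypothesis A2 : alpha ^+ 2 + beta ^+ 2 = A ^+ 2.
Implicit Types (x y t d : R).

(** In phase form this is A cos(nx - phi), and [wave1] is its derivative divided by n, namely -A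
    sin(nx - phi). The two values together determine the phase. *)
Definition wave x := alpha * cos (n * x) + beta * sin (n * x).
Definition wave1 x := beta * cos (n * x) - alpha * sin (n * x).
Local Notation U := wave.
Local Notation V := wave1.

(** The threshold is dictated by [attracting_unique]: three gaps of 3 pi / 4 make the 9 pi / 4 that
    one step of [T] may cover in phase. Doubling the angle avoids the value of the cosine at 3 pi /
    4. *)
Lemma cos_gap d : 0 <= d -> cos d <= - (4 / 5) -> 3 * pi / 4 < d.
Proof.
move=> d0 dc; rewrite ltNge; apply/negP => dpi; have p0 := pi_gt0 R.
have [h|h] := leP d (pi / 2).
  have : 0 <= cos d by apply: cos_ge0_pihalf; apply/andP; split; lra.
  lra.
have : 0 <= cos (2 * d - pi) by apply: cos_ge0_pihalf; apply/andP; split; lra.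
have -> : 2 * d - pi = - (pi - (d + d)) by ring.
rewrite cosN cosB cospi sinpi mul0r addr0 cosD mulN1r.
have := cos2Dsin2 d; move: (cos d) (sin d) dc => c s; nra.
Qed.

Lemma wave_sqr x : U x ^+ 2 + V x ^+ 2 = A ^+ 2.
Proof.
rewrite -A2 /wave /wave1; have := cos2Dsin2 (n * x).
move: (cos _) (sin _) => c s cs.
by rewrite -[RHS]mulr1 -cs; ring.
Qed.

Lemma wave_cosB x y : A ^+ 2 * cos (n * (y - x)) = U x * U y + V x * V y.
Proof.
by rewrite mulrBr cosB -A2 /wave /wave1; ring.
Qed.

Lemma wave_cont : continuous U.
Proof.
move=> x; apply: cvgD; apply: cvgMr.
  apply: (continuous_comp (f := fun x => n * x)); last exact: continuous_cos.
  by apply: cvgMr; exact: cvg_id.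
apply: (continuous_comp (f := fun x => n * x)); last exact: continuous_sin.
by apply: cvgMr; exact: cvg_id.
Qed.

Lemma phase_gap x y : x < y -> `|V x| <= A / 10 -> `|V y| <= A / 10 ->
  U x <= - (9 * A / 10) -> 9 * A / 10 <= U y -> 3 * pi / 4 < n * (y - x).
Proof.
move=> xy Vx Vy Ux Uy; apply: cos_gap; first by rewrite mulr_ge0 ?subr_ge0 ?ltW.
have AA : 0 < A ^+ 2 by rewrite exprn_gt0.
rewrite -(ler_pM2l AA) wave_cosB -[U x]opprK mulNr.
by apply: phase_product => //; rewrite lerNr.
Qed.

Lemma phase_gapN x y : x < y -> `|V x| <= A / 10 -> `|V y| <= A / 10 ->
  9 * A / 10 <= U x -> U y <= - (9 * A / 10) -> 3 * pi / 4 < n * (y - x).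
Proof.
move=> xy Vx Vy Ux Uy; apply: cos_gap; first by rewrite mulr_ge0 ?subr_ge0 ?ltW.
have AA : 0 < A ^+ 2 by rewrite exprn_gt0.
rewrite -(ler_pM2l AA) wave_cosB -[U y]opprK mulrN.
by apply: phase_product => //; rewrite lerNr.
Qed.

End Phase.

Lemma interior_min (R : realType) (h h1 : R -> R) (a b c : R) :
  (forall x : R, is_derive x 1 h (h1 x)) -> a < c < b -> h c < h a -> h c < h b ->
  exists w, [/\ a < w < b, h w <= h c, forall x, a <= x <= b -> h w <= h x & h1 w = 0].
Proof.
move=> hd /andP[ac cb] ha hb; have ab : a < b by lra.
have hc : continuous h by move=> x; apply: is_derive_continuous (hd x).
have [w] := EVT_min (ltW ab) (continuous_subspaceT hc).
rewrite in_itv /= => /andP[w1 w2] wm.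
have {}wm x : a <= x <= b -> h w <= h x by move=> xab; apply: wm; rewrite in_itv.
have wc : h w <= h c by apply: wm; lra.
have wa : a < w.
  by rewrite lt_neqAle w1 andbT; apply/eqP => E; move: wc; rewrite -E leNgt ha.
have wb : w < b.
  by rewrite lt_neqAle w2 andbT; apply/eqP => E; move: wc; rewrite E leNgt hb.
exists w; split=> //; first by rewrite wa wb.
have hder t : t \in `]a, b[ -> derivable h t 1 by move=> _; apply: ex_derive.
have wab : w \in `]a, b[ by rewrite in_itv /= wa wb.
have h0 : is_derive w 1 h 0.
  apply: derive1_at_min (ltW ab) hder wab _ => t; rewrite in_itv /= => /andP[t1 t2].
  by apply: wm; rewrite !ltW.
by rewrite -(derive_val (is_derive := hd w)) (derive_val (is_derive := h0)).
Qed.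

(** A vanishing first derivative makes [wave1] small, hence [wave] close to A or -A. The sign is
    decided by minimality to the right of [w]: if [wave] were above A / 10, then [h2] would be
    negative just after [w] and [h] would decrease. *)
Lemma min_phase (R : realType) (n A alpha beta c1 c2 : R) (h h1 h2 : R -> R) w b :
  0 < A -> alpha ^+ 2 + beta ^+ 2 = A ^+ 2 -> 0 < c1 -> 0 < c2 ->
  (forall x : R, is_derive x 1 h (h1 x)) -> (forall x : R, is_derive x 1 h1 (h2 x)) ->
  (forall x, `|h1 x - c1 * wave1 n alpha beta x| <= c1 * (A / 10)) ->
  (forall x, `|h2 x + c2 * wave n alpha beta x| <= c2 * (A / 10)) ->
  w < b -> (forall x, w <= x <= b -> h w <= h x) -> h1 w = 0 ->
  `|wave1 n alpha beta w| <= A / 10 /\ wave n alpha beta w <= - (9 * A / 10).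
Proof.
move=> A0 A2 c10 c20 hd hd1 H1 H2 wb wm w0.
set U := wave n alpha beta; set V := wave1 n alpha beta.
have hV : `|V w| <= A / 10.
  by have := H1 w; rewrite w0 sub0r normrN normrM gtr0_norm// ler_pM2l.
split=> //.
have hU : U w <= A / 10.
  rewrite leNgt; apply/negP => hU.
  have hU' : 0 < U w - A / 10 by lra.
  have /cvgrPdist_lt/(_ _ hU')/nbhs_ballP[e /= e0 eP] := @wave_cont R n alpha beta w.
  pose t := w + Num.min (e / 2) (b - w).
  have m0 : 0 < Num.min (e / 2) (b - w) by rewrite lt_min; apply/andP; split; lra.
  have m1 : Num.min (e / 2) (b - w) <= e / 2 by rewrite ge_min lexx.
  have m2 : Num.min (e / 2) (b - w) <= b - w by rewrite ge_min lexx orbT.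
  have wt : w < t by rewrite /t; lra.
  have hc : continuous h by move=> x; apply: is_derive_continuous (hd x).
  have hc1 : continuous h1 by move=> x; apply: is_derive_continuous (hd1 x).
  have [c] := MVT wt (fun x _ => hd x) (continuous_subspaceT hc).
  rewrite in_itv /= => /andP[wc ct] hE.
  have hc0 : 0 <= h1 c.
    have : 0 <= h t - h w by rewrite subr_ge0; apply: wm; rewrite /t; lra.
    by rewrite hE pmulr_lge0//; lra.
  have [d] := MVT wc (fun x _ => hd1 x) (continuous_subspaceT hc1).
  rewrite in_itv /= w0 subr0 => /andP[wd dc] dE.
  have hd0 : 0 <= h2 d by move: hc0; rewrite dE pmulr_lge0//; lra.
  have de : ball w e d.
    rewrite /ball /= distrC ger0_norm; last lra.
    by move: dc ct; rewrite /t; lra.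
  have := eP d de; rewrite -/(U w) -/(U d) ltr_norml => /andP[_ h3].
  have Ud : A / 10 < U d by lra.
  have := H2 d; rewrite ler_norml => /andP[_ h4].
  have : c2 * (A / 10) < c2 * U d by rewrite ltr_pM2l.
  by rewrite -/U in h4; lra.
rewrite leNgt; apply/negP => hU2.
have := wave_sqr n A2 w; rewrite -/U -/V; move: hV hU hU2.
move: (U w) (V w) => u v hV hU hU2 E.
have h3 : v ^+ 2 <= (A / 10) ^+ 2 by rewrite -real_normK ?num_real// lerXn2r// ?nnegrE//; lra.
have h4 : 0 <= (u + 9 * A / 10) * (9 * A / 10 - u) by apply: mulr_ge0; lra.
have AA : 0 < A ^+ 2 by rewrite exprn_gt0.
by move: h3 h4 E AA; rewrite !expr2; lra.
Qed.

(* Between the sign changes, h has a minimum, a maximum, a minimum and a maximum.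
   Since h1 is close to c1 V and h2 to - c2 U, these lie near the points of phase
   0, pi, 2 pi, 3 pi of a pure harmonic of frequency n, hence more than 3 pi / (4 n)
   apart. *)
Lemma alternation_length (R : realType) (n A alpha beta c1 c2 : R) (h h1 h2 : R -> R)
    (z1 y1 x2 y2 x3 z3 : R) :
  0 < n -> 0 < A -> alpha ^+ 2 + beta ^+ 2 = A ^+ 2 -> 0 < c1 -> 0 < c2 ->
  (forall x : R, is_derive x 1 h (h1 x)) -> (forall x : R, is_derive x 1 h1 (h2 x)) ->
  (forall x, `|h1 x - c1 * wave1 n alpha beta x| <= c1 * (A / 10)) ->
  (forall x, `|h2 x + c2 * wave n alpha beta x| <= c2 * (A / 10)) ->
  z1 < y1 -> y1 < x2 -> x2 < y2 -> y2 < x3 -> x3 < z3 ->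
  h z1 = 0 -> h y1 < 0 -> 0 < h x2 -> h y2 < 0 -> 0 < h x3 -> h z3 = 0 ->
  9 * pi / 4 < n * (z3 - z1).
Proof.
move=> n0 A0 A2 c10 c20 hd hd1 H1 H2 l1 l2 l3 l4 l5 e1 e2 e3 e4 e5 e6.
have hdN (x : R) : is_derive x 1 (fun x => - h x) (- h1 x) by apply: is_deriveN.
have hdN1 (x : R) : is_derive x 1 (fun x => - h1 x) (- h2 x) by apply: is_deriveN.
have A2N : (- alpha) ^+ 2 + (- beta) ^+ 2 = A ^+ 2 by rewrite !sqrrN.
have VN x : wave1 n (- alpha) (- beta) x = - wave1 n alpha beta x.
  by rewrite /wave1; ring.
have UN x : wave n (- alpha) (- beta) x = - wave n alpha beta x.
  by rewrite /wave; ring.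
have HN1 x : `|- h1 x - c1 * wave1 n (- alpha) (- beta) x| <= c1 * (A / 10).
  by rewrite VN mulrN opprK addrC distrC.
have HN2 x : `|- h2 x + c2 * wave n (- alpha) (- beta) x| <= c2 * (A / 10).
  by rewrite UN mulrN -opprD normrN.
(* Each search starts at the extremum found before, so the four points come out in order; maxima are
   minima of [- h]. *)
have [w1 [/andP[a1 b1] m1 M1 d1]] := @interior_min R h h1 z1 x2 y1 hd ltac:(lra) ltac:(lra) ltac:(lra).
have [w2 [/andP[a2 b2] m2 M2 d2]] := @interior_min R _ _ w1 y2 x2 hdN ltac:(lra) ltac:(rewrite /=; lra) ltac:(rewrite /=; lra).
have [w3 [/andP[a3 b3] m3 M3 d3]] := @interior_min R h h1 w2 x3 y2 hd ltac:(lra) ltac:(lra) ltac:(lra).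
have [w4 [/andP[a4 b4] m4 M4 d4]] := @interior_min R _ _ w3 z3 x3 hdN ltac:(lra) ltac:(rewrite /=; lra) ltac:(rewrite /=; lra).
have M1' x : w1 <= x <= x2 -> h w1 <= h x by move=> ?; apply: M1; lra.
have M2' x : w2 <= x <= y2 -> - h w2 <= - h x by move=> ?; apply: M2; lra.
have M3' x : w3 <= x <= x3 -> h w3 <= h x by move=> ?; apply: M3; lra.
have M4' x : w4 <= x <= z3 -> - h w4 <= - h x by move=> ?; apply: M4; lra.
have [V1 U1] := min_phase A0 A2 c10 c20 hd hd1 H1 H2 b1 M1' d1.
have [V2 U2] := min_phase A0 A2N c10 c20 hdN hdN1 HN1 HN2 b2 M2' d2.
have [V3 U3] := min_phase A0 A2 c10 c20 hd hd1 H1 H2 b3 M3' d3.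
have [V4 U4] := min_phase A0 A2N c10 c20 hdN hdN1 HN1 HN2 b4 M4' d4.
rewrite VN normrN in V2; rewrite VN normrN in V4; rewrite UN in U2; rewrite UN in U4.
have g1 := phase_gap n0 A0 A2 a2 V1 V2 U1 ltac:(lra).
have g2 := phase_gapN n0 A0 A2 a3 V2 V3 ltac:(lra) U3.
have g3 := phase_gap n0 A0 A2 a4 V3 V4 U3 ltac:(lra).
have : n * (w4 - w1) < n * (z3 - z1) by rewrite ltr_pM2l//; lra.
lra.
Qed.

(** * Uniqueness of the attracting trajectory *)

Section Unique.
Variables (R : realType) (F : R -> R) (Lam : R).
Hypothesis F2pi : forall x, F (x + 2 * pi) = F x + 2 * pi.
Hypothesis Finc : forall x y, x < y -> F x < F y.
Hypothesis Lam1 : 1 <= Lam.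
Hypothesis Flip : forall x y, `|F x - F y| <= Lam * `|x - y|.
Variables (q k : nat) (P l : int).
Hypothesis q0 : (0 < q)%N.
Implicit Types (x y z t e : R).

Local Notation Phi := (return_map F q P).
Local Notation H := (displacement F q P).
Local Notation T := (return_map F k l).

Hypothesis Tnear : forall x, `|T x - x - 2 * pi / q%:R| <= pi / (4 * q%:R).

Let qR : 0 < q%:R :> R. Proof. by rewrite ltr0n. Qed.

Lemma next_gt x : x + pi / q%:R < T x.
Proof.
have := Tnear x; rewrite ler_norml => /andP[h _].
have h2 : 0 < pi / q%:R :> R by rewrite divr_gt0// pi_gt0.
by move: h; rewrite invfM; lra.
Qed.

Lemma next_fixed z : Phi z = z -> Phi (T z) = T z.
Proof.
move=> zz; rewrite {2}/return_map (_ : - _ = (- l)%:~R * (2 * pi)); last by rewrite mulrNz mulNr.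
by rewrite (return_int F2pi) (return_iter F2pi) zz mulrNz mulNr.
Qed.

Lemma next_trajectory z : trajectory F z (T z).
Proof. by have := trajectory_int F z k (- l); rewrite mulrNz mulNr. Qed.

(* T permutes each trajectory of period q and moves points by about 2 pi / q, the
   distance between neighbouring points of a trajectory. *)
Lemma neighbours z1 z2 : Phi z1 = z1 -> Phi z2 = z2 ->
  trajectory F z1 <> trajectory F z2 ->
  exists z w, [/\ Phi z = z, Phi w = w, trajectory F z = trajectory F z1,
    trajectory F w = trajectory F z2 & z < w < T z].
Proof.
move=> zz1 zz2 O12.
have [j /andP[j1 _]] := mod_period z1 z2.
set w := z2 - _ in j1.
have zw : Phi w = w.
  by have := return_int F2pi q P (- j) z2; rewrite mulrNz mulNr zz2.
have Ow : trajectory F w = trajectory F z2.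
  apply: (trajectory_eq F2pi q0 zz2).
  by have := trajectory_int F z2 0 (- j); rewrite mulrNz mulNr.
have sp m : Phi (iter m T z1) = iter m T z1 /\ trajectory F (iter m T z1) = trajectory F z1.
  elim: m => //= m [h1 h2]; split; first exact: next_fixed.
  by rewrite -h2; apply: (trajectory_eq F2pi q0 h1); exact: next_trajectory.
have grow m : z1 + m%:R * (pi / q%:R) <= iter m T z1.
  elim: m => [|m IH] /=; first by rewrite mul0r addr0.
  by have := next_gt (iter m T z1); rewrite -(natr1 m) [_ * (pi / _)]mulrDl mul1r; lra.
have piq : 0 < pi / q%:R :> R by rewrite divr_gt0// pi_gt0.
have ex : exists m, w < iter m.+1 T z1.
  exists (Num.bound ((w - z1) / (pi / q%:R))); apply: lt_le_trans (grow _).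
  have : (w - z1) / (pi / q%:R) < (Num.bound ((w - z1) / (pi / q%:R)))%:R.
    by apply: archi_boundP; apply: divr_ge0; [lra|exact: ltW].
  by rewrite ltr_pdivrMr// -(natr1 (Num.bound _)) [_ * (pi / _)]mulrDl mul1r; lra.
have [m mP mmin] := ex_minnP ex.
have neq x : trajectory F x = trajectory F z1 -> w <> x.
  by move=> E wx; apply: O12; rewrite -E -wx Ow.
exists (iter m T z1), w; split=> //; [exact: (sp m).1|exact: (sp m).2|].
rewrite mP andbT lt_neqAle; apply/andP; split.
  by apply/eqP => E; apply: (neq _ (sp m).2).
case: m mP mmin => [|m] mP mmin //=.
by rewrite leNgt; apply/negP => h; have := mmin m h; rewrite ltnn.
Qed.

(** Two distinct attracting trajectories would have points z < w < T z, with [z] and [T z] on one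
    and [w] on the other. The sign changes next to these points form the alternation of
    [alternation_length], of phase length above 9 pi / 4, whereas [Tnear] allows at most 9 pi / 4.
    The scale [c] makes room for dividing the displacement by the size of [a]. *)
Lemma attracting_unique (c A alpha beta c1 c2 : R) (h1 h2 : R -> R) z1 z2 :
  0 < c -> 0 < A -> alpha ^+ 2 + beta ^+ 2 = A ^+ 2 -> 0 < c1 -> 0 < c2 ->
  (forall x : R, is_derive x 1 (fun x => c * H x) (h1 x)) ->
  (forall x : R, is_derive x 1 h1 (h2 x)) ->
  (forall x, `|h1 x - c1 * wave1 q%:R alpha beta x| <= c1 * (A / 10)) ->
  (forall x, `|h2 x + c2 * wave q%:R alpha beta x| <= c2 * (A / 10)) ->
  Phi z1 = z1 -> Phi z2 = z2 -> attracting F (trajectory F z1) ->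
  attracting F (trajectory F z2) -> trajectory F z1 = trajectory F z2.
Proof.
move=> c0 A0 A2 c10 c20 hd hd1 H1 H2 zz1 zz2 at1 at2.
have [//|O12] := pselect (trajectory F z1 = trajectory F z2).
have [z [w [zz ww Oz Ow /andP[zw wT]]]] := neighbours zz1 zz2 O12.
have zT := next_fixed zz; have OT := trajectory_eq F2pi q0 zz (next_trajectory z).
have sc u (s e : R) : Phi u = u -> (s = 1 \/ s = -1) -> attracting F (trajectory F u) -> 0 < e ->
    exists2 t : R, 0 < t < e & 0 < - (s * H (u + s * t)).
  move=> uu ss Au e0.
  have [t te ht] := attracting_sign_change F2pi Lam1 Flip q0 uu ss Au e0.
  by exists t => //; exact: side_sign ss _ ht.
have e1 : 0 < (w - z) / 2 by lra.
have e2 : 0 < (T z - w) / 2 by lra.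
have s1 : (1 : R) = 1 \/ (1 : R) = -1 by left.
have sN : (-1 : R) = 1 \/ (-1 : R) = -1 by right.
have Az : attracting F (trajectory F z) by rewrite Oz.
have Aw : attracting F (trajectory F w) by rewrite Ow.
have AT : attracting F (trajectory F (T z)) by rewrite OT.
have [t1 /andP[a1 b1] G1] := sc _ _ _ zz s1 Az e1.
have [t2 /andP[a2 b2] G2] := sc _ _ _ ww sN Aw e1.
have [t3 /andP[a3 b3] G3] := sc _ _ _ ww s1 Aw e2.
have [t4 /andP[a4 b4] G4] := sc _ _ _ zT sN AT e2.
rewrite mul1r oppr_gt0 in G1; rewrite mul1r oppr_gt0 in G3.
rewrite mulN1r opprK in G2; rewrite mulN1r opprK in G4.
have := @alternation_length R q%:R A alpha beta c1 c2 _ h1 h2 z (z + 1 * t1) (w + -1 * t2)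
  (w + 1 * t3) (T z + -1 * t4) (T z) qR A0 A2 c10 c20 hd hd1 H1 H2.
have zero u : Phi u = u -> c * H u = 0 by move=> E; rewrite /displacement E subrr mulr0.
have pc (v : R) : 0 < v -> 0 < c * v by move=> ?; apply: mulr_gt0.
have nc (v : R) : v < 0 -> c * v < 0 by move=> ?; rewrite pmulr_rlt0.
rewrite (zero _ zz) (zero _ zT).
move=> /(_ ltac:(lra) ltac:(lra) ltac:(lra) ltac:(lra) ltac:(lra) erefl).
move=> /(_ (nc _ G1) (pc _ G2) (nc _ G3) (pc _ G4) erefl).
have := Tnear z; rewrite ler_norml => /andP[_ u1] u2.
have : q%:R * (T z - z) <= q%:R * (2 * pi / q%:R + pi / (4 * q%:R)) by rewrite ler_pM2l//; lra.
have -> : q%:R * (2 * pi / q%:R + pi / (4 * q%:R)) = 9 * pi / 4 :> R by field; rewrite gt_eqF.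
by move=> u3; move: u2; rewrite ltNge u3.
Qed.

End Unique.

Local Notation family := (@Defs.family _).

Lemma derive_periodic (R : realType) (f f1 : R -> R) (T : R) :
  (forall x, f (x + T) = f x) -> (forall x : R, is_derive x 1 f (f1 x)) ->
  forall x, f1 (x + T) = f1 x.
Proof.
move=> fp fd x.
have sd : is_derive x 1 (fun y : R => y + T) 1.
  by apply: is_derive_eq; rewrite addr0.
have h : is_derive x 1 (fun y : R => f (y + T)) (f1 (x + T)).
  by have := @is_derive1_comp R f (fun y => y + T) x _ _ (fd (x + T)) sd; rewrite mulr1.
have E : (fun y : R => f (y + T)) = f by apply/funext.
rewrite E in h.
by rewrite -(derive_val (is_derive := h)) (derive_val (is_derive := fd x)).
Qed.

(** * Iterates of the family for small a *)

Section Family.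
Variables (R : realType) (f f1 f2 : R -> R) (M : R).
Hypothesis f2pi : forall x, f (x + 2 * pi) = f x.
Hypothesis fd : forall x : R, is_derive x 1 f (f1 x).
Hypothesis fd1 : forall x : R, is_derive x 1 f1 (f2 x).
Hypothesis M1 : 1 <= M.
Hypothesis fM : forall x, `|f x| <= M.
Hypothesis f1M : forall x, `|f1 x| <= M.
Hypothesis f2M : forall x, `|f2 x| <= M.
Hypothesis f1lip : forall x y, `|f1 y - f1 x| <= M * `|y - x|.
Hypothesis f2lip : forall x y, `|f2 y - f2 x| <= M * `|y - x|.
Implicit Types (a r x y : R) (k n q : nat) (P : int).

Lemma family_2pi r a x : family f r a (x + 2 * pi) = family f r a x + 2 * pi.
Proof. by rewrite /family f2pi; ring. Qed.

Lemma is_derive_family r a x : is_derive x 1 (family f r a) (1 + a * f1 x).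
Proof.
have h := fd x; rewrite /family.
by apply: is_derive_eq; rewrite ?scaler0 ?add0r ?addr0 ?scale0r -?[_ *: _]/(a * f1 x).
Qed.

Lemma family_slope a x : `|a| <= (2 * M)^-1 -> 0 < 1 + a * f1 x.
Proof.
have M1' := M1; move=> aM; have : `|a * f1 x| <= 1 / 2.
  rewrite normrM (_ : 1 / 2 = (2 * M)^-1 * M); last by field; lra.
  by apply: ler_pM.
by rewrite ler_norml => /andP[h _]; lra.
Qed.

Lemma family_diffeo r a : `|a| <= (2 * M)^-1 -> circle_diffeo (family f r a).
Proof.
move=> aM.
have dE : derive1 (family f r a) = fun x => 1 + a * f1 x.
  apply/funext => x; rewrite derive1E.
  exact: (derive_val (is_derive := is_derive_family r a x)).
split=> [x|x||x]; first exact: family_2pi.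
- exact: (ex_derive (is_derive := is_derive_family r a x)).
- rewrite dE => x; apply: cvgD; first exact: cvg_cst.
  by apply: cvgMr; exact: is_derive_continuous (fd1 x).
- by rewrite dE; exact: family_slope.
Qed.

Lemma family_lt r a : `|a| <= (2 * M)^-1 ->
  forall x y, x < y -> family f r a x < family f r a y.
Proof.
move=> aM x y xy.
have [c] := MVT xy (fun x _ => is_derive_family r a x)
  (continuous_subspaceT (fun x => is_derive_continuous (is_derive_family r a x))).
rewrite in_itv /= => _ E; rewrite -subr_gt0 E mulr_gt0 ?subr_gt0//.
exact: family_slope.
Qed.

Lemma family_lip r a : `|a| <= (2 * M)^-1 ->
  forall x y, `|family f r a x - family f r a y| <= 2 * `|x - y|.
Proof.
have M1' := M1; move=> aM x y; rewrite distrC [in leRHS]distrC.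
apply: (derive_bounded_lipschitz (is_derive_family r a)) => t.
have : `|a * f1 t| <= 1 / 2.
  rewrite normrM (_ : 1 / 2 = (2 * M)^-1 * M); last by field; lra.
  by apply: ler_pM.
by rewrite !ler_norml => /andP[h1 h2]; apply/andP; split; lra.
Qed.

Fixpoint iter_d1 r a k x := if k is k'.+1 then
  (1 + a * f1 (iter k' (family f r a) x)) * iter_d1 r a k' x else 1.

Fixpoint iter_d2 r a k x := if k is k'.+1 then
  a * f2 (iter k' (family f r a) x) * iter_d1 r a k' x * iter_d1 r a k' x +
  (1 + a * f1 (iter k' (family f r a) x)) * iter_d2 r a k' x else 0.

Lemma is_derive_iter r a k x : is_derive x 1 (iter k (family f r a)) (iter_d1 r a k x).
Proof.
elim: k => [|k IH] /=; first exact: is_derive_id.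
exact: is_derive1_comp (is_derive_family r a _) IH.
Qed.

Lemma is_derive_comp_iter (g g1 : R -> R) r a k x : (forall x : R, is_derive x 1 g (g1 x)) ->
  is_derive x 1 (fun x => g (iter k (family f r a) x))
    (g1 (iter k (family f r a) x) * iter_d1 r a k x).
Proof. by move=> gd; exact: is_derive1_comp (gd _) (is_derive_iter r a k x). Qed.

Lemma is_derive_iter_d1 r a k x : is_derive x 1 (iter_d1 r a k) (iter_d2 r a k x).
Proof.
elim: k => [|k IH] /=; first exact: is_derive_cst.
have h := is_derive_comp_iter r a k x fd1.
apply: is_derive_eq; rewrite -![_ *: _]/(_ * _); ring.
Qed.

Lemma iterE r a k x : iter k (family f r a) x =
  x + k%:R * (2 * pi * r) + a * \sum_(i < k) f (iter i (family f r a) x).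
Proof.
elim: k => [|k IH]; first by rewrite big_ord0 mul0r mulr0 !addr0.
rewrite big_ord_recr /= {1}/family {1}IH -natr1; ring.
Qed.

Lemma displacement_family r a q P x : displacement (family f r a) q P x =
  q%:R * (2 * pi * r) - P%:~R * (2 * pi) +
    a * \sum_(i < q) f (iter i (family f r a) x).
Proof. by rewrite /displacement /return_map iterE; ring. Qed.

Definition disp_d1 r a q x :=
  \sum_(i < q) (f1 (iter i (family f r a) x) * iter_d1 r a i x).
Definition disp_d2 r a q x :=
  \sum_(i < q) (f2 (iter i (family f r a) x) * iter_d1 r a i x * iter_d1 r a i x +
                f1 (iter i (family f r a) x) * iter_d2 r a i x).

Lemma is_derive_disp r a q P x :
  is_derive x 1 (displacement (family f r a) q P) (a * disp_d1 r a q x).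
Proof.
have -> : displacement (family f r a) q P = fun x =>
   (q%:R * (2 * pi * r) - P%:~R * (2 * pi)) +
    a * (\sum_(i < q) (fun x => f (iter i (family f r a) x))) x.
  by apply/funext => y; rewrite displacement_family fct_sumE.
have h : is_derive x 1 (\sum_(i < q) (fun x => f (iter i (family f r a) x)))
    (disp_d1 r a q x).
  by apply: is_derive_sum => i; exact: is_derive_comp_iter.
set c := _ - _; set S := \sum_(i < q) _ in h *.
have hc : is_derive x 1 (fun _ : R => c) 0 by exact: is_derive_cst.
have h' : is_derive x 1 (fun y => a * S y) (a * disp_d1 r a q x) by exact: is_deriveZ.
by have := @is_deriveD R R R (fun=> c) (fun y => a * S y) x 1 _ _ hc h'; rewrite add0r.
Qed.

Lemma is_derive_disp_d1 r a q x : is_derive x 1 (disp_d1 r a q) (disp_d2 r a q x).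
Proof.
have -> : disp_d1 r a q =
    \sum_(i < q) (fun x => f1 (iter i (family f r a) x) * iter_d1 r a i x).
  by apply/funext => y; rewrite fct_sumE.
apply: is_derive_sum => i.
have h1 := is_derive_comp_iter r a i x fd1; have h2 := is_derive_iter_d1 r a i x.
apply: is_derive_eq; rewrite -![_ *: _]/(_ * _); ring.
Qed.

Lemma iter_d_near k : exists2 K : R, 0 <= K & forall r a x, `|a| <= 1 ->
  `|iter_d1 r a k x - 1| <= K * `|a| /\ `|iter_d2 r a k x| <= K * `|a|.
Proof.
have M1' := M1.
elim: k => [|k [K K0 IH]]; first by exists 0 => // r a x _ /=; rewrite subrr normr0 mul0r.
exists (M * (1 + K) ^+ 2 + (1 + M) * K + M * (1 + K)) => [|r a x a1].
  by apply: addr_ge0; [apply: addr_ge0|]; apply: mulr_ge0 => //; rewrite ?sqr_ge0//; lra.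
have [h1 h2] := IH r a x a1 => /=.
set u := iter k _ x; set D := iter_d1 r a k x in h1 *; set E := iter_d2 r a k x in h2 *.
have a0 := normr_ge0 a.
have D1 : `|D| <= 1 + K.
  rewrite -[D](subrK 1) addrC; apply: le_trans (ler_normD _ _) _; rewrite normr1 lerD2l.
  by apply: le_trans h1 _; rewrite ler_piMr.
have b1 : `|a * f1 u| <= `|a| * M by rewrite normrM ler_wpM2l.
have b2 : `|1 + a * f1 u| <= 1 + M.
  apply: le_trans (ler_normD _ _) _; rewrite normr1 lerD2l; apply: le_trans b1 _.
  by rewrite ler_piMl//; lra.
have K2 : 0 <= (1 + K) by lra.
split.
  rewrite (_ : _ - 1 = (D - 1) + a * f1 u * D); last by ring.
  apply: le_trans (ler_normD _ _) _.
  have b3 : `|a * f1 u * D| <= `|a| * M * (1 + K) by rewrite normrM ler_pM.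
  have p1 : 0 <= M * (1 + K) ^+ 2 * `|a| by rewrite !mulr_ge0// ?sqr_ge0//; lra.
  have p2 : 0 <= M * K * `|a| by rewrite !mulr_ge0//; lra.
  lra.
apply: le_trans (ler_normD _ _) _.
have b3 : `|a * f2 u * D * D| <= `|a| * M * (1 + K) * (1 + K).
  by rewrite -!mulrA !normrM !mulrA; do 3 ?[apply: ler_pM => //; rewrite ?mulr_ge0//].
have b4 : `|(1 + a * f1 u) * E| <= (1 + M) * (K * `|a|) by rewrite normrM ler_pM.
have p1 : 0 <= M * (1 + K) * `|a| by rewrite !mulr_ge0//; lra.
by move: b3 b4 p1; rewrite expr2; lra.
Qed.

Lemma disp_term_near k : exists2 K : R, 0 <= K & forall r a v x, `|a| <= 1 ->
  `|iter k (family f r a) x - v| <= 2 * k%:R * M * `|a| ->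
  `|f1 (iter k (family f r a) x) * iter_d1 r a k x - f1 v| <= K * `|a| /\
  `|f2 (iter k (family f r a) x) * iter_d1 r a k x * iter_d1 r a k x +
    f1 (iter k (family f r a) x) * iter_d2 r a k x - f2 v| <= K * `|a|.
Proof.
have M1' := M1; have [K K0 HK] := iter_d_near k.
pose L : R := M * (2 * k%:R * M).
have L0 : 0 <= L by rewrite !mulr_ge0//; lra.
exists (M * (K * (2 + K)) + M * K + L) => [|r a v x a1].
  by apply: addr_ge0 => //; apply: addr_ge0; apply: mulr_ge0 => //; [lra|apply: mulr_ge0 => //; lra|lra].
set u := iter k _ x => uv; have [h1 h2] := HK r a x a1; have a0 := normr_ge0 a.
set D := iter_d1 r a k x in h1 *; set E := iter_d2 r a k x in h2 *.
have l1 : `|f1 u - f1 v| <= L * `|a|.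
  by apply: le_trans (f1lip _ _) _; rewrite /L -[leRHS]mulrA ler_wpM2l//; lra.
have l2 : `|f2 u - f2 v| <= L * `|a|.
  by apply: le_trans (f2lip _ _) _; rewrite /L -[leRHS]mulrA ler_wpM2l//; lra.
have D1 : `|D + 1| <= 2 + K.
  rewrite (_ : D + 1 = 2 + (D - 1)); last by ring.
  apply: le_trans (ler_normD _ _) _; rewrite ger0_norm// lerD2l.
  by apply: le_trans h1 _; rewrite ler_piMr.
have c1 : `|f1 u * (D - 1)| <= M * (K * `|a|) by rewrite normrM ler_pM.
have c2 : `|f2 u * ((D - 1) * (D + 1))| <= M * (K * `|a| * (2 + K)).
  by rewrite normrM ler_pM// normrM ler_pM.
have c3 : `|f1 u * E| <= M * (K * `|a|) by rewrite normrM ler_pM.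
have p2 : 0 <= M * K * (2 + K) * `|a| by rewrite !mulr_ge0//; lra.
split.
  rewrite (_ : _ - f1 v = f1 u * (D - 1) + (f1 u - f1 v)); last by ring.
  apply: le_trans (ler_normD _ _) _; lra.
rewrite (_ : _ - f2 v = f2 u * ((D - 1) * (D + 1)) + (f2 u - f2 v) + f1 u * E); last by ring.
apply: le_trans (ler_normD _ _) _.
have := ler_normD (f2 u * ((D - 1) * (D + 1))) (f2 u - f2 v); lra.
Qed.

(** [v] is meant to be the orbit of [x] under the rotation by 2 pi P / q, and [orbit_near] provides
    the hypothesis on it. The constant depends on [n], which stays fixed while [a] tends to 0. *)
Lemma disp_near n : exists2 K : R, 0 <= K & forall r a (v : nat -> R) x, `|a| <= 1 ->
  (forall i, (i < n)%N -> `|iter i (family f r a) x - v i| <= 2 * i%:R * M * `|a|) ->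
  `|disp_d1 r a n x - \sum_(i < n) f1 (v i)| <= K * `|a| /\
  `|disp_d2 r a n x - \sum_(i < n) f2 (v i)| <= K * `|a|.
Proof.
elim: n => [|n [K K0 IH]].
  by exists 0 => // r a v x _ _; rewrite /disp_d1 /disp_d2 !big_ord0 subrr normr0 mul0r.
have [L L0 HL] := disp_term_near n.
exists (K + L) => [|r a v x a1 hv]; first exact: addr_ge0.
have [h1 h2] := IH r a v x a1 (fun i ni => hv i (ltnW ni)).
have [g1 g2] := HL r a (v n) x a1 (hv n (ltnSn n)).
rewrite /disp_d1 /disp_d2 !big_ord_recr /= -!/(disp_d1 _ _ _ _) -!/(disp_d2 _ _ _ _).
rewrite -/(disp_d1 r a n x) -/(disp_d2 r a n x) mulrDl !opprD.
by split; rewrite addrACA; apply: le_trans (ler_normD _ _) _; exact: lerD.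
Qed.

(** The existence of one fixed point determines [r] up to O(a), since q (2 pi r) - 2 pi P is -a
    times a sum of q values of [f]. Every orbit is then close to the rigid rotation, not only that
    of [z]. *)
Lemma orbit_near r a q P z i x : (0 < q)%N -> (i <= q)%N ->
  return_map (family f r a) q P z = z ->
  `|iter i (family f r a) x - (x + 2 * pi * (i%:Z * P)%:~R / q%:R)| <= 2 * i%:R * M * `|a|.
Proof.
move=> q0 iq zz; have M1' := M1; have qR : 0 < q%:R :> R by rewrite ltr0n.
have sb n y : `|\sum_(j < n) f (iter j (family f r a) y)| <= n%:R * M.
  apply: le_trans (ler_norm_sum _ _ _) _; apply: (@le_trans _ _ (\sum_(j < n) M)).
    by apply: ler_sum.
  by rewrite sumr_const card_ord mulr_natl.
have H0 : displacement (family f r a) q P z = 0 by rewrite /displacement zz subrr.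
rewrite displacement_family in H0.
have h1 : `|2 * pi * r - 2 * pi * P%:~R / q%:R| <= M * `|a|.
  rewrite -(ler_pM2l qR) -{1}(gtr0_norm qR) -normrM.
  rewrite (_ : q%:R * (_ - _) = - (a * \sum_(j < q) f (iter j (family f r a) z))).
    by rewrite normrN normrM mulrC mulrA ler_wpM2r.
  have -> : q%:R * (2 * pi * r - 2 * pi * P%:~R / q%:R) =
      q%:R * (2 * pi * r) - P%:~R * (2 * pi) by field; rewrite gt_eqF.
  move: H0; set S := \sum_(j < q) _; lra.
rewrite iterE intrM -pmulrn.
rewrite (_ : _ - _ = i%:R * (2 * pi * r - 2 * pi * P%:~R / q%:R) +
   a * \sum_(j < i) f (iter j (family f r a) x)); last by field; rewrite gt_eqF.
apply: le_trans (ler_normD _ _) _; rewrite !normrM normr_nat.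
have p1 : i%:R * `|2 * pi * r - 2 * pi * P%:~R / q%:R| <= i%:R * (M * `|a|) by rewrite ler_wpM2l.
have p2 : `|a| * `|\sum_(j < i) f (iter j (family f r a) x)| <= `|a| * (i%:R * M) by rewrite ler_wpM2l.
lra.
Qed.

End Family.

Section Isolated.
Variables (R : realType) (delta : {posnum R}) (f : Comega delta).
Local Notation C := (R[i]).
Local Notation analytic := (@analytic_at (C : numFieldType)).

(** The continuation of [f] gives a complex extension of the displacement. Real points keep real
    orbits, so analyticity is needed only along the real axis, and the iterates never have to be
    followed through the strip. *)
Lemma family_isolated_zeros r a q P z :
  (forall e, 0 < e -> exists w, [/\ w != z, `|w - z| < e & displacement (family f r a) q P w = 0]) ->
  exists2 e, 0 < e & forall w, `|w - z| < e -> displacement (family f r a) q P w = 0.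
Proof.
move=> acc; have [ga gr] := Comega_continuation f.
set g := continuation _ _ in ga gr.
pose Fc (w : C) : C := w + (2 * pi * r)%:C%C + a%:C%C * g w.
have FcR (x : R) : Fc x%:C%C = (family f r a x)%:C%C.
  by rewrite /Fc gr /family !rmorphD !rmorphM.
have iR k (x : R) : iter k Fc x%:C%C = (iter k (family f r a) x)%:C%C.
  by elim: k => //= k ->; rewrite FcR.
have Fa (x : R) : analytic Fc x%:C%C.
  apply: analytic_atD; last first.
    by apply: analytic_atZ; apply: ga; rewrite /strip /= normr0.
  by apply: analytic_atD; [exact: analytic_at_id|exact: analytic_at_cst].
have ia k (x : R) : analytic (iter k Fc) x%:C%C.
  elim: k => [|k IH]; first exact: analytic_at_id.
  have Fk : analytic Fc (iter k Fc x%:C%C) by rewrite iR; exact: Fa.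
  exact: (analytic_at_comp IH Fk).
pose Hc (w : C) : C := iter q Fc w + (- (P%:~R * (2 * pi)))%:C%C + (-1) * w.
have HR (x : R) : Hc x%:C%C = (displacement (family f r a) q P x)%:C%C.
  by rewrite /Hc iR /displacement /return_map !rmorphD !rmorphN mulN1r.
have Ha : analytic Hc z%:C%C.
  apply: analytic_atD; last by apply: analytic_atZ; exact: analytic_at_id.
  by apply: analytic_atD; [exact: ia|exact: analytic_at_cst].
have nE (x y : R) : Normc.normc (x%:C%C - y%:C%C) = `|x - y| by rewrite -rmorphB normc_real.
have /nbhs_normcP[e e0 eP] : \forall w \near (z%:C%C : (C : numFieldType)), Hc w = 0.
  apply: zeros_cluster_near => // _ /gtc0E[e e0 ->].
  have [w [wz we Hw]] := acc e e0.
  exists w%:C%C; split; last by rewrite HR Hw.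
    by apply: contra wz => /eqP/complexI ->.
  by rewrite normc_normE nE ltcR.
exists e => // w we; have := eP w%:C%C; rewrite nE HR => /(_ we) /eqP.
by rewrite (inj_eq (@complexI R)) => /eqP.
Qed.

End Isolated.

Lemma trig_series_step (R : realType) (f : R -> R) (al be : nat -> R) (B rho : R) :
  0 <= B -> 0 <= rho < 1 -> geom_bounded al B rho -> geom_bounded be B rho ->
  trig_series f al be ->
  exists f1 : R -> R, exists2 M : R, 0 <= M & [/\ forall x, `|f x| <= M,
    forall x : R, is_derive x 1 f (f1 x),
    trig_series f1 (fun n => n%:R * be n) (fun n => - (n%:R * al n)) &
    exists2 B' : R, 0 <= B' & exists2 rho' : R, 0 <= rho' < 1 &
      geom_bounded (fun n => n%:R * be n) B' rho' /\
      geom_bounded (fun n => - (n%:R * al n)) B' rho'].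
Proof.
move=> B0 r1 gal gbe fs.
have [f1 [f1s fd]] := trig_series_derivable r1 gal gbe fs.
have [M M0 fM] := trig_series_bounded r1 gal gbe fs.
exists f1, M => //; split=> //.
have [B1 B10 [r2 /andP[r20 r21] h1]] := geom_bounded_natM r1 gal.
have [B2 B20 [r3 /andP[r30 r31] h2]] := geom_bounded_natM r1 gbe.
exists (B1 + B2); first exact: addr_ge0.
exists (Num.max r2 r3); first by rewrite le_max r20 gt_max r21.
split=> n.
  apply: le_trans (h2 n) _; apply: ler_pM => //; rewrite ?exprn_ge0 ?lerDr//.
  by rewrite lerXn2r ?nnegrE ?le_max ?r20 ?r30 ?lexx ?orbT.
rewrite normrN; apply: le_trans (h1 n) _; apply: ler_pM => //; rewrite ?exprn_ge0 ?lerDl//.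
by rewrite lerXn2r ?nnegrE ?le_max ?r20 ?r30 ?lexx ?orbT.
Qed.

Record smooth_trig (R : realType) (f f1 f2 : R -> R) (M : R) (al be : nat -> R) : Prop := {
  st_period : forall x, f (x + 2 * pi) = f x;
  st_d : forall x : R, is_derive x 1 f (f1 x);
  st_d1 : forall x : R, is_derive x 1 f1 (f2 x);
  st_M1 : 1 <= M;
  st_M : forall x, `|f x| <= M;
  st_1M : forall x, `|f1 x| <= M;
  st_2M : forall x, `|f2 x| <= M;
  st_lip1 : forall x y, `|f1 y - f1 x| <= M * `|y - x|;
  st_lip2 : forall x y, `|f2 y - f2 x| <= M * `|y - x|;
  st_s1 : trig_series f1 (fun n => n%:R * be n) (fun n => - (n%:R * al n));
  st_s2 : trig_series f2 (fun n => n%:R * - (n%:R * al n)) (fun n => - (n%:R * (n%:R * be n))) }.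

Lemma smooth_trig_exists (R : realType) (f : R -> R) (al be : nat -> R) (B rho : R) :
  (forall x, f (x + 2 * pi) = f x) ->
  0 <= B -> 0 <= rho < 1 -> geom_bounded al B rho -> geom_bounded be B rho ->
  trig_series f al be -> exists f1 f2 M, smooth_trig f f1 f2 M al be.
Proof.
move=> fp B0 r1 gal gbe fs.
have [f1 [M M0 [fM fd s1 [B1 B10 [r2 r21 [g1 g2]]]]]] := trig_series_step B0 r1 gal gbe fs.
have [f2 [M1 M10 [f1M fd1 s2 [B2 B20 [r3 r31 [g3 g4]]]]]] := trig_series_step B10 r21 g1 g2 s1.
have [f3 [M2 M20 [f2M fd2 s3 [B3 B30 [r4 r41 [g5 g6]]]]]] := trig_series_step B20 r31 g3 g4 s2.
(* The fourth step serves only to bound the third derivative, that is the Lipschitz constant of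
   [f2]. *)
have [f4 [M3 M30 [f3M _ _ _]]] := trig_series_step B30 r41 g5 g6 s3.
pose N := 1 + M + M1 + M2 + M3.
exists f1, f2, N; split=> //.
- by rewrite /N; lra.
- by move=> x; apply: le_trans (fM x) _; rewrite /N; lra.
- by move=> x; apply: le_trans (f1M x) _; rewrite /N; lra.
- by move=> x; apply: le_trans (f2M x) _; rewrite /N; lra.
- move=> x y; apply: le_trans (derive_bounded_lipschitz fd1 f2M x y) _.
  by rewrite ler_wpM2r// /N; lra.
- move=> x y; apply: le_trans (derive_bounded_lipschitz fd2 f3M x y) _.
  by rewrite ler_wpM2r// /N; lra.
Qed.

(* Averaging f over the orbits of the rotation by 2 pi p / q leaves only the
   frequencies q m; under this condition the one with m = 1 dominates the others in
   the first two derivatives. *)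
Definition dominant_harmonic (R : realType) (al be : nat -> R) (q : nat) :=
  0 < `|al q| /\ exists2 E : R, 20 * E <= q%:R ^+ 2 * `|al q| & forall L,
    \sum_(2 <= m < L) (q * m)%N%:R ^+ 2 * (`|al (q * m)%N| + `|be (q * m)%N|) <= E.

(** * Perturbation under a dominant harmonic *)

Section SmallPerturbation.
Variables (R : realType) (f f1 f2 : R -> R) (M : R) (al be : nat -> R).
Hypothesis st : smooth_trig f f1 f2 M al be.
Variables (p q : nat).
Hypothesis pq : coprime p q.
Hypothesis q0 : (0 < q)%N.

(** The factor 20 in [dominant_harmonic] yields half of the tolerance A / 10 of [attracting_unique],
    the other half being left for the error in [a]. The tail bound [E] for the second derivative
    gives E / q for the first, as all frequencies involved are at least q. *)
Lemma rotated_sum_near A : dominant_harmonic al be q ->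
  A ^+ 2 = al q ^+ 2 + be q ^+ 2 -> 0 < A -> forall x,
  `|\sum_(k < q) f1 (x + 2 * pi * (k * p)%:R / q%:R) -
    q%:R ^+ 2 * wave1 q%:R (al q) (be q) x| <= q%:R ^+ 2 * (A / 20) /\
  `|\sum_(k < q) f2 (x + 2 * pi * (k * p)%:R / q%:R) +
    q%:R ^+ 3 * wave q%:R (al q) (be q) x| <= q%:R ^+ 3 * (A / 20).
Proof.
move=> [a0 [E EA ES]] A2 A0 x; have qR : 0 < q%:R :> R by rewrite ltr0n.
have alA : `|al q| <= A.
  rewrite -(@ler_pXn2r _ 2)// ?nnegrE ?(ltW A0)// real_normK ?num_real// A2.
  by rewrite lerDl sqr_ge0.
have q2 : 0 < q%:R ^+ 2 :> R by rewrite exprn_gt0.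
have EA' : E <= q%:R ^+ 2 * (A / 20).
  have : q%:R ^+ 2 * `|al q| <= q%:R ^+ 2 * A by rewrite ler_pM2l.
  lra.
have b2 L : \sum_(2 <= m < L) (`|(q * m)%N%:R * - ((q * m)%N%:R * al (q * m)%N)| +
    `|- ((q * m)%N%:R * ((q * m)%N%:R * be (q * m)%N))|) <= E.
  apply: le_trans (ES L); apply: ler_sum => m _.
  by rewrite !normrM !normrN !normrM normr_nat mulrDr expr2 -!mulrA.
have b1 L : \sum_(2 <= m < L) (`|(q * m)%N%:R * be (q * m)%N| +
    `|- ((q * m)%N%:R * al (q * m)%N)|) <= E / q%:R.
  rewrite ler_pdivlMr// mulrC mulr_sumr; apply: le_trans (ES L).
  rewrite big_nat_cond [leRHS]big_nat_cond; apply: ler_sum => m /andP[/andP[m2 _] _].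
  rewrite normrN !normrM normr_nat -mulrDr mulrA addrC expr2 ler_wpM2r ?addr_ge0//.
  by rewrite ler_wpM2r// ler_nat leq_pmulr// (leq_trans _ m2).
have := trig_series_average x pq q0 (st_s1 st) b1.
have := trig_series_average x pq q0 (st_s2 st) b2.
rewrite !mul0r !add0r [q%:R * (E / q%:R)]mulrC divfK ?gt_eqF// => h2 h1; split.
  apply: le_trans EA'; apply: le_trans h1; rewrite le_eqVlt; apply/orP; left; apply/eqP.
  by congr (`| _ - _ |); rewrite /wave1; ring.
have EA3 : q%:R * E <= q%:R ^+ 3 * (A / 20).
  by rewrite exprS -mulrA ler_pM2l.
apply: le_trans EA3; apply: le_trans h2; rewrite le_eqVlt; apply/orP; left; apply/eqP.
by congr (`| _ |); rewrite -[in RHS]mulrN; congr (_ + _); rewrite /wave; ring.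
Qed.

(** [k] is the inverse of [p] modulo [q]: up to full turns, k rotations by 2 pi p / q advance by 2
    pi / q, the distance to the neighbouring point. The bound on [k] is what [orbit_near] asks. *)
Lemma inverse_step : exists k b : nat, (k <= q)%N /\ k%:Z * p%:Z = 1 + q%:Z * (p%:Z - b%:Z).
Proof.
have [a aq /dvdnP[b ab]] := Bezoutr p q0; exists (q - a)%N, b; split; first exact: leq_subr.
move: ab; rewrite (eqP pq) => ab.
have : 1 + a%:Z * p%:Z = b%:Z * q%:Z by rewrite -!PoszM -ab PoszD.
by rewrite -subzn ?(ltnW aq)//; lia.
Qed.

Lemma attracting_unique_near0 : dominant_harmonic al be q ->
  exists2 a1 : R, 0 < a1 & forall (r a : R) (j : int) (z1 z2 : R), a != 0 -> `|a| < a1 ->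
    let F := family f r a in let Phi := return_map F q (p%:Z + j * q%:Z) in
    Phi z1 = z1 -> Phi z2 = z2 -> attracting F (trajectory F z1) ->
    attracting F (trajectory F z2) -> trajectory F z1 = trajectory F z2.
Proof.
move=> dom; case: (dom) => al0 _; have qR : 0 < q%:R :> R by rewrite ltr0n.
have p0 := pi_gt0 R; have M1 := st_M1 st.
pose A : R := Num.sqrt (al q ^+ 2 + be q ^+ 2).
have A2 : A ^+ 2 = al q ^+ 2 + be q ^+ 2 by rewrite sqr_sqrtr// addr_ge0 ?sqr_ge0.
have A0 : 0 < A.
  rewrite sqrtr_gt0; apply: ltr_pwDl; last exact: sqr_ge0.
  by rewrite exprn_even_gt0//= -normr_gt0.
have near := rotated_sum_near dom A2 A0.
have [K K0 HK] := disp_near f (st_M1 st) (st_1M st) (st_2M st) (st_lip1 st) (st_lip2 st) q.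
have K1 : 0 < 20 * (K + 1) by lra.
pose c3 := 8 * q%:R ^+ 2 * M.
have c30 : 0 < c3 by rewrite /c3 !mulr_gt0 ?exprn_gt0//; lra.
(* In this order, the bounds serve the hypothesis of [disp_near], the monotonicity of the family,
   the error A / 20 in the derivatives of the displacement, and [Tnear]. *)
pose a1 : R := Num.min (Num.min 1 (2 * M)^-1) (Num.min (A / (20 * (K + 1))) (pi / c3)).
have a11 : a1 <= 1 by rewrite /a1 !ge_min lexx.
have a12 : a1 <= (2 * M)^-1 by rewrite /a1 !ge_min lexx orbT.
have a13 : a1 <= A / (20 * (K + 1)) by rewrite /a1 !ge_min lexx !orbT.
have a14 : a1 <= pi / c3 by rewrite /a1 !ge_min lexx !orbT.
exists a1 => [|r a j z1 z2 an0 aa1 F Phi zz1 zz2 at1 at2].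
  rewrite !lt_min ltr01 !divr_gt0// invr_gt0; lra.
have [k [b [kq kb]]] := inverse_step.
set P := p%:Z + j * q%:Z in Phi zz1 zz2 *.
pose l := p%:Z - b%:Z + k%:Z * j.
have kP : k%:Z * P = 1 + q%:Z * l by rewrite /P /l mulrDr kb; ring.
have aM : `|a| <= (2 * M)^-1 by lra.
have apos : 0 < `|a| by rewrite normr_gt0.
have ale1 : `|a| <= 1 by lra.
have onear i x : (i <= q)%N ->
    `|iter i F x - (x + 2 * pi * (i%:Z * P)%:~R / q%:R)| <= 2 * i%:R * M * `|a|.
  by move=> iq; exact: (orbit_near (st_M1 st) (st_M st) _ q0 iq zz1).
have Tnear x : `|return_map F k l x - x - 2 * pi / q%:R| <= pi / (4 * q%:R).
  have := onear k x kq; rewrite kP intrD intrM -pmulrn.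
  have -> : iter k F x - (x + 2 * pi * (1%:~R + q%:R * l%:~R) / q%:R) =
      return_map F k l x - x - 2 * pi / q%:R.
    by rewrite /return_map; field; rewrite gt_eqF.
  move=> h; apply: le_trans h _.
  apply: (@le_trans _ _ (2 * q%:R * M * (pi / c3))).
    apply: ler_pM; rewrite ?mulr_ge0 ?ler_wpM2r ?ler_wpM2l ?ler_nat//; lra.
  rewrite le_eqVlt; apply/orP; left; apply/eqP; rewrite /c3.
  by field; rewrite (gt_eqF qR) /=; apply/eqP; lra.
have snear i x : 2 * pi * (i%:Z * P)%:~R / q%:R + x =
   x + 2 * pi * (i * p)%:R / q%:R + (i%:Z * j)%:~R * (2 * pi) :> R.
  have -> : (i%:Z * P)%:~R = i%:R * (p%:R + j%:~R * q%:R) :> R.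
    by rewrite intrM /P intrD intrM -!pmulrn.
  by rewrite natrM intrM -pmulrn; field; rewrite gt_eqF.
have per (g : R -> R) : (forall x, g (x + 2 * pi) = g x) -> forall x (i : nat),
    g (x + 2 * pi * (i%:Z * P)%:~R / q%:R) = g (x + 2 * pi * (i * p)%:R / q%:R) :> R.
  by move=> gp x i; rewrite [x + _]addrC snear (periodic_int gp).
have p1 := derive_periodic (st_period st) (st_d st).
have p2 := derive_periodic p1 (st_d1 st).
(* Dividing the displacement by the absolute value of [a] leaves this sign, which is absorbed into
   the coefficients of the harmonic. *)
pose s : R := Num.sg a.
have s2 : s ^+ 2 = 1 by rewrite /s sqr_sg an0.
have sn : `|s| = 1 by rewrite /s normr_sg an0.
pose v x (i : nat) : R := x + 2 * pi * (i%:Z * P)%:~R / q%:R.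
have dn x := HK r a (v x) x ale1 (fun i iq => onear i x (ltnW iq)).
have Ka : K * `|a| <= A / 20.
  have : K * `|a| <= (K + 1) * (A / (20 * (K + 1))) by apply: ler_pM => //; lra.
  have -> : (K + 1) * (A / (20 * (K + 1))) = A / 20 by field; apply/eqP; lra.
  by [].
have qq : 1 <= q%:R :> R by rewrite ler1n.
have q2 : 1 <= q%:R ^+ 2 :> R by rewrite exprn_ege1.
have q3 : 1 <= q%:R ^+ 3 :> R by rewrite exprn_ege1.
have A20 : 0 <= A / 20 by lra.
have w2 := ler_wpM2r A20 q2; have w3 := ler_wpM2r A20 q3.
have harm1 x : wave1 q%:R (s * al q) (s * be q) x = s * wave1 q%:R (al q) (be q) x.
  by rewrite /wave1; ring.
have harm x : wave q%:R (s * al q) (s * be q) x = s * wave q%:R (al q) (be q) x.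
  by rewrite /wave; ring.
have X := (@attracting_unique R F 2 _ _ _ q k P l q0 Tnear `|a|^-1 A (s * al q) (s * be q)
  (q%:R ^+ 2) (q%:R ^+ 3) (fun x => s * disp_d1 f f1 r a q x)
  (fun x => s * disp_d2 f f1 f2 r a q x) z1 z2).
apply: X => //.
- exact: (family_2pi (st_period st)).
- by rewrite ler1n.
- exact: (family_lip (st_d st) (st_M1 st) (st_1M st) r aM).
- by rewrite invr_gt0.
- by rewrite !exprMn s2 !mul1r A2.
- by rewrite exprn_gt0.
- by rewrite exprn_gt0.
- move=> x; have h := is_derive_disp (st_d st) r a q P x.
  have := @is_deriveZ R R R (displacement F q P) `|a|^-1 x 1 _ h.
  suff -> : `|a|^-1 *: (a * disp_d1 f f1 r a q x) = s * disp_d1 f f1 r a q x by [].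
  rewrite -[LHS]/(_ * _) mulrA {2}[a]numEsg [Num.sg a * _]mulrC mulrA mulVf ?mul1r//.
  by rewrite normr_eq0.
- move=> x; exact: (@is_deriveZ R R R _ s x 1 _ (is_derive_disp_d1 (st_d st) (st_d1 st) r a q x)).
- move=> x; rewrite harm1 mulrCA -mulrBr normrM sn mul1r.
  have [h1 _] := dn x; have [h2 _] := near x.
  have E : \sum_(i < q) f1 (v x i) = \sum_(k < q) f1 (x + 2 * pi * (k * p)%:R / q%:R).
    by apply: eq_bigr => i _; exact: per.
  rewrite E in h1; apply: le_trans (ler_distD (\sum_(k < q) f1 (x + 2 * pi * (k * p)%:R / q%:R)) _ _) _.
  lra.
- move=> x; rewrite harm mulrCA -mulrDr normrM sn mul1r.
  have [_ h1] := dn x; have [_ h2] := near x.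
  have E : \sum_(i < q) f2 (v x i) = \sum_(k < q) f2 (x + 2 * pi * (k * p)%:R / q%:R).
    by apply: eq_bigr => i _; exact: per.
  rewrite E in h1; rewrite -[X in _ + X]opprK.
  apply: le_trans (ler_distD (\sum_(k < q) f2 (x + 2 * pi * (k * p)%:R / q%:R)) _ _) _.
  rewrite opprK; lra.
Qed.

End SmallPerturbation.

(** * Rotation numbers and periodic points *)

Section Rotation.
Variables (R : realType) (F : R -> R) (Lam : R).
Hypothesis F2pi : forall x, F (x + 2 * pi) = F x + 2 * pi.
Hypothesis Finc : forall x y, x < y -> F x < F y.
Hypothesis Lam1 : 1 <= Lam.
Hypothesis Flip : forall x y, `|F x - F y| <= Lam * `|x - y|.
Variables (p q : nat).
Hypothesis pq : coprime p q.
Hypothesis q0 : (0 < q)%N.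

(** A point that returns after n steps and j turns has j / n = P / q with [P = p + i q] prime to q.
    So n = m q and j = m P, and the point is fixed by the m-th iterate of the return map, hence by
    the return map itself. *)
Lemma periodic_fixed : has_rotation_number F (p%:R / q%:R) ->
  exists j : int, forall z, circle_periodic F z ->
    return_map F q (p%:Z + j * q%:Z) z = z.
Proof.
move=> [i Hi]; exists i => z [n n0 [j zj]].
have qR : 0 < q%:R :> R by rewrite ltr0n.
have nR : 0 < n%:R :> R by rewrite ltr0n.
have E := rotation_of_periodic F2pi n0 (Hi z) zj.
set P := p%:Z + i * q%:Z.
have jq : j * q%:Z = P * n%:Z.
  apply: (@mulrIz R 1 (oner_neq0 _)); rewrite -!/(_%:~R) !intrM /P intrD intrM -!pmulrn.
  have : j%:~R = (p%:R / q%:R + i%:~R) * n%:R :> R by rewrite -E divfK// gt_eqF.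
  by move=> ->; field; rewrite gt_eqF.
have qn : (q %| n)%N.
  have : (q%:Z %| P * n%:Z)%Z by rewrite -jq dvdz_mull.
  rewrite Gauss_dvdzr //; rewrite /coprimez -[gcdz _ _]gcdzC /P.
  by rewrite addrC gcdzC gcdzMDl /gcdz /= gcdnC; exact/eqP/(congr1 Posz)/eqP.
have [m nE] := dvdnP qn; have m0 : (0 < m)%N by move: n0; rewrite nE muln_gt0 => /andP[].
have jE : j = m%:Z * P.
  apply: (@mulIf _ q%:Z); first by rewrite gt_eqF// ltz_nat.
  by rewrite jq nE PoszM; ring.
apply: (@return_fixed_of_iter R F Finc q P m.-1); rewrite prednK//.
have := iter_return F2pi q P 0 m z; rewrite add0n -nE zj jE /=.
by move=> h; exact/esym/(addIr _ h).
Qed.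

Lemma two_sinks_of_num_attracting : has_rotation_number F (p%:R / q%:R) ->
  ~ (num_attracting F <= 1%:E)%E -> exists (j : int) x1 y1 x2 y2,
    two_sinks F q (p%:Z + j * q%:Z) x1 y1 x2 y2.
Proof.
move=> rot N1; have [j Hj] := periodic_fixed rot; exists j.
have [//|nT] := pselect (exists x1 y1 x2 y2, two_sinks F q (p%:Z + j * q%:Z) x1 y1 x2 y2).
case: N1; apply/counting_le1P => O1 O2 [z1 [c1 -> A1]] [z2 [c2 -> A2]].
have [//|O12] := pselect (trajectory F z1 = trajectory F z2); case: nT.
have ts := two_sinks_of_attracting F2pi Lam1 Flip q0 (Hj _ c1) (Hj _ c2) A1 A2 O12.
exact: ts.
Qed.

Lemma num_attracting_two_sinks (j : int) (x1 y1 x2 y2 : R) :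
  (forall z, (forall e, 0 < e -> exists w, [/\ w != z, `|w - z| < e &
      displacement F q (p%:Z + j * q%:Z) w = 0]) ->
    exists2 e, 0 < e & forall w, `|w - z| < e ->
      displacement F q (p%:Z + j * q%:Z) w = 0) ->
  two_sinks F q (p%:Z + j * q%:Z) x1 y1 x2 y2 ->
  has_rotation_number F (p%:R / q%:R) /\ ~ (num_attracting F <= 1%:E)%E.
Proof.
move=> iso ts; have qR : 0 < q%:R :> R by rewrite ltr0n.
have [z1 [z2 [zz1 zz2 A1 A2 O12]]] := attracting_of_two_sinks F2pi Finc Lam1 Flip q0 iso ts.
split.
  exists j => x; have := rotation_of_fixed F2pi Finc q0 zz1 x.
  suff -> : (p%:Z + j * q%:Z)%:~R / q%:R = p%:R / q%:R + j%:~R :> R by [].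
  by rewrite intrD intrM -!pmulrn; field; rewrite gt_eqF.
move=> /counting_le1P N1; apply: O12; apply: N1.
  by exists z1; split=> //; exact: fixed_periodic zz1.
by exists z2; split=> //; exact: fixed_periodic zz2.
Qed.

End Rotation.

Lemma counting_gt1 (T : choiceType) (R : realType) (X : set T) :
  ~ ((counting X : \bar R) <= 1%:E)%E -> ((2%:R)%:E <= (counting X : \bar R))%E.
Proof.
rewrite /counting; case: ifP => _; last by rewrite leey.
rewrite !lee_fin (_ : 1 = 1%:R)// !ler_nat => /negP; by rewrite -ltnNge.
Qed.

(** * Borel measurability of the condition *)

Section Wild.
Variables (R : realType) (delta : {posnum R}).
Local Notation X := (Comega delta).
Implicit Types (f g : X) (p q m k : nat).

Lemma Comega_smooth f : exists (f1 f2 : R -> R) M al be, smooth_trig f f1 f2 M al be.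
Proof.
have d0 : 0 < delta%:num by [].
have [|al [be [B B0 [gal gbe fs]]]] := @Comega_trig_series _ delta f (delta%:num / 2).
  by rewrite divr_gt0//= ltr_pdivrMr// ltr_pMr// ltr1n.
have r1 : 0 <= expR (- (delta%:num / 2) : R) < 1.
  by rewrite expR_ge0 expR_lt1 oppr_lt0 divr_gt0.
have [f1 [f2 [M st]]] := smooth_trig_exists (Comega_periodic f) B0 r1 gal gbe fs.
by exists f1, f2, M, al, be.
Qed.

(** A union over uncountably many parameters, yet measurable, because each member is open. The bound
    on [a] is discretized so that the limit [a] to 0 becomes a countable operation. *)
Definition wild p q m : set X := [set f | exists (a r : R) (j : int) (x1 y1 x2 y2 : R),
  `|a| < m.+1%:R^-1 /\ two_sinks (family f r a) q (p%:Z + j * q%:Z) x1 y1 x2 y2].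

Lemma near_forall_lt (F : set_system X) (Q : nat -> X -> Prop) n : Filter F ->
  (forall k, (k < n)%N -> \forall g \near F, Q k g) ->
  \forall g \near F, forall k, (k < n)%N -> Q k g.
Proof.
move=> FF; elim: n => [|n IH] H; first by apply: nearW.
have h1 := IH (fun k kn => H k (ltnW kn)); have h2 := H n (ltnSn n).
near=> g => k; rewrite ltnS leq_eqVlt => /orP[/eqP->|kn]; first by near: g.
by have : forall k, (k < n)%N -> Q k g by [near: g]; apply.
Unshelve. all: by end_near. Qed.

Section Near.
Variables (f : X) (F : set_system X).
Context {FF : Filter F}.
Hypothesis Ff : forall e, 0 < e -> \forall g \near F, `|f - g| < e.

Lemma iter_family_cvg (r a x : R) k :
  (fun g : X => iter k (family g r a) x) @ F --> iter k (family f r a) x.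
Proof.
elim: k => [|k IH] /=; first exact: cvg_cst.
set u := iter k (family f r a) x.
have ev : (fun g : X => (f : R -> R) (iter k (family g r a) x)) @ F --> (f : R -> R) u.
  by move=> B nB; have := IH _ (Comega_continuous (f := f) (x := u) nB).
have ap : (fun g : X => (g : R -> R) (iter k (family g r a) x)) @ F --> (f : R -> R) u.
  apply/cvgrPdist_lt => e e0; have e2 : 0 < e / 2 by rewrite divr_gt0.
  move/cvgrPdist_lt : ev => /(_ _ e2) h1; have h2 := Ff e2.
  near=> g.
  have g1 : `|(f : R -> R) u - (f : R -> R) (iter k (family g r a) x)| < e / 2 by near: g.
  have g2 : `|f - g| < e / 2 by near: g.
  set v := iter k (family g r a) x in g1 *.
  have g3 : `|(f : R -> R) v - (g : R -> R) v| <= `|f - g| by exact: (Comega_le_norm (f - g) v).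
  rewrite (_ : _ - _ = ((f : R -> R) u - (f : R -> R) v) + ((f : R -> R) v - (g : R -> R) v)); last by ring.
  apply: le_lt_trans (ler_normD _ _) _; lra.
rewrite /Defs.family.
apply: cvgD; last exact: cvgMr.
by apply: cvgD; [exact: IH|exact: cvg_cst].
Unshelve. all: by end_near. Qed.

Lemma wild_near p q m : wild p q m f -> \forall g \near F, wild p q m g.
Proof.
move=> [a [r [j [x1 [y1 [x2 [y2 [am [h1 h2 [s1 s2 s3 s4] sep]]]]]]]]].
set P := p%:Z + j * q%:Z in s1 s2 s3 s4.
have ic k x := @iter_family_cvg r a x k.
have dc x : (fun g : X => displacement (family g r a) q P x) @ F --> displacement (family f r a) q P x.
  apply: cvgB; last exact: cvg_cst.
  by apply: cvgB; [exact: ic|exact: cvg_cst].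
have n1 := @cvgr_gt R X F FF _ _ (dc x1) _ s1; have n2 := @cvgr_lt R X F FF _ _ (dc y1) _ s2.
have n3 := @cvgr_gt R X F FF _ _ (dc x2) _ s3; have n4 := @cvgr_lt R X F FF _ _ (dc y2) _ s4.
have n5 : \forall g \near F, forall k, (k < q)%N -> exists j0 : int,
    y1 + j0%:~R * (2 * pi) < iter k (family (g : X) r a) x2 /\
    iter k (family g r a) y2 < x1 + (j0 + 1)%:~R * (2 * pi).
  apply: near_forall_lt => k kq; have [j0 [j1 j2]] := sep k kq.
  have m1 := @cvgr_gt R X F FF _ _ (ic k x2) _ j1; have m2 := @cvgr_lt R X F FF _ _ (ic k y2) _ j2.
  by near=> g; exists j0; split; near: g.
near=> g; exists a, r, j, x1, y1, x2, y2; split=> //; split=> //; last by near: g.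
by split; near: g.
Unshelve. all: by end_near. Qed.

End Near.

Lemma wild_open p q m : open (wild p q m).
Proof.
rewrite openE => f Wf; rewrite /interior.
apply: (@wild_near f (nbhs f) (nbhs_filter f) _ p q m Wf) => e e0.
by apply/nbhs_ballP; exists e => // g; rewrite -ball_normE.
Qed.

Lemma two_sinks_a_neq0 f (r a : R) q P (x1 y1 x2 y2 : R) :
  two_sinks (family f r a) q P x1 y1 x2 y2 -> a != 0.
Proof.
move=> [_ _ [h1 h2 _ _] _]; apply/eqP => a0; move: h1 h2.
by rewrite !displacement_family a0 !mul0r !addr0 => h1 h2; have := lt_trans h1 h2; rewrite ltxx.
Qed.

(** Having two sinks for small [a] does not involve [a0] and forces the rotation number p / q modulo
    1. The limsup over parameters of given rotation number thus becomes a countable combination of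
    open sets. *)
Lemma ICeP f : @ICe R 1 delta f <-> exists Q, forall p q, coprime p q -> (0 < q)%N ->
  (Q <= q)%N -> exists m, ~ wild p q m f.
Proof.
have [f1 [f2 [M [al [be st]]]]] := Comega_smooth f; have M1 := st_M1 st.
have M0 : 0 < (2 * M)^-1 by rewrite invr_gt0; lra.
have F2pi r a := family_2pi (st_period st) r a.
have Finc r a := @family_lt R f f1 M (st_d st) (st_M1 st) (st_1M st) r a.
have Flip r a := @family_lip R f f1 M (st_d st) (st_M1 st) (st_1M st) r a.
have L1 : 1 <= 2 :> R by rewrite ler1n.
split=> [[a0 [a00 dif [Q HQ]]]|[Q HQ]].
  exists Q => p q pq q0 Qq; have := HQ p q pq q0 Qq.
  rewrite /infinitesimal_cyclicity => cyc.
  (* Counts jump from 1 to 2, and the strict bound by 2 can be realized by one member of the infimum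
     that defines the limsup. *)
  have {}cyc := le_lt_trans cyc (_ : (1%:E < 2%:E)%E).
  have [|_ [V FV <-] Vlt] := ereal_inf_lt (cyc _); first by rewrite lte_fin ltr1n.
  move: FV => [e /= e0 eV].
  pose b : R := Num.min (e / 2) (Num.min a0 (2 * M)^-1).
  have b0 : 0 < b by rewrite !lt_min a00 M0 divr_gt0.
  have be2 : b <= e / 2 by rewrite ge_min lexx.
  have ba0 : b <= a0 by rewrite !ge_min lexx orbT.
  have bM : b <= (2 * M)^-1 by rewrite !ge_min lexx !orbT.
  have Ve : V (e / 2).
    apply: eV => /=; last by rewrite divr_gt0.
    by rewrite /ball_ /= sub0r normrN gtr0_norm ?divr_gt0// ltr_pdivrMr// ltr_pMr// ltr1n.
  exists (Num.bound b^-1) => -[a [r [j [x1 [y1 [x2 [y2 [am ts]]]]]]]].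
  have ab : `|a| < b.
    apply: lt_trans am _; rewrite -[ltRHS]invrK ltf_pV2 ?posrE ?invr_gt0//.
    apply: lt_le_trans (archi_boundP _) _; first by rewrite invr_ge0 ltW.
    by rewrite ler_nat.
  have aM : `|a| <= (2 * M)^-1 by lra.
  have iso := family_isolated_zeros (f := f) (r := r) (a := a) (q := q) (P := p%:Z + j * q%:Z).
  have [rot N2] := num_attracting_two_sinks (F2pi r a) (Finc r a aM) L1 (Flip r a aM) q0 iso ts.
  have {}N2 := counting_gt1 N2.
  have : (2%:R%:E < 2%:R%:E :> \bar R)%E.
    apply: le_lt_trans Vlt; apply: le_trans N2 _.
    apply: (@le_trans _ _ (ereal_sup [set num_attracting (family f u.1 u.2) | u in
      [set u : R * R | [/\ `|u.2| <= a0, `|u.2| < e / 2 &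
        has_rotation_number (family f u.1 u.2) (p%:R / q%:R)]]])).
      by apply: ereal_sup_ubound; exists (r, a) => //=; split=> //; lra.
    by apply: ereal_sup_ubound; exists (e / 2).
  by rewrite ltxx.
exists (2 * M)^-1; split; first exact: M0.
  by move=> r a; exact: (family_diffeo (st_period st) (st_d st) (st_d1 st) (st_M1 st) (st_1M st)).
exists Q => p q pq q0 Qq; have [m Hm] := HQ p q pq q0 Qq.
rewrite /infinitesimal_cyclicity /limf_esup.
pose V : set R := [set t | 0 < t < m.+1%:R^-1].
apply: (@le_trans _ _ (ereal_sup ((fun a1 : R => ereal_sup [set num_attracting (family f u.1 u.2) | u in
      [set u : R * R | [/\ `|u.2| <= (2 * M)^-1, `|u.2| < a1 &
        has_rotation_number (family f u.1 u.2) (p%:R / q%:R)]]]) @` V))).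
  apply: ereal_inf_lbound; exists V => //.
  exists m.+1%:R^-1 => /=; first by rewrite invr_gt0 ltr0n.
  move=> t /=; rewrite sub0r normrN => t1 t0; rewrite /V /= t0 /=.
  by move: t1; rewrite gtr0_norm.
apply: ge_ereal_sup => _ [a1 /andP[a10 a1m] <-].
apply: ge_ereal_sup => _ [[r a] /= [aM aa1 rot] <-].
have [//|N1] := pselect (num_attracting (family f r a) <= 1%:R%:E)%E.
have [j [x1 [y1 [x2 [y2 ts]]]]] := two_sinks_of_num_attracting
  (F2pi r a) (Finc r a aM) L1 (Flip r a aM) pq q0 rot N1.
by case: Hm; exists a, r, j, x1, y1, x2, y2; split=> //; exact: lt_trans a1m.
Qed.

Lemma borel_ICe : borel_set (~` @ICe R 1 delta).
Proof.
suff : measurable (@ICe R 1 delta : set (g_sigma_algebraType (@open X))).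
  by move/measurableC.
have -> : @ICe R 1 delta = \bigcup_Q \bigcap_p \bigcap_q
    (if [&& coprime p q, (0 < q)%N & (Q <= q)%N] then \bigcup_m ~` wild p q m else setT).
  apply/seteqP; split=> f.
    move=> /ICeP[Q HQ]; exists Q => // p _ q _.
    case: ifP => // /and3P[pq q0 Qq]; have [m Hm] := HQ p q pq q0 Qq.
    by exists m.
  move=> [Q _ HQ]; apply/ICeP; exists Q => p q pq q0 Qq.
  by have := HQ p Logic.I q Logic.I; rewrite pq q0 Qq => -[m _ Hm]; exists m.
apply: bigcupT_measurable => Q; apply: bigcapT_measurable => p.
apply: bigcapT_measurable => q; case: ifP => _; last exact: measurableT.
apply: bigcupT_measurable => m; apply: measurableC.
by apply: sub_sigma_algebra; exact: wild_open.
Qed.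

Lemma not_wild_of_dominant f (f1 f2 : R -> R) M al be p q : smooth_trig f f1 f2 M al be ->
  coprime p q -> (0 < q)%N -> dominant_harmonic al be q -> exists m, ~ wild p q m f.
Proof.
move=> st pq q0 dom; have M1 := st_M1 st.
have [a1 a10 H] := attracting_unique_near0 st pq q0 dom.
pose b : R := Num.min a1 (2 * M)^-1.
have M0 : 0 < (2 * M)^-1 by rewrite invr_gt0; lra.
have b0 : 0 < b by rewrite !lt_min a10.
have ba1 : b <= a1 by rewrite ge_min lexx.
have bM : b <= (2 * M)^-1 by rewrite ge_min lexx orbT.
exists (Num.bound b^-1) => -[a [r [j [x1 [y1 [x2 [y2 [am ts]]]]]]]].
have ab : `|a| < b.
  apply: lt_trans am _; rewrite -[ltRHS]invrK ltf_pV2 ?posrE ?invr_gt0//.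
  apply: lt_le_trans (archi_boundP _) _; first by rewrite invr_ge0 ltW.
  by rewrite ler_nat.
have aM : `|a| <= (2 * M)^-1 by lra.
have L1 : 1 <= 2 :> R by rewrite ler1n.
have iso := family_isolated_zeros (f := f) (r := r) (a := a) (q := q) (P := p%:Z + j * q%:Z).
have [z1 [z2 [zz1 zz2 A1 A2]]] := attracting_of_two_sinks (family_2pi (st_period st) r a)
  (family_lt (st_d st) (st_M1 st) (st_1M st) r aM) L1
  (family_lip (st_d st) (st_M1 st) (st_1M st) r aM) q0 iso ts.
by apply; apply: (H r a j z1 z2 (two_sinks_a_neq0 ts)) => //; lra.
Qed.

End Wild.

(** * Haar nullity *)

Section Line.
Variables (R : realType) (X : normedModType R).
Local Notation borel := (g_sigma_algebraType (@open X)).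
Local Notation U01 := (uniform_prob (@ltr01 R)).

Lemma line_measurable (h x : X) :
  measurable_fun setT (fun w : measurableTypeR R => (w *: h - x : borel)).
Proof.
apply: (@measurability _ _ (measurableTypeR R) borel setT _ (@open X) erefl) => _ [U oU <-]; rewrite setTI.
apply: open_measurable; apply: open_comp => // w _.
by apply: cvgB; [exact: scalel_continuous|exact: cvg_cst].
Qed.

Lemma haar_null_line (h : X) (E : set X) : borel_set E ->
  (forall x, U01 [set w | E (w *: h - x)] = 0%E) -> haar_null E.
Proof.
move=> bE HE; split=> //.
have mh : measurable_fun setT (fun w : measurableTypeR R => (w *: h : borel)).
  by have := line_measurable h 0; under eq_fun do rewrite subr0.
pose phi : {mfun measurableTypeR R >-> borel} :=
  HB.pack (fun w : measurableTypeR R => (w *: h : borel)) (isMeasurableFun.Build _ _ _ _ _ mh).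
exists (distribution U01 phi) => x; rewrite -[RHS](HE x) /distribution /pushforward.
congr (uniform_prob _ _); apply/seteqP; split=> w /=.
  by move=> [y Ey <-]; rewrite addrAC subrr add0r.
by move=> Ew; exists (w *: h - x) => //; rewrite addrC subrK.
Qed.

Lemma uniform_prob_le (A : set (measurableTypeR R)) : measurable A ->
  (U01 A <= lebesgue_measure A)%E.
Proof.
move=> mA; rewrite /uniform_prob -[leRHS]mul1e -(integral_cst _ mA).
apply: ge0_le_integral => //= [x _||x _].
- by rewrite lee_fin uniform_pdf_ge0.
- by apply/measurable_EFinP/measurable_funTS; exact: measurable_uniform_pdf.
- by rewrite lee_fin /uniform_pdf subr0 invr1; case: ifP.
Qed.

Lemma uniform_prob_itv (A : set (measurableTypeR R)) : U01 A = U01 (A `&` `[0, 1]).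
Proof. by rewrite /uniform_prob integral_uniform_pdf. Qed.

Lemma uniform_prob_centered_itv (c e : R) : 0 <= e -> (U01 `](c - e)%R, (c + e)%R[ <= (2 * e)%:E)%E.
Proof.
move=> e0; apply: le_trans (uniform_prob_le (measurable_itv _)) _.
rewrite lebesgue_measure_itv /=; case: ifP => _; last by rewrite lee_fin mulr_ge0.
by rewrite -EFinB lee_fin; lra.
Qed.

Lemma uniform_prob_limsup (D tau : R) (c e : nat -> R) : 0 <= D -> 0 <= tau < 1 ->
  (forall n, 0 <= e n) -> (forall n, 2 * e n <= D * tau ^+ n) ->
  U01 (lim_sup_set (fun n => `](c n - e n), (c n + e n)[%classic)) = 0%E.
Proof.
move=> D0 t1 e0 eD; apply: lim_sup_set_cvg0 => [k|]; first exact: measurable_itv.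
apply: (@le_lt_trans _ _ (D / (1 - tau))%:E); last by rewrite ltry.
apply: lime_le; first by apply: is_cvg_nneseries => n _ _; exact: measure_ge0.
apply: nearW => n; apply: (@le_trans _ _ (\sum_(0 <= i < n) (D * tau ^+ i)%:E)%E).
  apply: lee_sum => i _; apply: le_trans (uniform_prob_centered_itv _ (e0 i)) _.
  by rewrite lee_fin.
by rewrite sumEFin lee_fin; exact: geom_sum_le.
Qed.

End Line.

Lemma trig_series_line (R : realType) (g h : R -> R) (al be al' be' : nat -> R) (w : R) :
  trig_series g al be -> trig_series h al' be' ->
  trig_series (fun x => w * h x + g x) (fun n => w * al' n + al n) (fun n => w * be' n + be n).
Proof.
move=> gs hs x.
have -> : series (trig_term (fun n => w * al' n + al n) (fun n => w * be' n + be n) x) =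
    (fun n => w * series (trig_term al' be' x) n + series (trig_term al be x) n).
  apply/funext => n; rewrite /series /= mulr_sumr -big_split /=.
  by apply: eq_bigr => i _; rewrite /trig_term; ring.
by apply: cvgD; [apply: cvgMr; exact: hs|exact: gs].
Qed.

(** The square is the weight of a second derivative in [dominant_harmonic]; it is paid for by
    passing from the rate [r] to [s]. *)
Lemma sqr_geom_bounded (R : realType) (r s : R) : 0 <= r -> r < s ->
  exists2 B : R, 0 <= B & forall n : nat, n%:R ^+ 2 * r ^+ n <= B * s ^+ n.
Proof.
move=> r0 rs; have s0 : 0 < s by apply: le_lt_trans rs.
have x1 : 0 <= r / s < 1 by rewrite divr_ge0 ?(ltW s0)//= ltr_pdivrMr// mul1r.
have g0 : geom_bounded (fun n => (r / s) ^+ n) 1 (r / s).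
  by move=> n; rewrite mul1r ger0_norm// exprn_ge0//; case/andP: x1.
have [B1 B10 [x2 x21 g1]] := geom_bounded_natM x1 g0.
have [B2 B20 [x3 /andP[x30 x31] g2]] := geom_bounded_natM x21 g1.
exists B2 => // n.
have h : n%:R * (n%:R * (r / s) ^+ n) <= B2.
  apply: le_trans (ler_norm _) _; apply: le_trans (g2 n) _.
  by rewrite ler_piMr// exprn_ile1// ltW.
rewrite -ler_pdivrMr ?exprn_gt0//; move: h; rewrite expr_div_n expr2.
by rewrite !mulrA.
Qed.

(** The weighted coefficients from frequency 2q on sum to O(s^(2q)), so a q-th coefficient above a
    multiple of this dominates. The added 1 keeps it nonzero when the tail bound is 0. *)
Lemma dominant_of_gap (R : realType) (al be : nat -> R) (A r s B : R) q :
  0 <= A -> 0 < s < 1 -> 0 <= B -> (forall n : nat, n%:R ^+ 2 * r ^+ n <= B * s ^+ n) ->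
  (forall n, `|al n| + `|be n| <= A * r ^+ n) -> (0 < q)%N ->
  (20 * (A * B / (1 - s)) + 1) * (s ^+ 2) ^+ q <= `|al q| -> dominant_harmonic al be q.
Proof.
move=> A0 /andP[s0 s1] B0 rB abA q0 gap.
have E0 : 0 <= A * B / (1 - s) by rewrite divr_ge0 ?mulr_ge0//; lra.
have sq : 0 < (s ^+ 2) ^+ q by rewrite !exprn_gt0.
split.
  by apply: lt_le_trans gap; rewrite mulr_gt0//; lra.
exists (A * B / (1 - s) * (s ^+ 2) ^+ q) => [|L].
  have q2 : 1 <= q%:R ^+ 2 :> R by rewrite exprn_ege1// ler1n.
  have : `|al q| <= q%:R ^+ 2 * `|al q| by rewrite ler_peMl.
  lra.
have s01 : 0 <= s < 1 by rewrite ltW.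
have AB : 0 <= A * B * (s ^+ 2) ^+ q by rewrite !mulr_ge0// ltW.
apply: (@le_trans _ _ (\sum_(0 <= k < L - 2) (A * B * (s ^+ 2) ^+ q) * s ^+ k)); last first.
  by apply: le_trans (geom_sum_le _ AB s01) _; rewrite mulrAC.
rewrite -{1}[2%N]add0n big_addn; apply: ler_sum => m _.
apply: (@le_trans _ _ (A * ((q * (m + 2))%N%:R ^+ 2 * r ^+ (q * (m + 2))))).
  by rewrite [leRHS]mulrCA ler_wpM2l ?sqr_ge0.
have -> : A * B * (s ^+ 2) ^+ q * s ^+ m = A * (B * ((s ^+ 2) ^+ q * s ^+ m)) by rewrite !mulrA.
rewrite ler_wpM2l//; apply: le_trans (rB _) _; rewrite ler_wpM2l//.
(* As q is positive, q (m + 2) is at least 2q + m, which leaves a geometric series in m. *)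
rewrite -exprM -exprD ler_wiXn2l ?(ltW s0) ?(ltW s1)//.
by rewrite mulnDr [(q * m + _)%N]addnC [(q * 2)%N]mulnC leq_add2l leq_pmull.
Qed.

Section Prevalence.
Variables (R : realType) (delta : {posnum R}).
Local Notation X := (Comega delta).
Local Notation d := (delta%:num).

(* rho < exp(-d) is needed for the Poisson kernel to be bounded on the strip, while
   the tails of order exp(-2 eta q), eta < d, must be negligible with respect to
   rho ^ q.  With s ^ 2 = rho tau the exceptional intervals have length O(tau ^ q). *)
Let rho : R := expR (- (7 * d / 6)).
Let s : R := expR (- (2 * d / 3)).
Let r : R := expR (- (3 * d / 4)).
Let tau : R := expR (- (d / 6)).

Let d0 : 0 < d. Proof. by []. Qed.

Let expN1 (x : R) : 0 < x -> 0 < expR (- x) < 1.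
Proof. by move=> x0; rewrite expR_gt0 expR_lt1 oppr_lt0. Qed.

Let rho01 : 0 < rho < 1. Proof. by apply: expN1; rewrite divr_gt0 ?mulr_gt0. Qed.

Let rho_lt : rho * expR d < 1.
Proof. have := d0; rewrite -expRD expR_lt1; lra. Qed.

Let h : X := MkComega (poisson_in_Comega rho01 rho_lt).

Lemma ICe_complement_line_null (g : X) :
  uniform_prob (@ltr01 R) [set w | (~` @ICe R 1 delta) (w *: h - g)] = 0%E.
Proof.
have dd := d0.
have s01 : 0 < s < 1 by apply: expN1; lra.
have tau01 : 0 <= tau < 1 by have /andP[/ltW -> ->] : 0 < tau < 1 by apply: expN1; lra.
have r01 : 0 <= r < 1 by have /andP[/ltW -> ->] : 0 < r < 1 by apply: expN1; lra.
have rs : r < s by rewrite ltr_expR; lra.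
have rhor : rho <= r by rewrite ler_expR; lra.
have s2E : s ^+ 2 = rho * tau.
  by rewrite expr2 -!expRD; congr expR; field.
have [B B0 rB] := sqr_geom_bounded (andP r01).1 rs.
have [|al [be [C C0 [gal gbe gs]]]] := @Comega_trig_series _ delta (- g) (3 * d / 4).
  by apply/andP; split; lra.
(* The coefficients of [- g] contribute [C] twice, cosine and sine, and those of [w *: h] at most 2.
   This holds for all [w] in [0, 1] at once, which is why the measure is restricted to this interval
   below. *)
pose A : R := 2 * C + 2; have A0 : 0 <= A by rewrite /A; lra.
pose K : R := 20 * (A * B / (1 - s)) + 1.
have K0 : 0 < K.
  have s1 : 0 <= 1 - s by case/andP: s01 => _ ?; rewrite subr_ge0 ltW.
  have : 0 <= A * B / (1 - s) by rewrite divr_ge0// mulr_ge0.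
  by rewrite /K; lra.
case/andP: (rho01) => rho0 rho1.
(* The cosine coefficient 2 rho^q w + al q vanishes exactly at w = [c q]. At distance at least [e q]
   from there it is at least K (rho tau)^q = K s^(2q), the threshold of [dominant_of_gap]. *)
pose c q : R := - al q / (2 * rho ^+ q).
pose e q : R := K * tau ^+ q / 2.
have e0 q : 0 <= e q by rewrite /e divr_ge0// mulr_ge0 ?(ltW K0)// exprn_ge0//; case/andP: tau01.
have eK q : 2 * e q <= K * tau ^+ q by rewrite /e mulrC divfK.
have lim0 := uniform_prob_limsup c (ltW K0) tau01 e0 eK.
set L := lim_sup_set _ in lim0.
set N := [set w | _].
have mN : measurable (N : set (measurableTypeR R)).
  have := line_measurable h g (@measurableT _ _) (@borel_ICe R delta).
  by rewrite setTI.
rewrite uniform_prob_itv.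
suff NL : N `&` `[0, 1] `<=` L.
  have mL : measurable (L : set (measurableTypeR R)).
    apply: bigcapT_measurable => n; apply: bigcup_measurable => k _; exact: measurable_itv.
  have mNI : measurable (N `&` `[0, 1] : set (measurableTypeR R)).
    by apply: measurableI => //; exact: measurable_itv.
  apply/eqP; rewrite -measure_le0 -lim0; apply: le_measure => //; exact: mem_set.
move=> w [Nw /=]; rewrite in_itv /= => /andP[w0 w1].
have [//|nL] := pselect (L w); exfalso; apply: Nw.
have [Q HQ] : exists Q, forall q, (Q <= q)%N -> ~ (c q - e q < w < c q + e q).
  have [//|nQ] := pselect (exists Q, forall q, (Q <= q)%N -> ~ (c q - e q < w < c q + e q)).
  case: nL => Q _; have [//|nq] := pselect ((\bigcup_(j >= Q) `](c j - e j), (c j + e j)[%classic) w).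
  by case: nQ; exists Q => q Qq cq; apply: nq; exists q => //; rewrite /= in_itv.
pose f : X := w *: h - g.
pose alw n := w * (2 * rho ^+ n) + al n.
pose bew n := w * 0 + be n.
have fs : trig_series f alw bew.
  exact: (@trig_series_line R _ _ _ _ _ _ w gs (poisson_trig_series rho01)).
have rn n : rho ^+ n <= r ^+ n by rewrite lerXn2r ?nnegrE ?(ltW rho0)//; case/andP: r01.
have rn0 n : 0 <= r ^+ n by rewrite exprn_ge0//; case/andP: r01.
have abA n : `|alw n| + `|bew n| <= A * r ^+ n.
  have h1 : `|alw n| <= 2 * r ^+ n + C * r ^+ n.
    apply: le_trans (ler_normD _ _) _; apply: lerD; last exact: gal.
    have p0 : 0 <= rho ^+ n by rewrite exprn_ge0// ltW.
    rewrite ger0_norm; last by rewrite !mulr_ge0.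
    apply: (@le_trans _ _ (1 * (2 * rho ^+ n))); first by rewrite ler_wpM2r// mulr_ge0.
    by rewrite mul1r ler_wpM2l.
  have h2 : `|bew n| <= C * r ^+ n by rewrite /bew mulr0 add0r; exact: gbe.
  by rewrite /A; lra.
have gaw : geom_bounded alw A r by move=> n; apply: le_trans (abA n); rewrite lerDl.
have gbw : geom_bounded bew A r by move=> n; apply: le_trans (abA n); rewrite lerDr.
have [f1 [f2 [M st]]] := smooth_trig_exists (Comega_periodic f) A0 r01 gaw gbw fs.
apply/ICeP; exists Q => p q pq q0 Qq.
apply: (not_wild_of_dominant st pq q0).
apply: (dominant_of_gap A0 s01 B0 rB abA q0).
have pq0 : 0 < 2 * rho ^+ q by rewrite mulr_gt0// exprn_gt0.
rewrite -/K s2E exprMn leNgt; apply/negP => lt; apply: (HQ q Qq).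
have : `|w - c q| < e q.
  rewrite -(ltr_pM2l pq0) -{1}(gtr0_norm pq0) -normrM.
  have -> : 2 * rho ^+ q * (w - c q) = alw q.
    by rewrite /alw /c mulrBr [2 * _ * (_ / _)]mulrCA divff ?gt_eqF// mulr1 opprK mulrC.
  by have -> : 2 * rho ^+ q * e q = K * (rho ^+ q * tau ^+ q) by rewrite /e; field.
by rewrite ltr_norml => /andP[? ?]; apply/andP; split; lra.
Qed.

End Prevalence.

Theorem theorem4 (R : realType) (delta : {posnum R}) :
  haar_prevalent (@ICe R 1 delta).
Proof.
by apply: haar_null_line; [exact: borel_ICe|exact: ICe_complement_line_null].
Qed.
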